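(* Let $\mathcal P$ be a set of primes with positive density, satisfying the Siegel--Walfisz condition with squarefree modulus $B$, and having a positive level of distribution (as in the context). Let $r\ge2$ and for $1\le i\le r$ fix reals $0<a_i<b_i$, and let $\mathcal P_i$ be the set of $p\in\mathcal P$ with $p\in[N^{a_i},N^{b_i}]$. Let $F_r(\mathcal P)=\{\prod_{i=1}^rp_i: p_i\in\mathcal P_i,\ p_i\text{ pairwise distinct}\}$ and let $\beta_r$ be its indicator function. Then for any $u\in\mathbb R$, $\varepsilon>0$ and $A>0$, $$\sum_{\substack{q\le N^{\frac12u-\varepsilon}\\(q,B)=1}}\max_{(a,q)=1}\left|\sum_{n<N^u}\left(\frac{1}{\phi(q)}\beta_r(n;q)-\beta_r(n;q,a)\right)\right|\ll\frac{N^u}{(\log N)^A}$$ as $N\to\infty$, with implied constant depending only on $u$, $A$ and $\varepsilon$.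
   Context: Density: $\#\{p\in\mathcal P:p\le x\}=(1+o(1))\delta x/\log x$ with $\delta>0$. Siegel--Walfisz: there is a squarefree positive integer $B$ with $|\pi_{\mathcal P}(x;q,a)-\pi_{\mathcal P}(x)/\phi(q)|\ll x/(\log x)^A$ for $(q,B)=1,(a,q)=1$, every $A>0$. Level of distribution $\theta_1>0$: $\sum_{q<x^{\theta_1},(q,B)=1}\max_{(a,q)=1}|\pi_{\mathcal P}(x;q,a)-\pi_{\mathcal P}(x)/\phi(q)|\ll x/(\log x)^A$ for every $A>0$, where $\pi_{\mathcal P}(x;q,a)$ counts $p\in\mathcal P$, $p\le x$, $p\equiv a\pmod q$. $\beta_r(n;q,a)=\beta_r(n)$ if $n\equiv a\pmod q$, else $0$; $\beta_r(n;q)=\beta_r(n)$ if $(n,q)=1$, else $0$. *)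

(* Defs.v *)
From HB Require Import structures.
From mathcomp Require Import all_boot all_order all_algebra.
From mathcomp Require Import all_classical all_reals all_analysis.
Set Implicit Arguments.
Unset Strict Implicit.
Unset Printing Implicit Defensive.
Import Order.TTheory GRing.Theory Num.Theory.
Import numFieldNormedType.Exports.
Local Open Scope classical_set_scope.
Local Open Scope ring_scope.

Definition squarefree (B : nat) : Prop :=
  (0 < B)%N /\ forall d : nat, (d ^ 2 %| B)%N -> d = 1%N.

(* Sums over positive integers below a real bound run up to its integer part;
   strict bounds are recovered by an explicit filter. *)

Definition primes_upto (R : realType) (P : set nat) (x : R) : nat :=
  (\sum_(1 <= p < (Num.truncn x).+1 | p \in P) 1)%N.

Definition primes_upto_ap (R : realType) (P : set nat) (x : R) (q a : nat) :
    nat :=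
  (\sum_(1 <= p < (Num.truncn x).+1 | (p \in P) && (p == a %[mod q])) 1)%N.

Definition has_density (R : realType) (P : set nat) (delta : R) : Prop :=
  (fun x : R => (primes_upto P x)%:R / (delta * x / ln x)) @ +oo --> (1 : R).

Definition ap_error (R : realType) (P : set nat) (x : R) (q a : nat) : R :=
  `| (primes_upto_ap P x q a)%:R - (primes_upto P x)%:R / (totient q)%:R |.

Definition siegel_walfisz (R : realType) (P : set nat) (B : nat) : Prop :=
  forall A : R, 0 < A -> exists C : R,
    forall (x : R) (q a : nat), 2 <= x -> (0 < q)%N ->
      coprime q B -> coprime a q ->
      ap_error P x q a <= C * (x / ln x `^ A).

(* The unit 0 makes this the maximum only for nonnegative f. *)
Definition max_reduced (R : realType) (q : nat) (f : nat -> R) : R :=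
  \big[Num.max/0]_(a < q | coprime a q) f a.

Definition has_level (R : realType) (P : set nat) (B : nat) (theta : R) :
    Prop :=
  forall A : R, 0 < A -> exists C : R, forall x : R, 2 <= x ->
    \sum_(1 <= q < (Num.truncn (x `^ theta)).+1
           | (q%:R < x `^ theta) && coprime q B)
       max_reduced q (ap_error P x q)
    <= C * (x / ln x `^ A).

Definition prime_products (R : realType) (P : set nat) (r : nat)
    (a b : 'I_r -> R) (N : R) : set nat :=
  [set n | exists p : 'I_r -> nat,
    [/\ forall i, P (p i) /\ N `^ a i <= (p i)%:R <= N `^ b i,
        injective p
      & n = (\prod_(i < r) p i)%N]].

Definition beta (R : realType) (P : set nat) (r : nat) (a b : 'I_r -> R)
    (N : R) (n : nat) : R :=
  \1_(prime_products P a b N) n.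

Definition coprime_part (R : realType) (f : nat -> R) (q n : nat) : R :=
  if coprime n q then f n else 0.

Definition ap_part (R : realType) (f : nat -> R) (q c n : nat) : R :=
  if n == c %[mod q] then f n else 0.

(* Main.v *)
(**
The proof is the classical large sieve treatment of a bilinear form, run without
characters: the indicator of [x = y mod f], times [totient f], is the sum over
[d %| f] of kernels [primitive_kernel d x y], which stand for the sum of
[chi x * (chi y)^-1] over the primitive characters modulo [d] and are orthogonal
idempotents for convolution on the units.  Cauchy-Schwarz then bounds the error
of [al m * la p] in progressions modulo [q] by the energies of [al] and [la] in
the conductors [d > 1] dividing [q].

A function with values on the units modulo [d] that is primitive in this sense is
also orthogonal to all functions of smaller additive period, so its energy is at
most that of the exponential sum at the fractions [a / d] in lowest terms, and the
additive large sieve (Gallagher's proof, on a finite cyclic group that contains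
all these fractions) controls conductors [d > D0] on dyadic blocks.  Conductors
[d <= D0], with [D0] a power of [ln N], are controlled by Siegel-Walfisz.

To reach a bilinear form, a product [n] of [r] primes is counted once for each of
its primes [p]; whether [n = m * p] is admissible depends on [p] only through the
set of intervals [[N^a_i, N^b_i]] that contain it, provided that [p] does not
divide [m].  Cutting the range of [p] into short geometric intervals replaces the
condition [m * p < N^u] by a condition on [m] alone, up to the few [n] close to
[N^u] and those divisible by the square of a large prime.
*)
Require Import Defs.
From HB Require Import structures.
From mathcomp Require Import all_boot all_order all_algebra.
From mathcomp Require Import all_classical all_reals all_analysis.
From mathcomp Require Import zify ring lra.
Set Implicit Arguments.
Unset Strict Implicit.
Unset Printing Implicit Defensive.
Import Order.TTheory GRing.Theory Num.Theory.
Import numFieldNormedType.Exports.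
Local Open Scope classical_set_scope.
Local Open Scope ring_scope.

(** * Residues prime to the modulus *)

(** The obstacle is that a bilinear form is only controlled when both of its variables are long.
    With [z = s ^+ 2] below all left endpoints of the intervals, the prime singled out is at least
    [z], and as [2 <= r] the cofactor still contains such a prime; the large sieve terms with an
    extra square root of a length then gain [s], a fixed power of [N]. The term that decreases with
    the conductor gains only [D0], while conductors up to [D0] lose [D0 ^ 2]: this is why [D0] is a
    power of [ln N], large enough to win and small enough for Siegel-Walfisz to pay for it.
    Equidistribution is asked of the prime variable alone; the cofactors, about which nothing is
    known, are bounded trivially. All bounds for bilinear forms are free of the residue [a], so the
    maximum over residues costs nothing. *)

Lemma eqn_mod_mul2l (d t c c' : nat) : coprime t d ->
  (t * c == t * c' %[mod d]) = (c == c' %[mod d]).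
Proof.
move=> td; wlog lcc : c c' / (c' <= c)%N => [H|].
  by case: (leqP c' c) => [|/ltnW] lcc; [|rewrite eq_sym [RHS]eq_sym]; apply: H.
by rewrite !eqn_mod_dvd ?leq_mul2l ?lcc ?orbT // -mulnBr Gauss_dvdr // coprime_sym.
Qed.

Lemma sum_unit_mul (V : nmodType) (d t : nat) (F : nat -> V) :
  (forall c, F (c %% d)%N = F c) -> coprime t d ->
  \sum_(c < d | coprime c d) F c = \sum_(c < d | coprime c d) F (t * c)%N.
Proof.
case: d => [|d] Fmod td; first by rewrite !big_ord0.
pose h (c : 'I_d.+1) : 'I_d.+1 := Ordinal (ltn_pmod (t * c) (ltn0Sn d)).
have hinj : injective h.
  move=> c c' /(congr1 val) /= /eqP; rewrite eqn_mod_mul2l // => h1.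
  by apply: val_inj => /=; move: h1; rewrite !modn_small // => /eqP.
rewrite (reindex_inj hinj) /=; apply: eq_big => c.
  by rewrite coprime_modl coprimeMl td.
by move=> _; rewrite Fmod.
Qed.

Lemma sum_units_fiber (V : nmodType) (q l : nat) (F : nat -> V) :
  (l %| q)%N -> (0 < q)%N ->
  \sum_(c < q | coprime c q) F c =
  \sum_(b < l | coprime b l) \sum_(c < q | coprime c q && (c == b %[mod l])) F c.
Proof.
move=> lq q0; have l0 := dvdn_gt0 q0 lq.
pose h (c : 'I_q) : 'I_l := Ordinal (ltn_pmod c l0).
rewrite (partition_big h (fun b : 'I_l => coprime b l)) /=.
  apply: eq_bigr => b _; apply: eq_bigl => c.
  by rewrite -val_eqE /= [(b %% l)%N]modn_small.
by move=> c cq; rewrite coprime_modl (coprime_dvdr lq).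
Qed.

Lemma totientE_sum (q : nat) : (\sum_(c < q | coprime c q) 1)%N = totient q.
Proof.
rewrite totient_count_coprime big_mkord big_mkcond /=.
by apply: eq_bigr => c _; rewrite coprime_sym; case: coprime.
Qed.

(* Adding to [b] a multiple [l * t], with [t] divisible by exactly the primes of
   [q] not dividing [b], makes it prime to [q]. *)
Lemma coprime_lift (q l b : nat) : (0 < q)%N -> (0 < l)%N -> coprime b l ->
  exists2 c, coprime c q & c == b %[mod l].
Proof.
move=> q0 l0; wlog b0 : b / (0 < b)%N => [H bl|bl].
  have [||c cq cb] := H (l + b)%N; first by rewrite addn_gt0 l0.
    by rewrite coprime_sym /coprime gcdnDl -[_ == _]/(coprime l b) coprime_sym.
  by exists c => //; rewrite (eqP cb) modnDl.
pose t := (q`_(negn \pi(b)))%N; exists (b + l * t)%N; last first.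
  by rewrite mulnC addnC modnMDl.
rewrite /coprime eqn_leq gcdn_gt0 q0 orbT andbT leqNgt; apply/negP => /pdiv_prime.
set p := pdiv _ => pp.
have : (p %| gcdn (b + l * t) q)%N by apply: pdiv_dvd.
rewrite dvdn_gcd => /andP[p1 pq].
case: (boolP (p %| b)%N) => pb.
  have : (p %| l * t)%N by rewrite -(dvdn_addr _ pb).
  rewrite Euclid_dvdM // => /orP[pl|pt].
    have : (p %| gcdn b l)%N by rewrite dvdn_gcd pb pl.
    by rewrite (eqP bl) Euclid_dvd1.
  have := part_pnat (negn \pi(b)) q.
  rewrite -/t => /pnatP; rewrite part_gt0 => /(_ isT p pp pt).
  by rewrite inE /= mem_primes pp b0 pb.
have pt : (p %| t)%N.
  have pbN : p \in negn \pi(b) by rewrite inE /= mem_primes (negPf pb) !andbF.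
  apply: dvdn_trans (_ : q`_p %| _)%N; last by apply: sub_in_partn => r _; rewrite inE /=
      => /eqP ->.
  by rewrite p_part dvdn_exp // logn_gt0 mem_primes pp q0.
by move: p1; rewrite dvdn_addl ?(negPf pb) // dvdn_mull.
Qed.

(** Reduction from units modulo [q] to units modulo [l] has fibres of equal size: multiplication by
    a unit modulo [q] lifting [m] carries the fibre over 1 to the fibre over [m]. *)
Lemma card_units_fiber (q l n : nat) : (l %| q)%N -> (0 < q)%N -> coprime n l ->
  ((\sum_(c < q | coprime c q) (c == n %[mod l])) * totient l = totient q)%N.
Proof.
move=> lq q0 nl; have l0 := dvdn_gt0 q0 lq.
pose S n := (\sum_(c < q | coprime c q) (c == n %[mod l]))%N.
have S1 m : coprime m l -> S m = S 1%N.
  move=> ml; have [t tq tm] := coprime_lift q0 l0 ml.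
  rewrite /S (sum_unit_mul (F := fun c => nat_of_bool (c == m %[mod l])) _ tq).
    apply: eq_bigr => c _; congr nat_of_bool.
    have tl : coprime t l by apply: coprime_dvdr lq tq.
    rewrite -(eqP tm) -{2}[t]muln1.
    by rewrite eqn_mod_mul2l.
  by move=> c; rewrite modn_dvdm.
rewrite -[LHS]/(S n * totient l)%N S1 // -[in RHS]totientE_sum.
apply/esym; apply: etrans (@sum_units_fiber nat _ _ (fun _ => 1%N) lq q0) _.
apply/esym.
rewrite -totientE_sum big_distrr /=; apply: eq_bigr => b bl.
rewrite muln1 -(S1 b bl) /S big_mkcondr /=.
by apply: eq_bigr => c _; case: eqP.
Qed.

(** The value 1 at exponent 0 lets products run over all primes of a range, whether or not they
    divide the number. *)
Definition totient_local (p e : nat) : nat :=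
  if e is e'.+1 then (p.-1 * p ^ e')%N else 1%N.

(** A range of primes common to several numbers lets the next two lemmas compare totients factor by
    factor. *)
Lemma totient_prod (n N : nat) : (0 < n)%N -> (n < N)%N ->
  totient n = (\prod_(p < N | prime p) totient_local p (logn p n))%N.
Proof.
move=> n0 nN; rewrite totientE //.
rewrite -(big_mkord (fun p => prime p) (fun p => totient_local p (logn p n))).
rewrite [RHS](bigID (fun p => p \in primes n)) /= [X in _ = (_ * X)%N]big1 ?muln1.
  rewrite -[RHS]big_filter.
  apply: etrans (_ : \prod_(p <- primes n) totient_local p (logn p n) = _)%N.
    rewrite big_seq [RHS]big_seq; apply: eq_bigr => p; rewrite -logn_gt0 /totient_local.
    by case: logn.
  apply: perm_big; apply: uniq_perm; rewrite ?primes_uniq ?filter_uniq ?iota_uniq //.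
  move=> r; rewrite mem_filter mem_index_iota.
  case: (boolP (r \in primes n)) => [|rn]; last by rewrite andbF.
  rewrite mem_primes => /and3P[-> _ /(dvdn_leq n0) rn] /=.
  by rewrite (leq_ltn_trans rn).
by move=> p /andP[pp]; rewrite -logn_gt0 lt0n negbK => /eqP ->.
Qed.

Lemma totient_lcm_gcd (f g : nat) : (0 < f)%N -> (0 < g)%N ->
  (totient (lcmn f g) * totient (gcdn f g) = totient f * totient g)%N.
Proof.
move=> f0 g0; have fg0 : (0 < f * g)%N by rewrite muln_gt0 f0.
have tE n : (0 < n)%N -> (n <= f * g)%N -> totient n = _ :=
  fun n0 nfg => totient_prod n0 (nfg : (n < (f * g).+1)%N).
rewrite !tE ?lcmn_gt0 ?gcdn_gt0 ?f0 ?leq_pmulr ?leq_pmull //; last first.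
- by rewrite -muln_lcm_gcd leq_pmulr // gcdn_gt0 f0.
- by apply: dvdn_leq => //; apply: dvdn_trans (dvdn_gcdl f g) (dvdn_mulr _ _).
rewrite -!big_split /=; apply: eq_bigr => p pp.
(* At each prime, [lcmn] and [gcdn] carry the exponents of [f] and [g] in some order. *)
have : (logn p (lcmn f g) + logn p (gcdn f g) = logn p f + logn p g)%N.
  by rewrite -!lognM ?muln_lcm_gcd // ?lcmn_gt0 ?gcdn_gt0 f0.
rewrite logn_gcd //; case: (leqP (logn p f) (logn p g)) => _ /eqP.
  by rewrite addnC eqn_add2l => /eqP ->; rewrite mulnC.
by rewrite eqn_add2r => /eqP ->.
Qed.

(** The factors at [p] agree unless [p] divides both numbers, where the right side has [p] in place
    of one [p.-1]. A conductor and its complementary divisor may share such primes. *)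
Lemma leq_totientM (d e : nat) : (0 < d)%N -> (0 < e)%N ->
  (totient d * totient e <= totient (d * e))%N.
Proof.
move=> d0 e0; have de0 : (0 < d * e)%N by rewrite muln_gt0 d0.
have tE n : (0 < n)%N -> (n <= d * e)%N -> totient n = _ :=
  fun n0 nde => totient_prod n0 (nde : (n < (d * e).+1)%N).
rewrite !tE ?leq_pmulr ?leq_pmull // -big_split /=; apply: leq_prod => p pp.
rewrite lognM //; case: (logn p d) => [|i]; first by rewrite mul1n.
case: (logn p e) => [|j]; first by rewrite muln1 addn0.
rewrite addSn /= addnS expnS expnD -!mulnA leq_mul2l mulnCA leq_mul2r leq_pred.
by rewrite !orbT.
Qed.

Lemma crt_dvd_gcd (f g x y : nat) : (0 < f)%N -> (0 < g)%N ->
  x == y %[mod gcdn f g] ->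
  exists n, (n == x %[mod f]) && (n == y %[mod g]).
Proof.
(* A representative of [y] modulo [g] that is not below [x], so that the natural subtraction
   [y' - x] is exact. *)
move=> f0 g0 xy; pose y' := (y + x * g)%N.
have xy' : (x <= y')%N by rewrite /y' -[X in (X <= _)%N]add0n leq_add // leq_pmulr.
have : (gcdn f g %| y' - x)%N.
  rewrite -eqn_mod_dvd // (eqP xy) /y' addnC.
  by rewrite -modnDml (eqP (dvdn_mull _ (dvdn_gcdr f g))) add0n.
case/dvdnP => w hw; case: (egcdnP g f0) => u v uv _.
exists (x + u * f * w)%N; apply/andP; split.
  by rewrite mulnAC addnC modnMDl.
rewrite uv mulnDl addnCA mulnAC modnMDl [(gcdn f g * _)%N]mulnC -hw subnKC //.
by rewrite /y' addnC modnMDl.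
Qed.

(** Two congruences either contradict each other modulo [gcdn f g] or amount to one class of units
    modulo [lcmn f g], whose fibre count is rewritten through [totient_lcm_gcd]. *)
Lemma card_units_crt (q f g x y : nat) :
  (0 < q)%N -> (f %| q)%N -> (g %| q)%N -> coprime x q -> coprime y q ->
  ((\sum_(c < q | coprime c q) ((c == x %[mod f]) && (c == y %[mod g])))
    * (totient f * totient g)
  = totient q * (totient (gcdn f g) * (x == y %[mod gcdn f g])))%N.
Proof.
move=> q0 fq gq xq yq; have f0 := dvdn_gt0 q0 fq; have g0 := dvdn_gt0 q0 gq.
case: (boolP (x == y %[mod gcdn f g])) => xy; last first.
  rewrite big1 ?muln0 // => c _; apply/eqP; rewrite eqb0; apply: contra xy.
  move=> /andP[/eqP cx /eqP cy]; apply/eqP.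
  by rewrite -(modn_dvdm x (dvdn_gcdl f g)) -cx modn_dvdm ?dvdn_gcdl // -(modn_dvdm y
      (dvdn_gcdr f g)) -cy modn_dvdm ?dvdn_gcdr.
have [n /andP[nx ny]] := crt_dvd_gcd f0 g0 xy.
have lq : (lcmn f g %| q)%N by rewrite dvdn_lcm fq.
have nl : coprime n (lcmn f g).
  apply: (@coprime_dvdr _ (f * g)).
    by rewrite -muln_lcm_gcd dvdn_mulr.
  rewrite coprimeMr -coprime_modl (eqP nx) coprime_modl (coprime_dvdr fq xq).
  by rewrite -coprime_modl (eqP ny) coprime_modl (coprime_dvdr gq yq).
rewrite muln1 -(card_units_fiber lq q0 nl) -totient_lcm_gcd // mulnA; congr (_ * _ * _)%N.
apply: eq_bigr => c _; congr nat_of_bool; rewrite -(eqP nx) -(eqP ny).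
case: (leqP n c) => h; first by rewrite !eqn_mod_dvd // dvdn_lcm.
rewrite [X in X && _]eq_sym [X in _ && X]eq_sym [RHS]eq_sym.
by rewrite !eqn_mod_dvd ?(ltnW h) // dvdn_lcm.
Qed.

Lemma unit_inverse (d t : nat) : (0 < d)%N -> coprime t d ->
  exists2 t', coprime t' d & t * t' == 1 %[mod d].
Proof.
move=> d0 td; case: (posnP t) => [t0|t0].
  move: td; rewrite t0 /coprime gcd0n => /eqP ->.
  by exists 0%N; rewrite ?modn1.
case: (egcdnP d t0) => u v; rewrite (eqP td) => uv _.
have tu : t * u == 1 %[mod d] by rewrite mulnC uv modnMDl.
exists u => //; have : coprime (t * u) d by rewrite -coprime_modl (eqP tu) coprime_modl
    coprime1n.
by rewrite coprimeMl => /andP[].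
Qed.

(** * Primitive kernels *)

Section DivisorInversion.
Variable V : zmodType.
Implicit Types (H S : nat -> V).

(** The argument [n] is fuel for the recursion over proper divisors; any [n] above [d] gives the
    same value. *)
Fixpoint dinv_rec H (n d : nat) : V :=
  if n is n'.+1 then H d - \sum_(f < d | (f %| d)%N) dinv_rec H n' f else 0.

(* Moebius inversion over the divisors of [d], see [sum_dinv]; locked, as
   unification would otherwise unfold the recursion. *)
Definition dinv H (d : nat) : V := locked dinv_rec H d.+1 d.

Lemma dinv_recE H d : dinv H d = dinv_rec H d.+1 d.
Proof. by rewrite /dinv; unlock. Qed.

Lemma dinvE H d : dinv H d = H d - \sum_(f < d | (f %| d)%N) dinv H f.
Proof.
suff stable n e : (e < n)%N -> dinv_rec H n e = dinv_rec H e.+1 e.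
  rewrite dinv_recE /=; congr (_ - _); apply: eq_bigr => f _.
  by rewrite dinv_recE stable.
elim/ltn_ind: n e => n IH e; case: n IH => // n IH en.
rewrite [LHS]/= [RHS]/=; congr (_ - _); apply: eq_bigr => f _; have fe := ltn_ord f.
transitivity (dinv_rec H f.+1 f); [|apply/esym]; apply: IH => //.
exact: leq_trans fe _.
Qed.

Lemma sum_dvdn_widen H d n : (0 < d)%N -> (d < n)%N ->
  \sum_(f < n | (f %| d)%N) H f = \sum_(f < d.+1 | (f %| d)%N) H f.
Proof.
move=> d0 dn; rewrite (big_ord_widen_cond _ (fun f => f %| d)%N H dn).
apply: eq_bigl => f; case: (boolP (f %| d)%N) => // /(dvdn_leq d0) fd.
by rewrite ltnS fd.
Qed.

Lemma sum_dinv H d n : (0 < d)%N -> (d < n)%N ->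
  \sum_(f < n | (f %| d)%N) dinv H f = H d.
Proof.
move=> d0 dn; rewrite sum_dvdn_widen // big_mkcond big_ord_recr -big_mkcond /=.
by rewrite dvdnn [X in _ + X]dinvE addrC subrK.
Qed.

Lemma eq_dinv H H' d : (0 < d)%N -> (forall f, (f %| d)%N -> H f = H' f) ->
  dinv H d = dinv H' d.
Proof.
elim/ltn_ind: d => d IH d0 HH; rewrite dinvE [RHS]dinvE HH //; congr (_ - _).
apply: eq_bigr => f fd; apply: IH => //; first exact: dvdn_gt0 fd.
by move=> g gf; apply: HH; apply: dvdn_trans fd.
Qed.

(** By induction only the term [S d] survives in its own divisor sum. Identities between primitive
    kernels can thus be checked after summing over divisors. *)
Lemma sum_dvdn_eq0 S q n : (0 < q)%N -> (q < n)%N ->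
  (forall d, (d %| q)%N -> \sum_(f < n | (f %| d)%N) S f = 0) ->
  forall d, (d %| q)%N -> S d = 0.
Proof.
move=> q0 qn HS; elim/ltn_ind=> d IH dq; have d0 := dvdn_gt0 q0 dq.
have dn : (d < n)%N by apply: leq_ltn_trans qn; apply: dvdn_leq.
have := HS d dq; rewrite sum_dvdn_widen // big_mkcond big_ord_recr /= dvdnn.
rewrite big1 ?add0r // => f _; case: ifP => // fd.
by apply: IH => //; apply: dvdn_trans dq.
Qed.

End DivisorInversion.

(** Lagrange's identity: the difference of the two sides is half a double sum of squares. *)
Lemma sum_prod_sqr (R : realFieldType) (I : finType) (P : pred I) (x y : I -> R) :
  (\sum_(i | P i) x i * y i) ^+ 2 <=
  (\sum_(i | P i) x i ^+ 2) * (\sum_(i | P i) y i ^+ 2).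
Proof.
have : 0 <= \sum_(i | P i) \sum_(j | P j) (x i * y j - x j * y i) ^+ 2.
  by apply: sumr_ge0 => i _; apply: sumr_ge0 => j _; apply: sqr_ge0.
rewrite (_ : \sum_(i | P i) _ =
  2 * ((\sum_(i | P i) x i ^+ 2) * (\sum_(i | P i) y i ^+ 2)) -
  2 * (\sum_(i | P i) x i * y i) ^+ 2); first by lra.
have e (f g : I -> R) : \sum_(i | P i) \sum_(j | P j) f i * g j =
    (\sum_(i | P i) f i) * (\sum_(i | P i) g i).
  by rewrite mulr_suml; apply: eq_bigr => i _; rewrite mulr_sumr.
rewrite mulrDl !mul1r -{2}[(\sum_(i | P i) x i ^+ 2) * _]mulrC expr2 -!e mulr_sumr.
rewrite -big_split -sumrB /=; apply: eq_bigr => i _.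
rewrite mulr_sumr -big_split -sumrB /=; apply: eq_bigr => j _; ring.
Qed.

Section Kernels.
Variable R : realType.

(** For [x] and [y] prime to [f], the sum of [chi x * (chi y)^-1] over all characters modulo [f]. *)
Definition residue_kernel (f x y : nat) : R :=
  (totient f)%:R * (x == y %[mod f])%:R.

(* In terms of characters, the sum of [chi x * (chi y)^-1] over the primitive
   characters [chi] modulo [d], for [x] and [y] coprime to [d]. *)
Definition primitive_kernel (d x y : nat) : R :=
  dinv (fun f => residue_kernel f x y) d.

Local Notation G := residue_kernel.
Local Notation K := primitive_kernel.

Lemma primitive_kernel_sym d x y : (0 < d)%N -> K d x y = K d y x.
Proof. by move=> d0; apply: eq_dinv => // f _; rewrite /G eq_sym. Qed.

Lemma primitive_kernel_congr d x x' y y' : (0 < d)%N ->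
  x == x' %[mod d] -> y == y' %[mod d] -> K d x y = K d x' y'.
Proof.
move=> d0 /eqP xx /eqP yy; apply: eq_dinv => // f fd; rewrite /G.
by rewrite -(modn_dvdm x fd) xx modn_dvdm // -(modn_dvdm y fd) yy modn_dvdm.
Qed.

Lemma primitive_kernel_mul2l d t x y : (0 < d)%N -> coprime t d ->
  K d (t * x) (t * y) = K d x y.
Proof.
move=> d0 td; apply: eq_dinv => // f fd; rewrite /G eqn_mod_mul2l //.
exact: coprime_dvdr td.
Qed.

Lemma primitive_kernel1 x y : K 1 x y = 1.
Proof.
rewrite /K dinvE big_mkcond big_ord_recr big_ord0 /= addr0.
by rewrite subr0 /G !modn1 eqxx mulr1.
Qed.

(** Up to totients the sum counts the units [c] congruent to [m] modulo [f] and to [a] times the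
    inverse of [p] modulo [g]; these are compatible exactly when [m * p] is congruent to [a] modulo
    the gcd. *)
Lemma residue_kernel_conv q f g m p a : (0 < q)%N -> (f %| q)%N -> (g %| q)%N ->
  coprime m q -> coprime p q -> coprime a q ->
  \sum_(c < q | coprime c q) G f m c * G g (c * p)%N a =
  (totient q)%:R * G (gcdn f g) (m * p)%N a.
Proof.
move=> q0 fq gq mq pq aq; have [p' p'q pp'] := unit_inverse q0 pq.
have move_p h x : (h %| q)%N ->
    (x * p == a %[mod h])%N = (x == a * p' %[mod h])%N.
  move=> hq; rewrite -(eqn_mod_mul2l _ _ (coprime_dvdr hq p'q)) [(p' * a)%N]mulnC.
  rewrite (_ : (p' * (x * p) = p * p' * x)%N); last by ring.
  by rewrite -modnMml -(modn_dvdm (p * p') hq) (eqP pp') modn_dvdm // modnMml mul1n.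
have a'q : coprime (a * p') q by rewrite coprimeMl aq.
have := card_units_crt q0 fq gq mq a'q.
move=> /(congr1 (fun n => n%:R : R)); rewrite !natrM natr_sum /G.
rewrite move_p ?(dvdn_trans (dvdn_gcdl f g)) // => <-.
rewrite mulr_suml; apply: eq_bigr => c _.
rewrite move_p // mulrACA mulrC; congr (_ * _).
by rewrite -natrM mulnb [X in X && _]eq_sym.
Qed.

(** Both sides are tested by summing [d] over the divisors of [f] and [e] over those of [g]. The
    left becomes a convolution of residue kernels; on the right the diagonal leaves the common
    divisors, that is the divisors of [gcdn f g]. *)
Lemma primitive_kernel_conv q d e m p a : (0 < q)%N -> (d %| q)%N ->
  (e %| q)%N -> coprime m q -> coprime p q -> coprime a q ->
  \sum_(c < q | coprime c q) K d m c * K e (c * p)%N a =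
  (d == e)%:R * ((totient q)%:R * K d (m * p)%N a).
Proof.
move=> q0 dq eq mq pq aq.
pose T j i := \sum_(c < q | coprime c q) K j m c * K i (c * p)%N a -
  (j == i)%:R * ((totient q)%:R * K j (m * p)%N a).
suff : T d e = 0 by move/eqP; rewrite subr_eq0 => /eqP.
move: e eq; apply: (sum_dvdn_eq0 q0 (ltnSn q)) => g gq.
move: d dq; apply: (sum_dvdn_eq0 q0 (ltnSn q)) => f fq.
have f0 := dvdn_gt0 q0 fq; have g0 := dvdn_gt0 q0 gq.
have lf : (f < q.+1)%N by rewrite ltnS dvdn_leq.
have lg : (g < q.+1)%N by rewrite ltnS dvdn_leq.
have GE h x y : (h %| q)%N -> G h x y = \sum_(j < q.+1 | (j %| h)%N) K j x y.
  move=> hq; apply/esym/(sum_dinv (fun h => G h x y)); first exact: dvdn_gt0 hq.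
  by rewrite ltnS dvdn_leq.
transitivity (\sum_(c < q | coprime c q) G f m c * G g (c * p)%N a
   - (totient q)%:R * G (gcdn f g) (m * p)%N a); last first.
  by rewrite residue_kernel_conv // subrr.
rewrite [G (gcdn _ _) _ _]GE ?(dvdn_trans (dvdn_gcdl f g)) //.
under [in RHS]eq_bigr => c _ do rewrite !GE // mulr_suml.
rewrite (eq_bigr _ (fun j _ => sumrB _ _ _ _)) sumrB; congr (_ - _).
  rewrite [RHS]exchange_big /=; apply: eq_bigr => j _.
  by rewrite exchange_big /=; apply: eq_bigr => c _; rewrite mulr_sumr.
rewrite mulr_sumr [RHS](eq_bigl (fun j : 'I_q.+1 => (j %| f)%N && (j %| g)%N)); last first.
  by move=> j; rewrite dvdn_gcd.
rewrite big_mkcondr /=; apply: eq_bigr => j _.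
case: ifP => jg; last first.
  rewrite big1 // => i ig; case: eqP => [ji|]; last by rewrite mul0r.
  by rewrite ji ig in jg.
rewrite (bigD1 j) //= eqxx mul1r big1 ?addr0 // => i /andP[_ ij].
by rewrite eq_sym (negPf (ij : (i != j :> nat))) mul0r.
Qed.

End Kernels.

(** * Energies in the primitive characters of a given conductor *)

Section PrimitiveEnergy.
Variable R : realType.
Implicit Types al la : nat -> R.
Local Notation G := (@residue_kernel R).
Local Notation K := (@primitive_kernel R).

Lemma sqr_sum (I : finType) (P : pred I) (f : I -> R) :
  (\sum_(i | P i) f i) ^+ 2 = \sum_(i | P i) \sum_(j | P j) f i * f j.
Proof. by rewrite expr2 mulr_suml; apply: eq_bigr => i _; rewrite mulr_sumr. Qed.

Lemma sqr_sum_exchange (I J : finType) (P : pred I) (Q : pred J)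
    (f : I -> R) (k : I -> J -> R) :
  \sum_(j | Q j) (\sum_(i | P i) f i * k i j) ^+ 2 =
  \sum_(i | P i) \sum_(i' | P i') f i * f i' * \sum_(j | Q j) k i j * k i' j.
Proof.
under eq_bigr => j _ do rewrite sqr_sum.
rewrite exchange_big; apply: eq_bigr => i _ /=.
rewrite exchange_big; apply: eq_bigr => i' _ /=.
by rewrite mulr_sumr; apply: eq_bigr => j _; rewrite mulrACA.
Qed.

Definition primitive_part al (M d c : nat) : R :=
  \sum_(m < M | coprime m d) al m * K d m c.

(* In terms of characters, [totient d] times the sum of
   [|\sum_m al m * chi m| ^ 2] over the primitive characters modulo [d]. *)
Definition primitive_energy al (M d : nat) : R :=
  \sum_(c < d | coprime c d) primitive_part al M d c ^+ 2.

Local Notation V := primitive_energy.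

Lemma primitive_energy_ge0 al M d : 0 <= V al M d.
Proof. by apply: sumr_ge0 => c _; apply: sqr_ge0. Qed.

Lemma primitive_energyE al M d : (0 < d)%N ->
  V al M d = (totient d)%:R *
    \sum_(m < M | coprime m d) \sum_(m' < M | coprime m' d)
       al m * al m' * K d m m'.
Proof.
move=> d0; rewrite /V sqr_sum_exchange mulr_sumr; apply: eq_bigr => m md.
rewrite mulr_sumr; apply: eq_bigr => m' md'; rewrite mulrCA; congr (_ * _).
rewrite -[X in K d X m']muln1 -[RHS]mul1r.
have := @primitive_kernel_conv R d d d m 1 m' d0 (dvdnn d) (dvdnn d) md (coprime1n d) md'.
rewrite eqxx => <-; apply: eq_bigr => c _; congr (_ * _).
by rewrite muln1 primitive_kernel_sym.
Qed.

(** In terms of characters, each coefficient sum is multiplied by a value of modulus 1 depending on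
    [a], which its absolute value does not see. *)
Lemma primitive_energy_twist la Y d a : (0 < d)%N -> coprime a d ->
  \sum_(c < d | coprime c d)
    (\sum_(p < Y | coprime p d) la p * K d (c * p)%N a) ^+ 2 = V la Y d.
Proof.
move=> d0 ad; rewrite primitive_energyE // sqr_sum_exchange mulr_sumr.
apply: eq_bigr => p pd; rewrite mulr_sumr; apply: eq_bigr => p' pd'.
rewrite mulrCA; congr (_ * _).
have [t td p't] := unit_inverse d0 pd'.
(* Replacing [c] by [t * c], with [t] inverse to [p'], frees the second kernel of [p'] and leaves a
   convolution. *)
rewrite (sum_unit_mul (F := fun c => K d (c * p)%N a * K d (c * p')%N a) _ td).
  transitivity (\sum_(c < d | coprime c d) K d a c * K d (c * (t * p))%N a).
    apply: eq_bigr => c _; rewrite mulrC primitive_kernel_sym //; congr (_ * _).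
      apply: primitive_kernel_congr => //.
      rewrite (_ : (t * c * p' = p' * t * c)%N); last by ring.
      by rewrite -modnMml (eqP p't) modnMml mul1n.
    by congr K; ring.
  have := @primitive_kernel_conv R d d d a (t * p) a d0 (dvdnn d) (dvdnn d) ad _ ad.
  rewrite coprimeMl td pd => /(_ isT) ->; rewrite eqxx mul1r; congr (_ * _).
  rewrite -[X in K d _ X]muln1 primitive_kernel_mul2l //.
  rewrite (@primitive_kernel_congr R d _ (t * p) _ (t * p')) // ?primitive_kernel_mul2l //.
  by rewrite eq_sym mulnC.
by move=> c; congr (_ * _); apply: primitive_kernel_congr; rewrite // modnMml.
Qed.

(** Idempotence splits the kernel at [m * p] into a convolution over units [c] that separates [m]
    from [p]; Cauchy-Schwarz in [c] then removes [a]. *)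
Lemma primitive_bilinear al la M Y d a : (0 < d)%N -> coprime a d ->
  (\sum_(m < M | coprime m d) \sum_(p < Y | coprime p d)
     al m * la p * K d (m * p)%N a) ^+ 2 * (totient d)%:R ^+ 2
  <= V al M d * V la Y d.
Proof.
move=> d0 ad; rewrite -(primitive_energy_twist la Y d0 ad) -exprMn.
apply: le_trans (sum_prod_sqr _ _ _); rewrite le_eqVlt; apply/orP; left; apply/eqP.
congr (_ ^+ 2); rewrite mulr_suml.
transitivity (\sum_(m < M | coprime m d) \sum_(c < d | coprime c d)
    \sum_(p < Y | coprime p d) al m * K d m c * (la p * K d (c * p)%N a)).
  apply: eq_bigr => m md; rewrite exchange_big /= mulr_suml.
  apply: eq_bigr => p pd.
  have := @primitive_kernel_conv R d d d m p a d0 (dvdnn d) (dvdnn d) md pd ad.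
  rewrite eqxx mul1r => E.
  transitivity (al m * la p * ((totient d)%:R * K d (m * p)%N a)); first by ring.
  rewrite -E mulr_sumr.
  by apply: eq_bigr => c _; ring.
rewrite exchange_big; apply: eq_bigr => c _ /=.
by rewrite /primitive_part mulr_suml; apply: eq_bigr => m _; rewrite mulr_sumr.
Qed.

(** A character modulo [q] of conductor [d] vanishes off the units modulo [q], whereas the energy at
    [d] only sees coprimality to [d]; this factor supplies the difference. *)
Definition restrict_coprime al (q m : nat) : R := (coprime m q)%:R * al m.

(** Parseval over the characters modulo [q], grouped by conductor: the kernels of the divisors of
    [q] add up to [residue_kernel q], which compares residues modulo [q]. *)
Lemma sum_primitive_energy al M q : (0 < q)%N ->
  \sum_(j < q.+1 | (j %| q)%N) V (restrict_coprime al q) M j / (totient j)%:R =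
  (totient q)%:R * \sum_(c < q | coprime c q)
    (\sum_(m < M | m == c %[mod q]) al m) ^+ 2.
Proof.
move=> q0.
transitivity (\sum_(m < M | coprime m q) \sum_(m' < M | coprime m' q)
   al m * al m' * G q m m').
  transitivity (\sum_(j < q.+1 | (j %| q)%N)
      \sum_(m < M | coprime m q) \sum_(m' < M | coprime m' q)
         al m * al m' * K j m m').
    apply: eq_bigr => j jq; have j0 := dvdn_gt0 q0 jq.
    rewrite primitive_energyE // mulrAC divff ?mul1r; last first.
      by rewrite pnatr_eq0 -lt0n totient_gt0.
    have drop (F : nat -> R) : \sum_(m < M | coprime m j) (coprime m q)%:R * F m =
        \sum_(m < M | coprime m q) F m.
      rewrite big_mkcond [RHS]big_mkcond; apply: eq_bigr => m _.
      case: (boolP (coprime m q)) => [mq|_]; last by rewrite mul0r if_same.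
      by rewrite (coprime_dvdr jq mq) mul1r.
    rewrite -(drop (fun m => \sum_(m' < M | coprime m' q) al m * al m' * K j m m')).
    apply: eq_bigr => m _; rewrite -(drop (fun m' => al m * al m' * K j m m')) mulr_sumr.
    by apply: eq_bigr => m' _; rewrite /restrict_coprime; ring.
  rewrite exchange_big; apply: eq_bigr => m _ /=.
  rewrite exchange_big; apply: eq_bigr => m' _ /=.
  rewrite -mulr_sumr; congr (_ * _).
  exact: (sum_dinv (fun f => G f m m')).
have fiber c : coprime c q -> \sum_(m < M | m == c %[mod q]) al m =
    \sum_(m < M | coprime m q) al m * (m == c %[mod q])%:R.
  move=> cq; rewrite big_mkcond [RHS]big_mkcond; apply: eq_bigr => m _.
  case: eqP => mc; last by rewrite mulr0 if_same.
  by rewrite -coprime_modl mc coprime_modl cq mulr1.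
transitivity ((totient q)%:R * \sum_(c < q | coprime c q)
    (\sum_(m < M | coprime m q) al m * (m == c %[mod q])%:R) ^+ 2); last first.
  by congr (_ * _); apply: eq_bigr => c cq; rewrite fiber.
rewrite sqr_sum_exchange mulr_sumr; apply: eq_bigr => m mq.
rewrite mulr_sumr; apply: eq_bigr => m' mq'; rewrite mulrCA; congr (_ * _).
rewrite /residue_kernel; congr (_ * _).
rewrite (bigD1 (Ordinal (ltn_pmod m q0))) /= ?coprime_modl //.
rewrite modn_mod eqxx mul1r big1 ?addr0 1?eq_sym // => c /andP[cq cm].
case: eqP => mc; last by rewrite mul0r.
by move: cm; rewrite -val_eqE /= mc modn_small ?eqxx.
Qed.

End PrimitiveEnergy.

(** * The large sieve *)

Section LargeSieve.
Variable R : realType.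
Implicit Types al u v : nat -> R.

Definition angle (K n : nat) : R := pi *+ 2 * n%:R / K%:R.

Lemma angleD K m n : angle K (m + n) = angle K m + angle K n.
Proof. by rewrite /angle natrD mulrDr mulrDl. Qed.

Lemma angle_mulK K n : (0 < K)%N -> angle K (n * K) = 0 + (pi *+ 2) *+ n.
Proof.
move=> K0; have K0' : K%:R != 0 :> R by rewrite pnatr_eq0 -lt0n.
by rewrite /angle natrM mulrA mulfK // add0r mulr_natr.
Qed.

Lemma angle_scale K l n : (0 < K)%N -> (0 < l)%N -> angle (K * l) (n * l) = angle K n.
Proof.
move=> K0 l0; rewrite /angle !natrM mulrA -mulf_div divff ?mulr1 //.
by rewrite pnatr_eq0 -lt0n.
Qed.

Lemma cos_angle_mod K n : (0 < K)%N -> cos (angle K (n %% K)) = cos (angle K n).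
Proof.
move=> K0; rewrite [in RHS](divn_eq n K) addnC angleD angle_mulK // add0r.
by rewrite (periodicn (@cosD2pi R)).
Qed.

Lemma sin_angle_mod K n : (0 < K)%N -> sin (angle K (n %% K)) = sin (angle K n).
Proof.
move=> K0; rewrite [in RHS](divn_eq n K) addnC angleD angle_mulK // add0r.
by rewrite (periodicn (@sinD2pi R)).
Qed.

Lemma sumr_ord_shift (F : nat -> R) K : F K = F 0%N ->
  \sum_(j < K) F j.+1 = \sum_(j < K) F j.
Proof.
case: K => [|K] FK; first by rewrite !big_ord0.
by rewrite big_ord_recr /= FK [RHS]big_ord_recl addrC.
Qed.

Lemma cos_angle_neq1 K k : (0 < k)%N -> (k < K)%N -> cos (angle K k) != 1.
Proof.
move=> k0 kK; have K0 : 0 < K%:R :> R by rewrite ltr0n (leq_trans _ kK).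
pose x : R := pi * k%:R / K%:R.
have -> : angle K k = x *+ 2 by rewrite /angle /x -mulrnAl -mulrnAl.
have sx : 0 < sin x.
  apply: sin_gt0_pi; apply/andP; split.
    by rewrite divr_gt0 // mulr_gt0 ?pi_gt0 ?ltr0n.
  by rewrite ltr_pdivrMr // ltr_pM2l ?pi_gt0 // ltr_nat.
apply/eqP => c1; have := cos2Dsin2 x; rewrite cos_mulr2n in c1.
have : 0 < sin x ^+ 2 by rewrite exprn_gt0.
lra.
Qed.

(** Rotation by the angle of [k] permutes the summands cyclically, so the vector of the two sums is
    fixed by a rotation other than the identity. *)
Lemma sum_cos_sin_angle K k : (0 < k)%N -> (k < K)%N ->
  \sum_(j < K) cos (angle K (j * k)) = 0 /\
  \sum_(j < K) sin (angle K (j * k)) = 0.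
Proof.
move=> k0 kK; have K0 : (0 < K)%N by apply: leq_trans kK.
set C := \sum_(j < K) cos _; set S := \sum_(j < K) sin _.
have EC : C = cos (angle K k) * C - sin (angle K k) * S.
  transitivity (\sum_(j < K) cos (angle K (j.+1 * k))); last first.
    rewrite !mulr_sumr -sumrB; apply: eq_bigr => j _.
    by rewrite mulSn angleD cosD.
  apply/esym/(@sumr_ord_shift (fun j => cos (angle K (j * k)))).
  by rewrite -[in LHS]cos_angle_mod // modnMr.
have ES : S = sin (angle K k) * C + cos (angle K k) * S.
  transitivity (\sum_(j < K) sin (angle K (j.+1 * k))); last first.
    rewrite !mulr_sumr -big_split; apply: eq_bigr => j _ /=.
    by rewrite mulSn angleD sinD.
  apply/esym/(@sumr_ord_shift (fun j => sin (angle K (j * k)))).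
  by rewrite -[in LHS]sin_angle_mod // modnMr.
have := cos_angle_neq1 k0 kK; have := cos2Dsin2 (angle K k).
move: (cos _) (sin _) EC ES => c s EC ES cs c1.
(* The determinant of the identity minus the rotation. *)
have d0 : (1 - c) ^+ 2 + s ^+ 2 != 0.
  have -> : (1 - c) ^+ 2 + s ^+ 2 = 2 * (1 - c) + (c ^+ 2 + s ^+ 2 - 1) by ring.
  by rewrite cs subrr addr0 mulf_neq0 // subr_eq0 eq_sym.
split; apply: (mulfI d0); rewrite mulr0.
  have -> : ((1 - c) ^+ 2 + s ^+ 2) * C =
     (1 - c) * (C - (c * C - s * S)) - s * (S - (s * C + c * S)) by ring.
  by rewrite -EC -ES !subrr !mulr0 subrr.
have -> : ((1 - c) ^+ 2 + s ^+ 2) * S =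
   s * (C - (c * C - s * S)) + (1 - c) * (S - (s * C + c * S)) by ring.
by rewrite -EC -ES !subrr !mulr0 addr0.
Qed.

Lemma sum_cos_sin_angle_sub K m n : (m < K)%N -> (n < K)%N -> n != m ->
  \sum_(j < K) cos (angle K (j * m) - angle K (j * n)) = 0 /\
  \sum_(j < K) sin (angle K (j * m) - angle K (j * n)) = 0.
Proof.
move=> mK nK nm.
have sub (a b : nat) j : (b <= a)%N ->
    angle K (j * a) - angle K (j * b) = angle K (j * (a - b)).
  by move=> ba; rewrite -{1}(subnK ba) mulnDr angleD addrK.
case: (ltngtP m n) => mn; last by rewrite mn eqxx in nm.
- have nm0 : (0 < n - m)%N by rewrite subn_gt0.
  have [C S] := sum_cos_sin_angle nm0 (leq_ltn_trans (leq_subr _ _) nK).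
  split.
    by apply: etrans C; apply: eq_bigr => j _; rewrite -cosN opprB sub // ltnW.
  apply: etrans (_ : - \sum_(j < K) sin (angle K (j * (n - m))) = 0); last first.
    by rewrite S oppr0.
  rewrite -sumrN; apply: eq_bigr => j _.
  by rewrite -sub ?(ltnW mn) // -sinN opprB.
- have mn0 : (0 < m - n)%N by rewrite subn_gt0.
  have [C S] := sum_cos_sin_angle mn0 (leq_ltn_trans (leq_subr _ _) mK).
  split; [apply: etrans C|apply: etrans S].
    by apply: eq_bigr => j _; rewrite sub // ltnW.
  by apply: eq_bigr => j _; rewrite sub // ltnW.
Qed.

(** Complex coefficients [u + i v] are needed because differences of neighbouring trigonometric sums
    have coefficients [al m * (e(m / K) - 1)]. *)
Lemma parseval_angle u v M K : (M <= K)%N -> (0 < K)%N ->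
  \sum_(j < K) ((\sum_(m < M) (u m * cos (angle K (j * m)) - v m * sin (angle K (j * m)))) ^+ 2
    + (\sum_(m < M) (u m * sin (angle K (j * m)) + v m * cos (angle K (j * m)))) ^+ 2)
  = K%:R * \sum_(m < M) (u m ^+ 2 + v m ^+ 2).
Proof.
move=> MK K0.
transitivity (\sum_(j < K) \sum_(m < M) \sum_(n < M)
   ((u m * u n + v m * v n) * cos (angle K (j * m) - angle K (j * n)) +
    (v m * u n - u m * v n) * - sin (angle K (j * m) - angle K (j * n)))).
  apply: eq_bigr => j _; rewrite !sqr_sum -big_split; apply: eq_bigr => m _ /=.
  rewrite -big_split; apply: eq_bigr => n _ /=; rewrite cosB sinB; ring.
rewrite exchange_big mulr_sumr; apply: eq_bigr => m _ /=.
rewrite exchange_big (bigD1 m) //= [X in _ + X = _]big1 ?addr0.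
  under eq_bigr => j _ do rewrite subrr cos0 sin0 oppr0 mulr0 mulr1 addr0 -!expr2.
  by rewrite sumr_const card_ord mulr_natl.
move=> n nm; rewrite big_split -!mulr_sumr /= sumrN.
have [-> ->] := sum_cos_sin_angle_sub (leq_trans (ltn_ord m) MK) (leq_trans (ltn_ord n) MK) nm.
by rewrite oppr0 !mulr0 addr0.
Qed.

Lemma norm_sin_le (x : R) : 0 <= x -> `|sin x| <= x.
Proof.
move=> x0; have [|c _] := @MVT_segment R sin cos 0 x x0 (fun y _ => is_derive_sin y).
  by apply: continuous_subspaceT; exact: continuous_sin.
by rewrite sin0 !subr0 => ->; rewrite normrM (ger0_norm x0) ler_piMl // cos_max.
Qed.

(** Here [2 - 2 * cos x] is the squared length of the chord of an arc [x]. *)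
Lemma sub2_cos_le (x : R) : 0 <= x -> 2 - 2 * cos x <= x ^+ 2.
Proof.
move=> x0; have {1}-> : x = (x / 2) *+ 2 by rewrite -mulr_natr divfK.
have y0 : 0 <= x / 2 by rewrite divr_ge0.
rewrite (_ : x ^+ 2 = 4 * (x / 2) ^+ 2); last by field.
move: (x / 2) y0 => y y0; rewrite cos_mulr2n.
have : sin y ^+ 2 <= y ^+ 2.
  by rewrite -real_normK ?num_real // lerXn2r ?nnegrE // norm_sin_le.
by have := cos2Dsin2 y; lra.
Qed.

(* The squared modulus of the sum of [al m * e(j m / K)]. *)
Definition trig_sum_sqr al (M K j : nat) : R :=
  (\sum_(m < M) al m * cos (angle K (j * m))) ^+ 2 +
  (\sum_(m < M) al m * sin (angle K (j * m))) ^+ 2.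

Local Notation T := trig_sum_sqr.

Lemma trig_sum_sqr_ge0 al M K j : 0 <= T al M K j.
Proof. by rewrite addr_ge0 // sqr_ge0. Qed.

Lemma sum_trig_sum_sqr al M K : (M <= K)%N -> (0 < K)%N ->
  \sum_(j < K) T al M K j = K%:R * \sum_(m < M) al m ^+ 2.
Proof.
move=> MK K0; have := parseval_angle al (fun _ => 0) MK K0.
under eq_bigr => j _ do under eq_bigr => m _ do rewrite mul0r subr0.
under eq_bigr => j _ do under [X in _ + X ^+ 2]eq_bigr => m _ do rewrite mul0r addr0.
by under [in RHS]eq_bigr => m _ do rewrite expr0n addr0.
Qed.

End LargeSieve.

(** * Gallagher's inequality on a finite cyclic group *)

Section Gallagher.
Variable R : realType.
Implicit Types al : nat -> R.
Local Notation T := (@trig_sum_sqr R).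

(** In each coordinate the difference of squares factors, and the means inequality with weight [t]
    applies; both parts of the bound can then be summed by Parseval. *)
Lemma norm_sqr_diff_le (x x' y y' t : R) : 0 < t ->
  `|x' ^+ 2 + y' ^+ 2 - (x ^+ 2 + y ^+ 2)| <=
  t / 2 * ((x' - x) ^+ 2 + (y' - y) ^+ 2) +
  t^-1 * (x' ^+ 2 + y' ^+ 2 + (x ^+ 2 + y ^+ 2)).
Proof.
move=> t0; rewrite (_ : _ - _ = (x' - x) * (x' + x) + (y' - y) * (y' + y)); last by ring.
have amgm (a b : R) : `|a * b| <= t / 2 * a ^+ 2 + t^-1 / 2 * b ^+ 2.
  have h s : s ^+ 2 = 1 -> 0 <= t / 2 * (a + s * t^-1 * b) ^+ 2 by rewrite mulr_ge0
      ?sqr_ge0 ?divr_ge0 ?ltW.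
  have e s : s ^+ 2 = 1 -> t / 2 * (a + s * t^-1 * b) ^+ 2 =
      t / 2 * a ^+ 2 + t^-1 / 2 * b ^+ 2 + s * (a * b).
    move=> s1; rewrite (_ : t^-1 / 2 * b ^+ 2 = s ^+ 2 * (t^-1 / 2 * b ^+ 2)); last by
        rewrite s1 mul1r.
    by field; rewrite gt_eqF.
  have s1 : (1 : R) ^+ 2 = 1 by rewrite expr1n.
  have s2 : (-1 : R) ^+ 2 = 1 by rewrite sqrrN expr1n.
  have := h 1 s1; have := h (-1) s2; rewrite (e _ s1) (e _ s2) ler_norml => ? ?; lra.
apply: le_trans (ler_normD _ _) _.
have sq (a b : R) : t^-1 / 2 * (a + b) ^+ 2 <= t^-1 * (a ^+ 2 + b ^+ 2).
  have : 0 <= t^-1 / 2 * (a - b) ^+ 2 by rewrite mulr_ge0 ?sqr_ge0 ?divr_ge0 ?invr_ge0 ?ltW.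
  have -> : t^-1 * (a ^+ 2 + b ^+ 2) = t^-1 / 2 * (a + b) ^+ 2 + t^-1 / 2 * (a - b) ^+ 2.
    by field; rewrite gt_eqF.
  by move=> h; rewrite lerDl.
have := amgm (x' - x) (x' + x); have := amgm (y' - y) (y' + y).
have := sq x' x; have := sq y' y; rewrite !mulrDr; lra.
Qed.

(** The counterpart of the integral of [|S * S'|] in Gallagher's argument for an exponential sum
    [S]. *)
Lemma sum_trig_sum_sqr_diff al M K : (0 < M)%N -> (M <= K)%N ->
  \sum_(j < K) `|T al M K j.+1 - T al M K j| <= 16 * M%:R * \sum_(m < M) al m ^+ 2.
Proof.
move=> M0 MK; have K0 : (0 < K)%N := leq_trans M0 MK.
have KR : 0 < K%:R :> R by rewrite ltr0n.
have MR : 0 < M%:R :> R by rewrite ltr0n.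
set nal := \sum_(m < M) _.
(* With this weight each of the two parts contributes [8 * M%:R * nal]. *)
pose t : R := K%:R / (4 * M%:R).
have t0 : 0 < t by rewrite divr_gt0 // mulr_gt0.
pose u m := al m * (cos (angle R K m) - 1); pose v m := al m * sin (angle R K m).
pose D j := (\sum_(m < M) (u m * cos (angle R K (j * m)) - v m * sin (angle R K (j * m)))) ^+ 2
    + (\sum_(m < M) (u m * sin (angle R K (j * m)) + v m * cos (angle R K (j * m)))) ^+ 2.
have step j : `|T al M K j.+1 - T al M K j| <=
    t / 2 * D j + t^-1 * (T al M K j.+1 + T al M K j).
  apply: le_trans (norm_sqr_diff_le _ _ _ _ t0) _.
  rewrite lerD2r le_eqVlt; apply/orP; left; apply/eqP; congr (_ * (_ ^+ 2 + _ ^+ 2)).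
    rewrite -sumrB; apply: eq_bigr => m _; rewrite mulSn angleD cosD /u /v; ring.
  rewrite -sumrB; apply: eq_bigr => m _; rewrite mulSn angleD sinD /u /v; ring.
apply: (@le_trans _ _ (\sum_(j < K) (t / 2 * D j + t^-1 * (T al M K j.+1 + T al M K j)))).
  by apply: ler_sum => j _; apply: step.
have -> : \sum_(j < K) (t / 2 * D j + t^-1 * (T al M K j.+1 + T al M K j)) =
    t / 2 * (\sum_(j < K) D j) +
    t^-1 * (\sum_(j < K) T al M K j.+1 + \sum_(j < K) T al M K j).
  rewrite -[X in _ = _ + _ * X]big_split /= [X in _ = X + _]mulr_sumr.
  by rewrite [X in _ = _ + X]mulr_sumr -big_split.
have -> : \sum_(j < K) T al M K j.+1 = \sum_(j < K) T al M K j.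
  apply: (@sumr_ord_shift R (T al M K)).
  rewrite /trig_sum_sqr; congr (_ ^+ 2 + _ ^+ 2); apply: eq_bigr => m _; congr (_ * _).
    by rewrite -cos_angle_mod // modnMr.
  by rewrite -sin_angle_mod // modnMr.
rewrite sum_trig_sum_sqr // parseval_angle //.
(* The chord from 1 to [e(m / K)] is at most its arc, and [2 pi <= 8]. *)
have uv : \sum_(m < M) (u m ^+ 2 + v m ^+ 2) <= (8 * M%:R / K%:R) ^+ 2 * nal.
  rewrite mulr_sumr; apply: ler_sum => m _.
  rewrite /u /v [(_ * (_ - 1)) ^+ 2]exprMn [(_ * sin _) ^+ 2]exprMn -mulrDr mulrC ler_wpM2r
      ?sqr_ge0 //.
  have a0 : 0 <= angle R K m by rewrite /angle divr_ge0 // mulr_ge0 // mulrn_wge0 // pi_ge0.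
  have := cos2Dsin2 (angle R K m); have := sub2_cos_le a0.
  have : angle R K m ^+ 2 <= (8 * M%:R / K%:R) ^+ 2.
    rewrite lerXn2r ?nnegrE // ?divr_ge0 ?mulr_ge0 // /angle ler_pM2r ?invr_gt0 //.
    have pi8 : pi *+ 2 <= 8 :> R.
      by have := @pihalf_lt2 R; rewrite -[pi *+ 2]mulr_natr; lra.
    have p0 : 0 <= pi *+ 2 :> R by rewrite mulrn_wge0 // pi_ge0.
    have mM : m%:R <= M%:R :> R by rewrite ler_nat ltnW.
    exact: ler_pM p0 (ler0n _ _) pi8 mM.
  move: (cos _) (sin _) => c s h1 h2 h3.
  by rewrite (_ : _ + _ = 2 - 2 * c + (c ^+ 2 + s ^+ 2 - 1)); [lra|ring].
have nal0 : 0 <= nal by apply: sumr_ge0 => m _; apply: sqr_ge0.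
apply: le_trans (_ : t / 2 * (K%:R * ((8 * M%:R / K%:R) ^+ 2 * nal)) + t^-1 * (K%:R * nal +
    K%:R * nal) <= _).
  rewrite lerD2r; apply: ler_wpM2l; first by rewrite divr_ge0 // ltW.
  by apply: ler_wpM2l uv; rewrite ltW.
rewrite le_eqVlt; apply/orP; left; apply/eqP; rewrite /t; field.
by rewrite !gt_eqF.
Qed.

Lemma ler_sum_injective (I : finType) (P : pred I) (phi : I -> nat) (K : nat)
    (F : nat -> R) : (forall i, 0 <= F i) ->
  {in P &, injective phi} -> (forall i, P i -> (phi i < K)%N) ->
  \sum_(i | P i) F (phi i) <= \sum_(j < K) F j.
Proof.
move=> F0 phi_inj phiK.
case: K phiK => [|K] phiK.
  by rewrite big_ord0 big1 // => i /phiK.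
pose f i : 'I_K.+1 := inord (phi i).
have fE i : P i -> f i = phi i :> nat by move=> Pi; rewrite inordK // phiK.
rewrite (partition_big f predT) //=; apply: ler_sum => j _.
case: (pickP (fun i => P i && (f i == j))) => [i0 /andP[P0 f0]|none]; last first.
  by rewrite big_pred0.
rewrite (bigD1 i0) /= ?P0 // -(fE _ P0) (eqP f0) big1 ?addr0 // => i.
case/andP=> /andP[Pi fi] /eqP ii0; case: ii0; apply: phi_inj => //.
by rewrite -(fE _ Pi) -(fE _ P0) (eqP fi) (eqP f0).
Qed.

(* A value is at most the mean over the next [H] points plus the variation along
   them; the blocks of [H] points do not overlap. *)
Lemma gallagher al M K H (I : finType) (P : pred I) (phi : I -> nat) :
  (0 < M)%N -> (M <= K)%N -> (0 < H)%N ->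
  {in (fun p : I * 'I_H => P p.1) &, injective (fun p : I * 'I_H => (phi p.1 + p.2)%N)} ->
  (forall i (h : 'I_H), P i -> (phi i + h < K)%N) ->
  \sum_(i | P i) T al M K (phi i) <=
  (K%:R / H%:R + 16 * M%:R) * \sum_(m < M) al m ^+ 2.
Proof.
move=> M0 MK H0 phi_inj phiK; have HR : 0 < H%:R :> R by rewrite ltr0n.
pose d j := `|T al M K j.+1 - T al M K j|.
have inj_sum (F : nat -> R) : (forall j, 0 <= F j) ->
    \sum_(i | P i) \sum_(h < H) F (phi i + h)%N <= \sum_(j < K) F j.
  move=> F0; rewrite pair_big_dep /=.
  rewrite (eq_bigl (fun p : I * 'I_H => P p.1)) => [|p]; last by rewrite andbT.
  by apply: (ler_sum_injective (phi := fun p : I * 'I_H => (phi p.1 + p.2)%N)) => // p Pp;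
      apply: phiK.
have local i : T al M K (phi i) <=
    H%:R^-1 * \sum_(h < H) T al M K (phi i + h) + \sum_(h < H) d (phi i + h)%N.
  rewrite -(ler_pM2l HR) [leRHS]mulrDr mulVKf ?gt_eqF //.
  have e (x : R) : H%:R * x = \sum_(h < H) x by rewrite sumr_const card_ord mulr_natl.
  rewrite !e -big_split; apply: ler_sum => h _ /=.
  apply: le_trans (_ : T al M K (phi i + h) + \sum_(l < h) d (phi i + l)%N <= _).
    elim: (h : nat) => [|n IH]; first by rewrite big_ord0 addr0 addn0.
    rewrite big_ord_recr /= [X in _ + X]addrC addrA; apply: le_trans IH _.
    by rewrite lerD2r addnS -lerBlDl /d distrC ler_norm.
  rewrite lerD2l (big_ord_widen _ (fun l => d (phi i + l)%N) (ltnW (ltn_ord h))).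
  by rewrite big_mkcond; apply: ler_sum => l _; case: ifP => // _; apply: normr_ge0.
apply: (@le_trans _ _ (\sum_(i | P i) (H%:R^-1 * \sum_(h < H) T al M K (phi i + h) +
    \sum_(h < H) d (phi i + h)%N))).
  by apply: ler_sum => i _; apply: local.
rewrite big_split -mulr_sumr /= mulrDl; apply: lerD; last first.
  have d0 j : 0 <= d j by apply: normr_ge0.
  apply: le_trans (inj_sum d d0) _.
  exact: sum_trig_sum_sqr_diff.
rewrite mulrAC mulrC ler_pM2r ?invr_gt0 //.
rewrite -sum_trig_sum_sqr ?(leq_trans M0) //.
by apply: (inj_sum (T al M K)) => j; apply: trig_sum_sqr_ge0.
Qed.

End Gallagher.

(** * The large sieve for primitive energies *)

Section PrimitiveLargeSieve.
Variable R : realType.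
Implicit Types al : nat -> R.
Local Notation G := (@residue_kernel R).
Local Notation K := (@primitive_kernel R).
Local Notation T := (@trig_sum_sqr R).
Local Notation V := (@primitive_energy R).
Local Notation angle := (@angle R).

(** Distinct fractions in lowest terms with denominators up to [D] are at least [1 / D ^ 2] apart,
    hence [H] points apart among [N], so blocks of [H] points starting at them are disjoint. *)
Lemma farey_injective (D H N : nat) (d a h d' a' h' : nat) :
  (N = D ^ 2 * H)%N -> (d %| N)%N -> (d' %| N)%N ->
  (0 < d <= D)%N -> (0 < d' <= D)%N -> coprime a d -> coprime a' d' ->
  (h < H)%N -> (h' < H)%N ->
  (a * (N %/ d) + h = a' * (N %/ d') + h')%N -> [/\ d = d', a = a' & h = h'].
Proof.
move=> NE dN dN' /andP[d0 dD] /andP[d0' dD'] ad ad' hH hH' E.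
have dd0 : (0 < d * d')%N by rewrite muln_gt0 d0.
have small k : (k < H)%N -> (k * (d * d') < N)%N.
  move=> kH; rewrite NE [X in (_ < X)%N]mulnC.
  apply: (@leq_ltn_trans (k * D ^ 2)%N); last first.
    by rewrite ltn_pmul2r // expn_gt0 (leq_trans d0 dD).
  by rewrite leq_mul2l; apply/orP; right; apply: leq_mul.
(* With denominators cleared the offsets stay below [N], so division by [N] separates the fractions
   from the offsets. *)
have E2 : (a * d' * N + h * (d * d') = a' * d * N + h' * (d * d'))%N.
  have := congr1 (fun x => x * (d * d'))%N E; rewrite !mulnDl.
  rewrite (_ : a * (N %/ d) * (d * d') = a * d' * (N %/ d * d))%N; last by ring.
  rewrite (_ : a' * (N %/ d') * (d * d') = a' * d * (N %/ d' * d'))%N; last by ring.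
  by rewrite !divnK.
have N0 : (0 < N)%N by apply: leq_ltn_trans (small h hH).
have Eq : (a * d' = a' * d)%N.
  by have := congr1 (fun x => x %/ N)%N E2; rewrite /= !divnMDl // !divn_small ?small //
      !addn0.
have hh : h = h'.
  move/eqP: E2; rewrite Eq eqn_add2l => /eqP /eqP.
  by rewrite eqn_pmul2r // => /eqP.
have dd : d = d'.
  apply/eqP; rewrite eqn_dvd; apply/andP; split.
    by rewrite -(Gauss_dvdr d' (_ : coprime d a)) 1?coprime_sym // Eq dvdn_mull.
  by rewrite -(Gauss_dvdr d (_ : coprime d' a')) 1?coprime_sym // -Eq dvdn_mull.
split=> //; move/eqP: Eq; rewrite dd eqn_pmul2r ?(leq_trans _ d0') // => /eqP //.
Qed.

Lemma trig_sum_sqr_scale al M d l a : (0 < d)%N -> (0 < l)%N ->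
  T al M (d * l) (a * l) = T al M d a.
Proof.
move=> d0 l0; rewrite /trig_sum_sqr; congr (_ ^+ 2 + _ ^+ 2);
  by apply: eq_bigr => m _; rewrite mulnAC angle_scale.
Qed.

Lemma large_sieve al M D : (0 < M)%N -> (0 < D)%N ->
  \sum_(d < D.+1 | (0 < d)%N) \sum_(a < d | coprime a d) T al M d a <=
  (D%:R ^+ 2 + 16 * M%:R) * \sum_(m < M) al m ^+ 2.
Proof.
(* The factorial makes every [d <= D] divide [N], and the factor [M] ensures [M <= N]. Their size is
   harmless, since only [N / H = D ^ 2] enters the bound. *)
move=> M0 D0; pose H := (D`! * M)%N; pose N := (D ^ 2 * H)%N.
have H0 : (0 < H)%N by rewrite muln_gt0 fact_gt0.
have DN : (D ^ 2 %| N)%N by apply: dvdn_mulr.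
have N0 : (0 < N)%N by rewrite muln_gt0 expn_gt0 D0.
have dvdN d : (0 < d)%N -> (d < D.+1)%N -> (d %| N)%N.
  move=> d0 dD; apply: dvdn_mull; apply: dvdn_mulr; apply: dvdn_fact.
  by rewrite d0.
pose P (p : 'I_D.+1 * 'I_D.+1) := [&& (0 < p.1)%N, (p.2 < p.1)%N & coprime p.2 p.1].
pose phi (p : 'I_D.+1 * 'I_D.+1) := (p.2 * (N %/ p.1))%N.
have -> : \sum_(d < D.+1 | (0 < d)%N) \sum_(a < d | coprime a d) T al M d a =
    \sum_(p | P p) T al M N (phi p).
  transitivity (\sum_(d < D.+1 | (0 < d)%N)
     \sum_(a < D.+1 | (a < d)%N && coprime a d) T al M d a).
    apply: eq_bigr => d _.
    rewrite (big_ord_widen_cond _ (fun a => coprime a d) (T al M d) (ltnW (ltn_ord d))).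
    by apply: eq_bigl => a; rewrite andbC.
  rewrite pair_big_dep /=; apply: eq_bigr => p /and3P[d0 _ _].
  have dN := dvdN _ d0 (ltn_ord p.1).
  rewrite -[in RHS](divnK dN) [in RHS]mulnC /phi trig_sum_sqr_scale //.
  by rewrite divn_gt0 // dvdn_leq.
apply: le_trans (gallagher al (H := H) (phi := phi) M0 _ H0 _ _) _.
- by rewrite /N /H mulnA leq_pmull // muln_gt0 expn_gt0 D0 fact_gt0.
- move=> [[d a] h] [[d' a'] h'] /and3P /= [d0 ad cad] /and3P /= [d0' ad' cad'] /=.
  rewrite /phi /= => E.
  have [] := @farey_injective D H N d a h d' a' h' erefl.
  + exact: dvdN d0 (ltn_ord d).
  + exact: dvdN d0' (ltn_ord d').
  + by rewrite d0 -ltnS (ltn_ord d).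
  + by rewrite d0' -ltnS (ltn_ord d').
  + by [].
  + by [].
  + by [].
  + by [].
  + exact: E.
  by move=> /val_inj -> /val_inj -> /val_inj ->.
- move=> [d a] h /and3P /= [d0 ad _]; rewrite /phi /=.
  have dN := dvdN _ d0 (ltn_ord d).
  apply: (@leq_trans (a.+1 * (N %/ d))%N).
    rewrite mulSn addnC ltn_add2r (leq_trans (ltn_ord h)) // leq_divRL // mulnC.
    rewrite leq_mul2r; apply/orP; right.
    rewrite -[X in (X <= _)%N]muln1; apply: leq_mul => //; by rewrite -ltnS (ltn_ord d).
  by rewrite -[X in (_ <= X)%N](divnK dN) mulnC leq_mul2l ad orbT.
rewrite /N natrM natrX mulfK ?lexx //.
by rewrite pnatr_eq0 -lt0n.
Qed.

(** Up to a factor [totient f], the indicator of a class modulo [f] is a sum of kernels of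
    conductors dividing [f], all below [d] and so orthogonal to the kernel of conductor [d]. *)
Lemma primitive_part_fiber al M d f b : (0 < d)%N -> (f %| d)%N -> (f < d)%N ->
  coprime b f ->
  \sum_(c < d | coprime c d && (c == b %[mod f])) primitive_part al M d c = 0.
Proof.
move=> d0 fd fltd bf; have f0 := dvdn_gt0 d0 fd.
have [b' b'd b'b] := coprime_lift d0 f0 bf.
have phi0 : (totient f)%:R != 0 :> R by rewrite pnatr_eq0 -lt0n totient_gt0.
apply: (mulfI phi0); rewrite mulr0 mulr_sumr.
transitivity (\sum_(m < M | coprime m d) al m *
    \sum_(c < d | coprime c d) K d m c * G f (c * 1)%N b').
  rewrite big_mkcondr /=; under [RHS]eq_bigr => m _ do rewrite mulr_sumr.
  rewrite [RHS]exchange_big; apply: eq_bigr => c cd /=.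
  rewrite /residue_kernel muln1 (eqP b'b); case: eqP => _.
    by rewrite /primitive_part mulr_sumr; apply: eq_bigr => m _; rewrite mulr1; ring.
  by rewrite big1 // => m _; rewrite !mulr0.
rewrite big1 // => m md; apply/eqP; rewrite mulf_eq0; apply/orP; right; apply/eqP.
transitivity (\sum_(j < d | (j %| f)%N)
    \sum_(c < d | coprime c d) K d m c * K j (c * 1)%N b').
  rewrite exchange_big; apply: eq_bigr => c _ /=; rewrite -mulr_sumr; congr (_ * _).
  by apply/esym/(sum_dinv (fun f => G f (c * 1)%N b')).
rewrite big1 // => j jf.
rewrite primitive_kernel_conv ?coprime1n //; last exact: dvdn_trans fd.
by rewrite (gtn_eqF (ltn_ord j)) mul0r.
Qed.

(* For [g := gcdn a d > 1], [F (a * c)] only depends on [c] modulo [d %/ g]. *)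
Lemma sum_mul_trig_coprime (d : nat) (v F : nat -> R) : (0 < d)%N ->
  (forall c, F (c %% d)%N = F c) ->
  (forall f b, (f %| d)%N -> (f < d)%N -> coprime b f ->
     \sum_(c < d | coprime c d && (c == b %[mod f])) v c = 0) ->
  forall a, ~~ coprime a d -> \sum_(c < d | coprime c d) v c * F (a * c)%N = 0.
Proof.
move=> d0 Fmod v0 a ad; pose g := gcdn a d; pose f := (d %/ g)%N.
have g0 : (0 < g)%N by rewrite gcdn_gt0 d0 orbT.
have g1 : (1 < g)%N by rewrite ltn_neqAle eq_sym ad.
have gd : (g %| d)%N := dvdn_gcdr a d.
have fgd : (f * g = d)%N by rewrite divnK.
have fd : (f %| d)%N by rewrite -fgd dvdn_mulr.
have f0 := dvdn_gt0 d0 fd.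
have fltd : (f < d)%N by rewrite -fgd ltn_Pmulr.
have lift_cong (x y : nat) : x = y %[mod f] -> a * x = a * y %[mod d].
  have ea : a = (g * (a %/ g))%N by rewrite mulnC divnK // dvdn_gcdl.
  move=> xy; rewrite ea -fgd [(f * g)%N]mulnC -!mulnA -!muln_modr; congr (_ * _)%N.
  by rewrite -modnMmr xy modnMmr.
rewrite (sum_units_fiber (fun c => v c * F (a * c)%N) fd d0) big1 // => b bf.
rewrite (eq_bigr (fun c : 'I_d => v c * F (a * b)%N)); last first.
  move=> c /andP[_ /eqP cb]; congr (_ * _); rewrite -Fmod -[RHS]Fmod; congr F.
  exact: lift_cong.
by rewrite -mulr_suml v0 ?mul0r.
Qed.

Lemma sum_cos_angle_orth (d m c : nat) : (c < d)%N ->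
  \sum_(a < d) (cos (angle d (a * m)) * cos (angle d (a * c)) +
                sin (angle d (a * m)) * sin (angle d (a * c)))
  = d%:R * (m == c %[mod d])%:R.
Proof.
move=> cd; have d0 : (0 < d)%N := leq_ltn_trans (leq0n c) cd.
transitivity (\sum_(a < d) cos (angle d (a * (m %% d)) - angle d (a * c))).
  apply: eq_bigr => a _; rewrite cosB.
  by rewrite -[cos (angle d (a * m))]cos_angle_mod // -modnMmr cos_angle_mod //
    -[sin (angle d (a * m))]sin_angle_mod // -modnMmr sin_angle_mod.
rewrite (modn_small cd); case: eqP => [->|/eqP mc].
  under eq_bigr => a _ do rewrite subrr cos0.
  by rewrite sumr_const card_ord mulr1.
have cm : c != (m %% d)%N by rewrite eq_sym.
by have [-> _] := @sum_cos_sin_angle_sub R d _ c (ltn_pmod m d0) cd cm; rewrite mulr0.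
Qed.

(** A duality argument in place of Gauss sums. The Fourier coefficients of the primitive part vanish
    at frequencies not prime to [d], so [d * V] is [totient d] times their pairing with the
    exponential sums of [al] at reduced fractions. Cauchy-Schwarz bounds the pairing, and Parseval
    turns the norm of the primitive part back into [d * V]. *)
Lemma primitive_energy_trig al M d : (0 < d)%N ->
  d%:R * V al M d <=
  (totient d)%:R ^+ 2 * \sum_(a < d | coprime a d) T al M d a.
Proof.
move=> d0; have dR : 0 < d%:R :> R by rewrite ltr0n.
have phi0 : (totient d)%:R != 0 :> R by rewrite pnatr_eq0 -lt0n totient_gt0.
pose v := primitive_part al M d.
pose Cv a := \sum_(c < d | coprime c d) v c * cos (angle d (a * c)).
pose Sv a := \sum_(c < d | coprime c d) v c * sin (angle d (a * c)).
pose Ca a := \sum_(m < M) al m * cos (angle d (a * m)).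
pose Sa a := \sum_(m < M) al m * sin (angle d (a * m)).
have v0 f b : (f %| d)%N -> (f < d)%N -> coprime b f ->
    \sum_(c < d | coprime c d && (c == b %[mod f])) v c = 0.
  by move=> fd fltd bf; apply: primitive_part_fiber.
have Cv0 a : ~~ coprime a d -> Cv a = 0.
  apply: (@sum_mul_trig_coprime d v (fun n => cos (angle d n))) => // c.
  exact: cos_angle_mod.
have Sv0 a : ~~ coprime a d -> Sv a = 0.
  apply: (@sum_mul_trig_coprime d v (fun n => sin (angle d n))) => // c.
  exact: sin_angle_mod.
have VE : d%:R * V al M d = (totient d)%:R * \sum_(a < d | coprime a d) (Ca a * Cv a + Sa a
    * Sv a).
  rewrite primitive_energyE // mulrCA; congr (_ * _).
  transitivity (\sum_(a < d) (Ca a * Cv a + Sa a * Sv a)); last first.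
    rewrite [RHS]big_mkcond; apply: eq_bigr => a _; case: ifPn => // ad.
    by rewrite Cv0 // Sv0 // !mulr0 addr0.
  transitivity (\sum_(m < M) al m * \sum_(c < d | coprime c d) v c *
     (d%:R * (m == c %[mod d])%:R)).
    rewrite mulr_sumr big_mkcond; apply: eq_bigr => m _.
    case: (boolP (coprime m d)) => md; last first.
      rewrite big1 ?mulr0 // => c cd; case: eqP => mc; last by rewrite !mulr0.
      by move: md; rewrite -coprime_modl mc coprime_modl cd.
    rewrite (bigD1 (Ordinal (ltn_pmod m d0))) /= ?coprime_modl //.
    rewrite modn_mod eqxx [X in _ * (_ + X)]big1 ?addr0; last first.
      move=> c /andP[cq cm]; case: eqP => mc; last by rewrite !mulr0.
      by move: cm; rewrite -val_eqE /= mc modn_small ?eqxx.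
    rewrite mulr1; transitivity (d%:R * (al m * v (m %% d)%N)); last by ring.
    congr (_ * _); rewrite /v /primitive_part mulr_sumr; apply: eq_bigr => m' _.
    rewrite -mulrA; congr (_ * (_ * _)).
    rewrite primitive_kernel_sym //; apply: primitive_kernel_congr => //.
    by rewrite modn_mod.
  transitivity (\sum_(m < M) \sum_(a < d) \sum_(c < d | coprime c d) al m * (v c *
     (cos (angle d (a * m)) * cos (angle d (a * c)) +
      sin (angle d (a * m)) * sin (angle d (a * c))))).
    apply: eq_bigr => m _; rewrite exchange_big mulr_sumr; apply: eq_bigr => c _ /=.
    by rewrite -sum_cos_angle_orth // -!mulr_sumr.
  rewrite exchange_big; apply: eq_bigr => a _ /=.
  rewrite /Ca /Sa !mulr_suml -big_split; apply: eq_bigr => m _ /=.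
  rewrite /Cv /Sv !mulr_sumr -big_split; apply: eq_bigr => c _ /=; ring.
have CS : (\sum_(a < d | coprime a d) (Ca a * Cv a + Sa a * Sv a)) ^+ 2 <=
   (\sum_(a < d | coprime a d) T al M d a) * (d%:R * V al M d).
  pose X (p : 'I_d * bool) := if p.2 then Ca p.1 else Sa p.1.
  pose Y (p : 'I_d * bool) := if p.2 then Cv p.1 else Sv p.1.
  have toP (F : 'I_d * bool -> R) : \sum_(a < d | coprime a d) (F (a, true) + F (a, false)) =
     \sum_(p : 'I_d * bool | coprime p.1 d) F p.
    rewrite (eq_bigr (fun a => \sum_(b : bool) F (a, b))); last first.
      by move=> a _; rewrite big_bool.
    by rewrite pair_big_dep; apply: eq_big => [[a b]|[a b] _] //=; rewrite andbT.
  rewrite (toP (fun p => X p * Y p)).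
  apply: le_trans (sum_prod_sqr _ _ _) _.
  rewrite -(toP (fun p => X p ^+ 2)) -(toP (fun p => Y p ^+ 2)) /X /Y /=.
  apply: ler_wpM2l; first by apply: sumr_ge0 => a _; apply: trig_sum_sqr_ge0.
  apply: (@le_trans _ _ (\sum_(a < d) (Cv a ^+ 2 + Sv a ^+ 2))).
    rewrite big_mkcond; apply: ler_sum => a _; case: ifP => // _.
    by rewrite addr_ge0 ?sqr_ge0.
  have := parseval_angle (fun c => (coprime c d)%:R * v c) (fun _ => 0) (leqnn d) d0.
  move=> E; rewrite le_eqVlt; apply/orP; left; apply/eqP.
  have drop (F : nat -> R) : \sum_(c < d) (coprime c d)%:R * F c = \sum_(c < d | coprime c
      d) F c.
    by rewrite [RHS]big_mkcond; apply: eq_bigr => c _; case: coprime; rewrite ?mul1r ?mul0r.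
  transitivity (d%:R * \sum_(m < d) (((coprime m d)%:R * v m) ^+ 2 + 0 ^+ 2)).
    rewrite -E; apply: eq_bigr => a _; congr (_ ^+ 2 + _ ^+ 2).
      rewrite /Cv -(drop (fun c => v c * cos (angle d (a * c)))); apply: eq_bigr => c _.
      by rewrite mul0r subr0 mulrA.
    rewrite /Sv -(drop (fun c => v c * sin (angle d (a * c)))); apply: eq_bigr => c _.
    by rewrite mul0r addr0 mulrA.
  congr (_ * _); rewrite /V -(drop (fun c => v c ^+ 2)); apply: eq_bigr => c _.
  by rewrite expr0n addr0 exprMn; case: coprime; rewrite ?expr1n // expr0n.
(* A factor [d * V] is cancelled below, so vanishing energy is treated apart. *)
have := primitive_energy_ge0 al M d; rewrite le_eqVlt => /orP[/eqP <-|V0].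
  by rewrite mulr0 mulr_ge0 ?sqr_ge0 // sumr_ge0 // => a _; apply: trig_sum_sqr_ge0.
have dV0 : 0 < d%:R * V al M d by rewrite mulr_gt0.
rewrite -(ler_pM2r dV0).
apply: (@le_trans _ _ (((totient d)%:R *
    \sum_(a < d | coprime a d) (Ca a * Cv a + Sa a * Sv a)) ^+ 2)).
  by rewrite -VE expr2.
by rewrite exprMn -[leRHS]mulrA; apply: ler_wpM2l CS; apply: sqr_ge0.
Qed.

Lemma large_sieve_primitive al M D : (0 < M)%N -> (0 < D)%N ->
  \sum_(d < D.+1 | (0 < d)%N) d%:R / (totient d)%:R ^+ 2 * V al M d <=
  (D%:R ^+ 2 + 16 * M%:R) * \sum_(m < M) al m ^+ 2.
Proof.
move=> M0 D0; apply: le_trans (large_sieve al M0 D0); apply: ler_sum => d d0.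
have phi0 : 0 < (totient d)%:R :> R by rewrite ltr0n totient_gt0.
rewrite mulrAC ler_pdivrMr ?exprn_gt0 // [X in _ <= X]mulrC.
exact: primitive_energy_trig.
Qed.

End PrimitiveLargeSieve.

(** * Bilinear forms in arithmetic progressions *)

Section BilinearForm.
Variable R : realType.
Implicit Types al la : nat -> R.
Local Notation G := (@residue_kernel R).
Local Notation K := (@primitive_kernel R).
Local Notation V := (@primitive_energy R).

Definition bilinear_error al la (M Y q a : nat) : R :=
  `| \sum_(m < M) \sum_(p < Y) al m * la p *
      ((m * p == a %[mod q])%:R - (coprime (m * p) q)%:R / (totient q)%:R) |.

(** Conductor 1 contributes exactly the main term, its kernel being constantly 1; only [d > 1]
    remain. *)
Lemma bilinear_expansion al la M Y q a : (0 < q)%N -> coprime a q ->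
  \sum_(m < M) \sum_(p < Y) al m * la p *
      ((m * p == a %[mod q])%:R - (coprime (m * p) q)%:R / (totient q)%:R) =
  (totient q)%:R^-1 * \sum_(d < q.+1 | (d %| q)%N && (1 < d)%N)
    \sum_(m < M | coprime m d) \sum_(p < Y | coprime p d)
      restrict_coprime al q m * restrict_coprime la q p * K d (m * p)%N a.
Proof.
move=> q0 aq; have phi0 : (totient q)%:R != 0 :> R by rewrite pnatr_eq0 -lt0n totient_gt0.
transitivity ((totient q)%:R^-1 * \sum_(d < q.+1 | (d %| q)%N && (1 < d)%N)
    \sum_(m < M) \sum_(p < Y)
      restrict_coprime al q m * restrict_coprime la q p * K d (m * p)%N a); last first.
  congr (_ * _); apply: eq_bigr => d /andP[dq _].
  rewrite [RHS]big_mkcond; apply: eq_bigr => m _; case: ifPn => md.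
    rewrite [RHS]big_mkcond; apply: eq_bigr => p _; case: ifPn => // pd.
    rewrite /restrict_coprime [coprime p q](contraNF _ pd) ?mul0r ?mulr0 ?mul0r //.
    exact: coprime_dvdr.
  rewrite big1 // => p _.
  rewrite /restrict_coprime [coprime m q](contraNF _ md) ?mul0r //.
  exact: coprime_dvdr.
rewrite [in RHS]exchange_big mulr_sumr; apply: eq_bigr => m _ /=.
rewrite [in RHS]exchange_big mulr_sumr; apply: eq_bigr => p _ /=.
rewrite -mulr_sumr /restrict_coprime coprimeMl.
have GE : G q (m * p)%N a - 1 =
    \sum_(d < q.+1 | (d %| q)%N && (1 < d)%N) K d (m * p)%N a.
  rewrite -(@sum_dinv R (fun f => G f (m * p)%N a) q q.+1) // (bigD1 (Ordinal (q0 : 1 <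
      q.+1)%N)) ?dvd1n //=.
  rewrite [X in X + _ - _](@primitive_kernel1 R) addrAC subrr add0r; apply: eq_bigl => d.
  case: (boolP (d %| q)%N) => //= /(dvdn_gt0 q0) d0.
  by rewrite -val_eqE /= ltn_neqAle eq_sym d0 andbT.
rewrite -GE /residue_kernel.
case: (boolP (coprime m q)) => mq /=; last first.
  case: eqP => mpa; last by rewrite !mul0r subr0 !mulr0.
  move: aq; rewrite -coprime_modl -mpa coprime_modl coprimeMl (negPf mq).
  by [].
case: (boolP (coprime p q)) => pq /=; last first.
  case: eqP => mpa; last by rewrite !mul0r subr0 !mulr0 mul0r mulr0.
  by move: aq; rewrite -coprime_modl -mpa coprime_modl coprimeMl (negPf pq) andbF.
by field.
Qed.

(** Coprimality to [d] is built into the energy at [d]. Dropping it from the weights lets the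
    conductor and the complementary divisor vary independently. *)
Lemma primitive_energy_restrict al M d e :
  V (restrict_coprime al (d * e)) M d = V (restrict_coprime al e) M d.
Proof.
apply: eq_bigr => c _; congr (_ ^+ 2); apply: eq_bigr => m md; congr (_ * _).
by rewrite /restrict_coprime coprimeMr md.
Qed.

(* The contribution to the modulus [d * e] of the characters of conductor [d]. *)
Definition conductor_bound al la (M Y d e : nat) : R :=
  Num.sqrt (V (restrict_coprime al e) M d) *
  Num.sqrt (V (restrict_coprime la e) Y d) /
  ((totient d)%:R ^+ 2 * (totient e)%:R).

Lemma conductor_bound_ge0 al la M Y d e : 0 <= conductor_bound al la M Y d e.
Proof. by rewrite divr_ge0 // mulr_ge0 ?sqrtr_ge0 ?sqr_ge0. Qed.

Lemma bilinear_error_le al la M Y q a : (0 < q)%N -> coprime a q ->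
  bilinear_error al la M Y q a <=
  \sum_(d < q.+1 | (d %| q)%N && (1 < d)%N) conductor_bound al la M Y d (q %/ d).
Proof.
move=> q0 aq; rewrite /bilinear_error bilinear_expansion // normrM ger0_norm ?invr_ge0 //.
apply: le_trans (ler_wpM2l _ (ler_norm_sum _ _ _)) _; rewrite ?invr_ge0 //.
rewrite mulr_sumr; apply: ler_sum => d /andP[].
move: (nat_of_ord d) => {}d dq d1.
have d0 : (0 < d)%N by apply: ltnW.
have ad : coprime a d := coprime_dvdr dq aq.
have qE : q = (d * (q %/ d))%N by rewrite mulnC divnK.
have e0 : (0 < q %/ d)%N by rewrite divn_gt0 // dvdn_leq.
move: (q %/ d)%N qE e0 => e {dq} qE e0; rewrite {q q0 aq}qE.
have pd : 0 < (totient d)%:R :> R by rewrite ltr0n totient_gt0.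
have pe : 0 < (totient e)%:R :> R by rewrite ltr0n totient_gt0.
have pde : (totient d)%:R * (totient e)%:R <= (totient (d * e))%:R :> R.
  by rewrite -natrM ler_nat leq_totientM.
rewrite /conductor_bound -!(primitive_energy_restrict _ _ d e).
move: (restrict_coprime al _) (restrict_coprime la _) => al' la'.
set S := \sum_(m < M | _) _.
have : S ^+ 2 * (totient d)%:R ^+ 2 <= V al' M d * V la' Y d by apply: primitive_bilinear.
rewrite -ler_sqrt ?mulr_ge0 ?primitive_energy_ge0 // -exprMn sqrtr_sqr.
rewrite sqrtrM ?primitive_energy_ge0 // normrM (gtr0_norm pd) => h.
set VV := Num.sqrt _ * Num.sqrt _ in h *.
rewrite (_ : VV / _ = ((totient d)%:R * (totient e)%:R)^-1 * (VV / (totient d)%:R)); last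
    first.
  by field; rewrite !gt_eqF.
apply: ler_pM; rewrite ?invr_ge0 //; last by rewrite ler_pdivlMr.
by rewrite lef_pV2 ?posrE ?mulr_gt0 // ltr0n totient_gt0 muln_gt0 d0.
Qed.

Lemma max_reduced_le (q : nat) (f : nat -> R) (x : R) : 0 <= x ->
  (forall a, (a < q)%N -> coprime a q -> f a <= x) -> max_reduced q f <= x.
Proof.
move=> x0 fx; rewrite /max_reduced; elim/big_ind: _ => // [y z yx zx|a aq].
  by rewrite ge_max yx.
exact: fx (ltn_ord a) aq.
Qed.

Lemma max_reduced_ge0 (q : nat) (f : nat -> R) : (forall a, 0 <= f a) ->
  0 <= max_reduced q f.
Proof.
move=> f0; rewrite /max_reduced; elim/big_ind: _ => // [x y x0 y0].
by rewrite le_max x0.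
Qed.

Lemma le_max_reduced (q a : nat) (f : nat -> R) : (a < q)%N -> coprime a q ->
  f a <= max_reduced q f.
Proof.
move=> aq cop; rewrite /max_reduced (bigD1 (Ordinal aq)) //=.
by rewrite le_max lexx.
Qed.

(** With [q = d * e], the map from [q] to [q %/ d] is injective on the multiples of [d]. Coprimality
    to [B] passes to the conductor [d], where Siegel-Walfisz will use it, and is dropped for [e]. *)
Lemma sum_bilinear_error al la M Y Q B :
  \sum_(q < Q.+1 | (0 < q)%N && coprime q B)
     max_reduced q (bilinear_error al la M Y q) <=
  \sum_(e < Q.+1 | (0 < e)%N) \sum_(d < Q.+1 | (1 < d)%N && coprime d B)
     conductor_bound al la M Y d e.
Proof.
apply: (@le_trans _ _ (\sum_(q < Q.+1 | (0 < q)%N && coprime q B)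
  \sum_(d < Q.+1 | [&& (d %| q)%N, (1 < d)%N & coprime d B])
     conductor_bound al la M Y d (q %/ d))).
  apply: ler_sum => q /andP[q0 qB].
  apply: (@le_trans _ _ (\sum_(d < q.+1 | (d %| q)%N && (1 < d)%N)
     conductor_bound al la M Y d (q %/ d))).
    apply: max_reduced_le; last by move=> a _; apply: bilinear_error_le.
    by apply: sumr_ge0 => d _; apply: conductor_bound_ge0.
  rewrite (big_ord_widen_cond _ (fun d => (d %| q)%N && (1 < d)%N)
    (fun d => conductor_bound al la M Y d (q %/ d)) (ltn_ord q)).
  rewrite le_eqVlt; apply/orP; left; apply/eqP; apply: eq_bigl => d.
  case: (boolP (d %| q)%N) => //= dq; rewrite (coprime_dvdl dq qB) andbT.
  by rewrite [(d < _)%N]ltnS (dvdn_leq q0 dq) andbT.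
rewrite (exchange_big_dep (fun d : 'I_Q.+1 => (1 < d)%N && coprime d B)) /=; last first.
  by move=> q d _ /and3P[_ -> ->].
rewrite [leRHS]exchange_big; apply: ler_sum => d /andP[d1 dB] /=.
rewrite [leRHS]big_mkcond; pose F e := if (0 < e)%N then conductor_bound al la M Y d e else 0.
apply: (@le_trans _ _ (\sum_(q < Q.+1 | (0 < q)%N && (d %| q)%N) F (q %/ d)%N)).
  rewrite big_mkcond [leRHS]big_mkcond; apply: ler_sum => q _.
  rewrite d1 dB andbT !andbT -/(0 < q)%N; case: (boolP (0 < q)%N) => //= q0.
  case: (boolP (d %| q)%N) => dq; last by rewrite !andbF.
  rewrite /F divn_gt0 ?(ltnW d1) // dvdn_leq //.
  by case: (coprime q B) => //=; apply: conductor_bound_ge0.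
apply: (@ler_sum_injective R _ _ (fun q : 'I_Q.+1 => q %/ d)%N Q.+1 F).
- by move=> e; rewrite /F; case: ifP => // _; apply: conductor_bound_ge0.
- move=> q q' /andP[_ dq] /andP[_ dq'] E; apply: val_inj => /=.
  by rewrite -(divnK dq) E divnK.
- by move=> q _; apply: leq_ltn_trans (leq_div _ _) (ltn_ord q).
Qed.

End BilinearForm.

(** * Small conductors *)

Section TypeII.
Variable R : realType.
Implicit Types al la : nat -> R.
Local Notation V := (@primitive_energy R).

Lemma totient_pos (d : nat) : (0 < d)%N -> 0 < (totient d)%:R :> R.
Proof. by move=> d0; rewrite ltr0n totient_gt0. Qed.

Lemma primitive_energy_restrict_id al M d : V (restrict_coprime al d) M d = V al M d.
Proof.
apply: eq_bigr => c _; congr (_ ^+ 2); apply: eq_bigr => m md; congr (_ * _).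
by rewrite /restrict_coprime md mul1r.
Qed.

Lemma primitive_energy1 al M : V al M 1 = (\sum_(m < M) al m) ^+ 2.
Proof.
rewrite /V big_mkcond big_ord_recl big_ord0 /= addr0; congr (_ ^+ 2).
rewrite /primitive_part; apply: eq_big => m; first by rewrite coprimen1.
by rewrite primitive_kernel1 mulr1.
Qed.

(** Of the nonnegative terms in [sum_primitive_energy] only those of conductors [d] and 1 are kept;
    conductor 1 gives the square of the total, so the right side is a variance over the reduced
    classes. *)
Lemma primitive_energy_le_variance la Y d : (1 < d)%N ->
  V la Y d / (totient d)%:R <=
  (totient d)%:R * \sum_(c < d | coprime c d)
    (\sum_(p < Y | p == c %[mod d]) la p) ^+ 2 -
  (\sum_(p < Y | coprime p d) la p) ^+ 2.
Proof.
move=> d1; have d0 : (0 < d)%N by apply: ltnW.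
rewrite -sum_primitive_energy // (bigD1 (Ordinal (ltnSn d))) ?dvdnn //=.
rewrite primitive_energy_restrict_id -addrA lerDl subr_ge0.
rewrite (bigD1 (Ordinal (d0 : 1 < d.+1)%N)) /=; last first.
  by rewrite dvd1n -val_eqE /= neq_ltn d1.
rewrite primitive_energy1 divr1 [\sum_(p < Y | _) _]big_mkcond /=.
rewrite (eq_bigr (fun p : 'I_Y => restrict_coprime la d p)).
  by rewrite lerDl sumr_ge0 // => j _; rewrite divr_ge0 ?primitive_energy_ge0.
by move=> p _; rewrite /restrict_coprime; case: coprime; rewrite ?mul1r ?mul0r.
Qed.

Lemma sum_residues_le (d m : nat) :
  \sum_(c < d | coprime c d) (m == c %[mod d])%:R <= 1 :> R.
Proof.
case: (posnP d) => [->|d0]; first by rewrite big_ord0.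
apply: (@le_trans _ _ (\sum_(c < d) (m == c %[mod d])%:R : R)).
  by rewrite big_mkcond; apply: ler_sum => c _; case: ifP => _; rewrite ?ler0n.
rewrite (bigD1 (Ordinal (ltn_pmod m d0))) //= modn_mod eqxx big1 ?addr0 // => c cm.
case: eqP => // mc; move: cm; rewrite -val_eqE /= mc modn_small ?eqxx //.
Qed.

Lemma primitive_energy_le_trivial al M d : (1 < d)%N -> (forall m, `|al m| <= 1) ->
  V al M d <= (totient d)%:R ^+ 2 * M%:R ^+ 2.
Proof.
move=> d1 al1; have d0 : (0 < d)%N by apply: ltnW.
have phi0 := totient_pos d0.
rewrite expr2 -mulrA [leRHS]mulrC -ler_pdivrMr //.
apply: le_trans (primitive_energy_le_variance _ _ d1) _.
apply: (@le_trans _ _ ((totient d)%:R * \sum_(c < d | coprime c d)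
    (\sum_(m < M | m == c %[mod d]) al m) ^+ 2)).
  by rewrite lerBlDr lerDl sqr_ge0.
rewrite ler_pM2l //; pose n c : R := \sum_(m < M) (m == c %[mod d])%:R.
have nM c : n c <= M%:R.
  rewrite -[in leRHS](card_ord M) -sum1_card natr_sum; apply: ler_sum => m _.
  by case: eqP.
have n0 c : 0 <= n c by apply: sumr_ge0.
apply: (@le_trans _ _ (\sum_(c < d | coprime c d) n c * M%:R)).
  apply: ler_sum => c _; rewrite -real_normK ?num_real // expr2.
  have An : `|\sum_(m < M | m == c %[mod d]) al m| <= n c.
    apply: le_trans (ler_norm_sum _ _ _) _; rewrite big_mkcond; apply: ler_sum => m _.
    by case: ifP => // _; apply: al1.
  by apply: ler_pM => //; apply: le_trans An (nM c).
rewrite -mulr_suml expr2 ler_wpM2r // exchange_big /=.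
rewrite -[in leRHS](card_ord M) -sum1_card natr_sum; apply: ler_sum => m _.
exact: sum_residues_le.
Qed.

(** The variance equals [totient d] times the sum of the squared deviations of the class sums from
    their mean. *)
Lemma primitive_energy_le_equidistributed la Y d (Del : R) : (1 < d)%N ->
  (forall c, coprime c d ->
    `|\sum_(p < Y | p == c %[mod d]) la p -
      (\sum_(p < Y | coprime p d) la p) / (totient d)%:R| <= Del) ->
  V la Y d <= (totient d)%:R ^+ 3 * Del ^+ 2.
Proof.
move=> d1 LD; have d0 : (0 < d)%N by apply: ltnW.
have phi0 := totient_pos d0.
have -> : (totient d)%:R ^+ 3 * Del ^+ 2 = (totient d)%:R * Del ^+ 2 *
   (totient d)%:R * (totient d)%:R by ring.
rewrite -ler_pdivrMr //; apply: le_trans (primitive_energy_le_variance _ _ d1) _.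
set S := \sum_(p < Y | _) _ in LD *; pose L c := \sum_(p < Y | p == c %[mod d]) la p.
have SE : S = \sum_(c < d | coprime c d) L c.
  rewrite (exchange_big_dep xpredT) //= [LHS]big_mkcond; apply: eq_bigr => p _.
  case: (boolP (coprime p d)) => pd; last first.
    rewrite big_pred0 // => c; case: (boolP (coprime c d)) => //= cd.
    apply/negP => /eqP pc; move: pd; rewrite -coprime_modl pc coprime_modl cd.
    by [].
  rewrite (big_pred1 (Ordinal (ltn_pmod p d0))) // => c.
  rewrite /= -[c == _]val_eqE /=; apply/andP/eqP => [[_ /eqP ->]|->].
    by rewrite modn_small.
  by rewrite coprime_modl pd modn_mod.
have cardphi : \sum_(c < d | coprime c d) 1 = (totient d)%:R :> R.
  by rewrite -totientE_sum natr_sum.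
apply: (@le_trans _ _ ((totient d)%:R * \sum_(c < d | coprime c d) (L c - S / (totient
    d)%:R) ^+ 2)).
  under [in leRHS]eq_bigr => c _ do rewrite sqrrB.
  rewrite big_split sumrB /= -/L.
  have -> : \sum_(c < d | coprime c d) (S / (totient d)%:R) ^+ 2 =
      (S / (totient d)%:R) ^+ 2 * (totient d)%:R.
    by rewrite -[X in _ = _ * X]cardphi mulr_sumr; apply: eq_bigr => c _; rewrite mulr1.
  have -> : \sum_(c < d | coprime c d) L c * (S / (totient d)%:R) *+ 2 = S * (S / (totient
      d)%:R) *+ 2.
    by rewrite sumrMnl -mulr_suml -SE.
  rewrite le_eqVlt; apply/orP; left; apply/eqP; field.
  by rewrite gt_eqF.
rewrite [leRHS]mulrC ler_pM2l // -[X in _ <= X * _]cardphi [leRHS]mulr_suml; apply: ler_sum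
    => c cd.
rewrite mul1r -real_normK ?num_real // lerXn2r ?nnegrE //; last exact: LD.
exact: le_trans (normr_ge0 _) (LD c cd).
Qed.

(** The energy of [al] is bounded trivially. Each conductor then costs [totient d <= D0], and there
    are at most [D0] of them. *)
Lemma sum_small_conductors al la M Y D0 B e (Del : R) : (0 < e)%N -> 0 <= Del ->
  (forall m, `|al m| <= 1) ->
  (forall d c, (1 < d <= D0)%N -> coprime d B -> coprime c d ->
    `|\sum_(p < Y | p == c %[mod d]) restrict_coprime la e p -
      (\sum_(p < Y | coprime p d) restrict_coprime la e p) / (totient d)%:R| <= Del) ->
  \sum_(d < D0.+1 | (1 < d)%N && coprime d B) conductor_bound al la M Y d e <=
  D0%:R ^+ 2 * M%:R * Del / (totient e)%:R.
Proof.
move=> e0 Del0 al1 LD; have phie := totient_pos e0.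
apply: (@le_trans _ _ (\sum_(d < D0.+1 | (1 < d)%N) D0%:R * M%:R * Del / (totient e)%:R)).
  rewrite big_mkcondr; apply: ler_sum => d d1; have d0 : (0 < d)%N by apply: ltnW.
  have RHS0 : 0 <= D0%:R * M%:R * Del / (totient e)%:R by rewrite !mulr_ge0 ?invr_ge0.
  case: ifP => // dB; have phid := totient_pos d0.
  have dD0 : (d <= D0)%N by rewrite -ltnS.
  rewrite /conductor_bound invfM mulrA; apply: ler_wpM2r; first by rewrite invr_ge0 ltW.
  rewrite ler_pdivrMr ?exprn_gt0 // -sqrtrM ?primitive_energy_ge0 //.
  have pd1 : 1 <= (totient d)%:R :> R by rewrite ler1n totient_gt0.
  have pdD : (totient d)%:R <= D0%:R :> R.
    rewrite ler_nat (leq_trans _ dD0) // -totientE_sum.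
    rewrite -[X in (_ <= X)%N](card_ord d) -sum1_card big_mkcond /=.
    by apply: leq_sum => c _; case: ifP.
  (* The two energy bounds multiply to the fifth power of [totient d]; rounding up to the sixth
     makes the square root exact. *)
  apply: (@le_trans _ _ (Num.sqrt (((totient d)%:R ^+ 3 * M%:R * Del) ^+ 2))).
    rewrite ler_sqrt ?sqr_ge0 //.
    apply: (@le_trans _ _ (((totient d)%:R ^+ 2 * M%:R ^+ 2) * ((totient d)%:R ^+ 3 * Del
        ^+ 2))).
      apply: ler_pM; rewrite ?primitive_energy_ge0 //.
        apply: primitive_energy_le_trivial => // m.
        rewrite /restrict_coprime; case: coprime; rewrite ?mul1r ?mul0r ?normr0 //.
      by apply: primitive_energy_le_equidistributed => // c cd; apply: LD; rewrite ?d1.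
    rewrite (_ : ((totient d)%:R ^+ 3 * M%:R * Del) ^+ 2 = (totient d)%:R *
      ((totient d)%:R ^+ 2 * M%:R ^+ 2 * ((totient d)%:R ^+ 3 * Del ^+ 2))); last by ring.
    by rewrite ler_peMl // !mulr_ge0 ?exprn_ge0.
  rewrite sqrtr_sqr ger0_norm ?mulr_ge0 ?exprn_ge0 //.
  rewrite (_ : _ * Del = (totient d)%:R * (M%:R * Del * (totient d)%:R ^+ 2)); last by ring.
  rewrite (_ : D0%:R * M%:R * Del * (totient d)%:R ^+ 2 =
    D0%:R * (M%:R * Del * (totient d)%:R ^+ 2)); last by ring.
  by apply: ler_wpM2r pdD; rewrite !mulr_ge0 ?exprn_ge0.
have count : \sum_(d < D0.+1 | (1 < d)%N) 1 <= D0%:R :> R.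
  rewrite big_mkcond big_ord_recl /= add0r.
  rewrite -[in leRHS](card_ord D0) -sum1_card natr_sum; apply: ler_sum => c _.
  by case: ifP.
rewrite (_ : D0%:R ^+ 2 * M%:R * Del / (totient e)%:R =
   D0%:R * (D0%:R * M%:R * Del / (totient e)%:R)); last by rewrite expr2 !mulrA.
rewrite -[X in X <= _](_ : (\sum_(d < D0.+1 | (1 < d)%N) 1) *
   (D0%:R * M%:R * Del / (totient e)%:R) = _); last first.
  by rewrite mulr_suml; apply: eq_bigr => d _; rewrite mul1r.
by apply: ler_wpM2r count; rewrite !mulr_ge0 ?invr_ge0.
Qed.

End TypeII.

(** * Large conductors *)

Section LargeConductors.
Variable R : realType.
Implicit Types al la : nat -> R.
Local Notation V := (@primitive_energy R).
Local Notation cb := (@conductor_bound R).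

Lemma ler_sum_ord_sub (n n' : nat) (P P' : pred nat) (F : nat -> R) :
  (forall i, 0 <= F i) -> (forall i, (i < n)%N -> P i -> (i < n')%N && P' i) ->
  \sum_(i < n | P i) F i <= \sum_(i < n' | P' i) F i.
Proof.
move=> F0 PP; rewrite [leRHS]big_mkcond.
apply: (@le_trans _ _ (\sum_(i < n | P i) (if P' i then F i else 0))).
  by apply: ler_sum => i /(PP _ (ltn_ord i)) /andP[_ ->].
apply: (@ler_sum_injective R _ (fun i : 'I_n => P i) (fun i => i : nat) n'
  (fun i => if P' i then F i else 0)).
- by move=> i; case: ifP.
- by move=> i j _ _ /val_inj.
- by move=> i /(PP _ (ltn_ord i)) /andP[].
Qed.

(** For [d > D] the weight [d] in the large sieve is at least [D]. Its factor [4 * D ^ 2 + 16 * M]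
    is majorized by a square, ready for the root taken in Cauchy-Schwarz. *)
Lemma sum_sqr_dyadic al M D : (0 < M)%N -> (0 < D)%N ->
  (forall m, `|al m| <= 1) ->
  \sum_(d < (2 * D).+1 | (D < d)%N) (Num.sqrt (V al M d) / (totient d)%:R) ^+ 2 <=
  D%:R^-1 * ((2 * D%:R + 4 * Num.sqrt M%:R) * Num.sqrt M%:R) ^+ 2.
Proof.
move=> M0 D0 al1; have DR : 0 < D%:R :> R by rewrite ltr0n.
have sM := sqr_sqrtr (ler0n R M); have s0 := sqrtr_ge0 (M%:R : R).
have norm2 : \sum_(m < M) al m ^+ 2 <= M%:R.
  rewrite -[in leRHS](card_ord M) -sum1_card natr_sum; apply: ler_sum => m _.
  by rewrite -real_normK ?num_real // expr_le1.
have D20 : (0 < 2 * D)%N by rewrite muln_gt0.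
rewrite -ler_pdivrMl ?invr_gt0 // invrK mulr_sumr.
apply: (@le_trans _ _ (\sum_(d < (2 * D).+1 | (0 < d)%N) d%:R / (totient d)%:R ^+ 2 * V al
    M d)).
  apply: (@le_trans _ _ (\sum_(d < (2 * D).+1 | (D < d)%N) d%:R / (totient d)%:R ^+ 2 * V
      al M d)).
    apply: ler_sum => d Dd; rewrite exprMn sqr_sqrtr ?primitive_energy_ge0 // exprVn.
    rewrite [V _ _ _ / _]mulrC mulrA; apply: ler_wpM2r; first exact: primitive_energy_ge0.
    by rewrite ler_wpM2r ?invr_ge0 ?sqr_ge0 // ler_nat ltnW.
  apply: (@ler_sum_ord_sub _ _ (fun d => D < d)%N (fun d => 0 < d)%N
    (fun d => d%:R / (totient d)%:R ^+ 2 * V al M d)).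
    by move=> d; rewrite mulr_ge0 ?primitive_energy_ge0 // divr_ge0 ?sqr_ge0.
  by move=> d -> Dd; rewrite (leq_ltn_trans (leq0n D) Dd).
apply: le_trans (large_sieve_primitive al M0 D20) _.
apply: (@le_trans _ _ (((2 * D)%:R ^+ 2 + 16 * M%:R) * M%:R)).
  by apply: ler_wpM2l norm2; rewrite addr_ge0 ?sqr_ge0 ?mulr_ge0.
rewrite natrM; move: (Num.sqrt _) sM s0 => s <- s0.
rewrite [leRHS]exprMn; apply: ler_wpM2r; first exact: sqr_ge0.
by have := mulr_ge0 (ltW DR) s0; nra.
Qed.

(** The expansion of [(2 * D + 4 * m) * m * (2 * D + 4 * y) * y / D], with [m] and [y] the square
    roots of [M] and [Y], after [D <= Q] in the first term and [D0 <= D] in the last: one bound for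
    all dyadic blocks. *)
Definition large_sieve_bound (M Y Q D0 : nat) : R :=
  Num.sqrt M%:R * Num.sqrt Y%:R * (4 * Q%:R + 8 * Num.sqrt M%:R +
    8 * Num.sqrt Y%:R + 16 * (Num.sqrt M%:R * Num.sqrt Y%:R) / D0%:R).

Lemma large_sieve_bound_ge0 M Y Q D0 : 0 <= large_sieve_bound M Y Q D0.
Proof. by rewrite mulr_ge0 ?addr_ge0 ?divr_ge0 ?mulr_ge0 ?sqrtr_ge0. Qed.

Lemma restrict_coprime_le1 al e : (forall m, `|al m| <= 1) ->
  forall m, `|restrict_coprime al e m| <= 1.
Proof.
by move=> al1 m; rewrite /restrict_coprime; case: coprime; rewrite ?mul1r ?mul0r ?normr0.
Qed.

Lemma sum_dyadic_conductors al la M Y Q D0 D e : (0 < M)%N -> (0 < Y)%N ->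
  (0 < D0 <= D)%N -> (D <= Q)%N -> (0 < e)%N ->
  (forall m, `|al m| <= 1) -> (forall m, `|la m| <= 1) ->
  \sum_(d < (2 * D).+1 | (D < d)%N) cb al la M Y d e <=
  large_sieve_bound M Y Q D0 / (totient e)%:R.
Proof.
move=> M0 Y0 /andP[D00 D0D] DQ e0 al1 la1.
have D1 : (0 < D)%N := leq_trans D00 D0D.
have DR : 0 < D%:R :> R by rewrite ltr0n.
have D0R : 0 < D0%:R :> R by rewrite ltr0n.
have DQR : D%:R <= Q%:R :> R by rewrite ler_nat.
have DDR : D0%:R <= D%:R :> R by rewrite ler_nat.
rewrite /conductor_bound; set al' := restrict_coprime al e; set la' := restrict_coprime la e.
pose f d := Num.sqrt (V al' M d) / (totient d)%:R.
pose g d := Num.sqrt (V la' Y d) / (totient d)%:R.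
rewrite (eq_bigr (fun d : 'I__ => f d * g d * (totient e)%:R^-1)); last first.
  by move=> d _; rewrite /f /g invfM expr2 invfM; ring.
rewrite -mulr_suml; apply: ler_wpM2r; first by rewrite invr_ge0.
have fg0 : 0 <= \sum_(d < (2 * D).+1 | (D < d)%N) f d * g d.
  by apply: sumr_ge0 => d _; rewrite mulr_ge0 ?divr_ge0 ?sqrtr_ge0.
have := sqrtr_ge0 (M%:R : R); have := sqrtr_ge0 (Y%:R : R).
have := sum_sqr_dyadic M0 D1 (restrict_coprime_le1 e al1).
have := sum_sqr_dyadic Y0 D1 (restrict_coprime_le1 e la1).
rewrite -/al' -/la' /large_sieve_bound; move: (Num.sqrt M%:R) (Num.sqrt Y%:R) => m y hy hm
    y0 m0.
have my0 : 0 <= m * y by apply: mulr_ge0.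
apply: (@le_trans _ _ (D%:R^-1 * ((2 * D%:R + 4 * m) * m * ((2 * D%:R + 4 * y) * y)))).
  rewrite -(@ler_pXn2r _ 2) ?nnegrE //; last first.
    by rewrite mulr_ge0 ?invr_ge0 // !mulr_ge0 ?addr_ge0 ?mulr_ge0.
  apply: le_trans (sum_prod_sqr _ _ _) _.
  apply: (@le_trans _ _ (D%:R^-1 * ((2 * D%:R + 4 * m) * m) ^+ 2 * (D%:R^-1 * ((2 * D%:R +
      4 * y) * y) ^+ 2))).
    by apply: ler_pM; rewrite ?sumr_ge0 // => d _; apply: sqr_ge0.
  by rewrite le_eqVlt; apply/orP; left; apply/eqP; ring.
rewrite (_ : D%:R^-1 * _ = m * y * (4 * D%:R + 8 * m + 8 * y + 16 * (m * y) / D%:R)); last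
    first.
  by field; rewrite gt_eqF.
apply: ler_wpM2l => //; apply: lerD.
  by rewrite !lerD2r ler_pM2l.
by apply: ler_wpM2l; rewrite ?mulr_ge0 // lef_pV2 ?posrE.
Qed.

Lemma sum_large_conductors al la M Y Q D0 e : (0 < M)%N -> (0 < Y)%N ->
  (0 < D0)%N -> (0 < e)%N ->
  (forall m, `|al m| <= 1) -> (forall m, `|la m| <= 1) ->
  \sum_(d < Q.+1 | (D0 < d)%N) cb al la M Y d e <=
  (trunc_log 2 Q).+1%:R * (large_sieve_bound M Y Q D0 / (totient e)%:R).
Proof.
move=> M0 Y0 D00 e0 al1 la1; set C := _ / _.
have C0 : 0 <= C by rewrite divr_ge0 ?large_sieve_bound_ge0.
have cb0 d : 0 <= cb al la M Y d e by apply: conductor_bound_ge0.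
have step i : \sum_(d < Q.+1 | (D0 < d <= D0 * 2 ^ i)%N) cb al la M Y d e <= i%:R * C.
  elim: i => [|i IH].
    rewrite mul0r big_pred0 // => d; rewrite muln1.
    by apply/negP => /andP[h1 /(leq_trans h1)]; rewrite ltnn.
  rewrite (bigID (fun d : 'I__ => (d <= D0 * 2 ^ i)%N)) /= -natr1 [leRHS]mulrDl mul1r.
  apply: lerD.
    apply: le_trans IH; apply: (@ler_sum_ord_sub _ _
      (fun d => (D0 < d <= D0 * 2 ^ i.+1) && (d <= D0 * 2 ^ i))%N
      (fun d => D0 < d <= D0 * 2 ^ i)%N (fun d => cb al la M Y d e)) => // d dQ.
    by move=> /andP[/andP[-> _] ->]; rewrite dQ.
  case: (leqP (D0 * 2 ^ i) Q) => h; last first.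
    rewrite big_pred0 // => d; apply/negP => /andP[_]; rewrite -ltnNge => h2.
    by have := leq_trans (ltn_trans h h2) (ltn_ord d : (d <= Q)%N); rewrite ltnn.
  apply: le_trans (sum_dyadic_conductors M0 Y0 _ h e0 al1 la1) => //; last first.
    by rewrite D00 leq_pmulr // expn_gt0.
  apply: (@ler_sum_ord_sub _ _
      (fun d => (D0 < d <= D0 * 2 ^ i.+1) && ~~ (d <= D0 * 2 ^ i))%N
      (fun d => D0 * 2 ^ i < d)%N (fun d => cb al la M Y d e)) => // d dQ.
  by move=> /andP[/andP[_ h1]]; rewrite -ltnNge => ->; rewrite andbT ltnS mulnCA -expnS.
apply: le_trans (step (trunc_log 2 Q).+1).
apply: (@ler_sum_ord_sub _ _ (fun d => D0 < d)%N
  (fun d => D0 < d <= D0 * 2 ^ (trunc_log 2 Q).+1)%N (fun d => cb al la M Y d e)) => // d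
      dQ ->.
rewrite dQ /=; apply: leq_trans (leq_pmull _ D00).
exact: leq_trans (dQ : (d <= Q)%N) (ltnW (trunc_log_ltn _ _)).
Qed.

(** The bounds for small and for large conductors depend on [e] only through [1 / totient e], which
    is summed separately. *)
Lemma sum_bilinear_error_le al la M Y Q D0 B (Del : R) : (0 < M)%N -> (0 < Y)%N ->
  (0 < D0)%N -> 0 <= Del ->
  (forall m, `|al m| <= 1) -> (forall m, `|la m| <= 1) ->
  (forall e d c, (0 < e <= Q)%N -> (1 < d <= D0)%N -> coprime d B -> coprime c d ->
    `|\sum_(p < Y | p == c %[mod d]) restrict_coprime la e p -
      (\sum_(p < Y | coprime p d) restrict_coprime la e p) / (totient d)%:R| <= Del) ->
  \sum_(q < Q.+1 | (0 < q)%N && coprime q B)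
     max_reduced q (bilinear_error al la M Y q) <=
  (\sum_(e < Q.+1 | (0 < e)%N) (totient e)%:R^-1) *
  (D0%:R ^+ 2 * M%:R * Del + (trunc_log 2 Q).+1%:R * large_sieve_bound M Y Q D0).
Proof.
move=> M0 Y0 D00 Del0 al1 la1 LD; apply: le_trans (sum_bilinear_error _ _ _ _ _ _) _.
rewrite mulr_suml; apply: ler_sum => e e0; rewrite [leRHS]mulrC [leRHS]mulrDl.
have cb0 d : 0 <= cb al la M Y d e by apply: conductor_bound_ge0.
rewrite (bigID (fun d : 'I__ => (d <= D0)%N)) /=; apply: lerD.
  apply: le_trans (sum_small_conductors M e0 Del0 al1 _); last first.
    have eQ : (0 < e <= Q)%N by rewrite e0 -ltnS ltn_ord.
    by move=> d c d1 dB cd; apply: LD eQ d1 dB cd.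
  apply: (@ler_sum_ord_sub _ _ (fun d => ((1 < d) && coprime d B) && (d <= D0))%N
    (fun d => (1 < d) && coprime d B)%N (fun d => cb al la M Y d e)) => // d dQ.
  by move=> /andP[-> dD]; rewrite ltnS dD.
rewrite -mulrA; apply: le_trans (sum_large_conductors _ M0 Y0 D00 e0 al1 la1).
apply: (@ler_sum_ord_sub _ _ (fun d => ((1 < d) && coprime d B) && ~~ (d <= D0))%N
    (fun d => D0 < d)%N (fun d => cb al la M Y d e)) => // d dQ.
by move=> /andP[_]; rewrite -ltnNge dQ.
Qed.

End LargeConductors.

(** * Products of primes as bilinear forms *)

Lemma prime_dvd_prod (I : finType) (f : I -> nat) (p : nat) : prime p ->
  (forall i, prime (f i)) -> (p %| \prod_i f i)%N -> exists i, f i = p.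
Proof.
move=> pp fpr; case: (pickP (fun i => p %| f i)%N) => [i pi _|none].
  by exists i; apply/eqP; rewrite eq_sym -dvdn_prime2.
elim/big_ind: _ => [|x y hx hy|i _]; last by rewrite none.
  by rewrite dvdn1 => /eqP p1; rewrite p1 in pp.
by rewrite Euclid_dvdM // => /orP[/hx|/hy].
Qed.

Section Cofactors.
Variables (R : realType) (P : set nat) (r : nat) (a b : 'I_r -> R) (N : R).
Hypothesis Pprime : forall p, P p -> prime p.
Local Notation F := (prime_products P a b N).

Definition signature (p : nat) : {ffun 'I_r -> bool} :=
  [ffun i => N `^ a i <= p%:R <= N `^ b i].

Definition cofactor_of (S : {ffun 'I_r -> bool}) (m : nat) : bool :=
  `[< exists p0, [/\ P p0, signature p0 = S, ~~ (p0 %| m)%N & F (p0 * m)%N] >].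

(* Which primes [p] prime to [m] satisfy [F (p * m)] only depends on the set of
   intervals containing [p]: [p] may replace any prime lying in the same ones. *)
Lemma cofactor_ofE p m : P p -> ~~ (p %| m)%N ->
  cofactor_of (signature p) m = `[< F (p * m)%N >].
Proof.
move=> Pp pm; apply/asboolP/asboolP; last by exists p.
case=> p0 [Pp0 sp0 p0m [f [fP finj fE]]].
have fpr i : prime (f i) by apply: Pprime; case: (fP i).
have [i0 fi0] : exists i0, f i0 = p0.
  by apply: prime_dvd_prod; rewrite ?Pprime // -fE dvdn_mulr.
have mE : m = (\prod_(i < r | i != i0) f i)%N.
  apply/eqP; rewrite -(eqn_pmul2l (prime_gt0 (Pprime Pp0))) fE.
  by rewrite (bigD1 i0) //= fi0.
exists (fun i => if i == i0 then p else f i); split.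
- move=> i; case: eqP => [->|_]; last exact: fP.
  split=> //; have := congr1 (fun s : {ffun 'I_r -> bool} => s i0) sp0.
  by rewrite !ffunE => <-; rewrite -fi0; case: (fP i0).
- have pf i : i != i0 -> p != f i.
    move=> ii0; apply: contra pm => /eqP ->; rewrite mE (bigD1 i) //=.
    exact: dvdn_mulr.
  move=> i j; case: (eqVneq i i0) => [->|ii0]; case: (eqVneq j i0) => [->|ji0] //.
  + by move=> E; case/eqP: (pf _ ji0).
  + by move=> E; case/eqP: (pf _ ii0).
  + exact: finj.
- rewrite (bigD1 i0) //= eqxx mE; congr (_ * _)%N; apply: eq_bigr => i.
  by move=> /negPf ->.
Qed.

Lemma prime_products_divisors n : F n ->
  (\sum_(p < n.+1 | `[< P p >] && (p %| n)) 1)%N = r.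
Proof.
case=> f [fP finj nE].
have fpr i : prime (f i) by apply: Pprime; case: (fP i).
have n0 : (0 < n)%N by rewrite nE prodn_gt0 // => i; apply: prime_gt0.
have fn i : (f i %| n)%N by rewrite nE (bigD1 i) //= dvdn_mulr.
have key (p : nat) : (if `[< P p >] && (p %| n)%N then 1 else 0)%N =
    (\sum_(i < r) (f i == p))%N.
  case: ifP => [/andP[/asboolP Pp pn]|Pp].
    have [i0 fi0] : exists i0, f i0 = p.
      by apply: prime_dvd_prod; rewrite ?Pprime // -nE.
    rewrite (bigD1 i0) //= fi0 eqxx big1 // => i ii0; apply/eqP; rewrite eqb0.
    by rewrite -fi0; apply: contra ii0 => /eqP /finj ->.
  rewrite big1 // => i _; apply/eqP; rewrite eqb0; apply/negP => /eqP fip.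
  move/negP: Pp; apply; rewrite -fip fn andbT; apply/asboolP.
  by case: (fP i).
rewrite big_mkcond; under eq_bigr => p _ do rewrite key.
rewrite exchange_big /=.
rewrite (eq_bigr (fun=> 1%N)) ?sum1_card ?card_ord // => i _.
have fin : (f i < n.+1)%N by rewrite ltnS dvdn_leq.
rewrite (bigD1 (Ordinal fin)) //= eqxx big1 // => p.
by rewrite -val_eqE /= eq_sym => /negPf ->.
Qed.

(** For a product [n], its divisors in [P] are its [r] factors, all at least [z]. The hypothesis on
    squares keeps [p] from dividing [n %/ p], as [cofactor_ofE] requires. *)
Lemma sum_cofactors z n : (0 < n)%N -> (forall i, z <= N `^ a i) ->
  (forall p, P p -> z <= p%:R -> ~~ (p ^ 2 %| n)%N) ->
  \sum_(p < n.+1 | [&& `[< P p >], z <= p%:R & (p %| n)%N])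
     (cofactor_of (signature p) (n %/ p))%:R = r%:R * beta P a b N n.
Proof.
move=> n0 zN sqf.
rewrite (eq_bigr (fun=> beta P a b N n)); last first.
  move=> p /and3P[/asboolP Pp zp pn].
  have pnp : ~~ (p %| n %/ p)%N.
    apply: contra (sqf _ Pp zp) => h.
    by have := dvdn_mul h (dvdnn p); rewrite divnK // mulnn.
  rewrite cofactor_ofE // mulnC divnK // /beta indicE.
case: (pselect (F n)) => h; last first.
  have -> : beta P a b N n = 0 by rewrite /beta indicE memNset.
  by rewrite big1 ?mulr0.
have -> : beta P a b N n = 1 by rewrite /beta indicE mem_set.
rewrite mulr1 -[in RHS](prime_products_divisors h) natr_sum.
apply: eq_bigl => p; case: (boolP `[< P p >]) => //= /asboolP Pp.
case: (boolP (p %| n)%N); rewrite ?andbF // => pn; rewrite andbT.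
have [f [fP finj nE]] := h.
have [i <-] : exists i, f i = p.
  apply: prime_dvd_prod; rewrite ?Pprime // -?nE // => i.
  by apply: Pprime; case: (fP i).
by have [_ /andP[fi _]] := fP i; apply: le_trans (zN i) fi.
Qed.

(** Since [r >= 2], the product has a prime factor besides [p0], and it divides [m]. This is what
    makes the cofactor variable long. *)
Lemma cofactor_of_ge S m z : (2 <= r)%N -> (forall i, z <= N `^ a i) ->
  cofactor_of S m -> z <= m%:R.
Proof.
move=> r2 zN /asboolP[p0 [Pp0 _ p0m [f [fP finj fE]]]].
have fpr i : prime (f i) by apply: Pprime; case: (fP i).
have m0 : (0 < m)%N by rewrite lt0n; apply: contra p0m => /eqP ->.
have [i fi] : exists i, f i != p0.
  pose i0 := Ordinal (ltn_trans (ltnSn 0) r2); pose i1 := Ordinal r2.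
  case: (eqVneq (f i0) p0) => [f0|?]; last by exists i0.
  exists i1; apply/eqP => f1; have := finj i0 i1.
  by rewrite f0 f1 => /(_ erefl) /(congr1 val).
have fim : (f i %| m)%N.
  have : (f i %| p0 * m)%N by rewrite fE (bigD1 i) //= dvdn_mulr.
  by rewrite Euclid_dvdM // (dvdn_prime2 (fpr i) (Pprime Pp0)) (negPf fi).
have [_ /andP[zi _]] := fP i.
by apply: le_trans (zN i) (le_trans zi _); rewrite ler_nat dvdn_leq.
Qed.

End Cofactors.

(** * Elementary bounds for arithmetic functions *)

Section ElementaryBounds.
Variable R : realType.

(** The shift [s] serves to count in a short interval, the factor [u] to count multiples of a
    square. *)
Lemma count_ap (u c q s k : nat) : (0 < q)%N -> coprime u q ->
  \sum_(n < k | (u * (s + n) == c %[mod q])%N) 1 <= k%:R / q%:R + 1 :> R.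
Proof.
move=> q0 uq; have qR : 0 < q%:R :> R by rewrite ltr0n.
apply: (@le_trans _ _ (\sum_(j < (k %/ q).+1) 1)); last first.
  rewrite sumr_const card_ord -natr1 lerD2r ler_pdivlMr // -natrM ler_nat.
  exact: leq_divM.
apply: (@ler_sum_injective R _ _ (fun n : 'I_k => n %/ q)%N _ (fun=> 1)) => //.
  move=> n n' /eqP un /eqP un' E; apply: val_inj => /=.
  have /eqP : (n == n' %[mod q])%N.
    by rewrite -(eqn_modDl s) -(eqn_mod_mul2l _ _ uq) un un'.
  by move=> nn; rewrite (divn_eq n q) (divn_eq n' q) E nn.
by move=> n _; rewrite ltnS leq_div2r // ltnW.
Qed.

Lemma expn2_size_primes (n : nat) : (0 < n)%N -> (2 ^ size (primes n) <= n)%N.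
Proof.
move=> n0; apply: (@leq_trans (\prod_(p <- primes n) p ^ logn p n)%N); last first.
  by rewrite [leqRHS]prod_prime_decomp // prime_decompE big_map.
rewrite -sum1_size expn_sum.
rewrite big_seq [leqRHS]big_seq; apply: leq_prod => p; rewrite mem_primes => /and3P[pp _ pn].
apply: (leq_trans (prime_gt1 pp)); rewrite -[leqLHS]expn1 leq_exp2l ?prime_gt1 //.
by rewrite logn_gt0 mem_primes pp n0.
Qed.

Lemma size_primes_le (n : nat) : (size (primes n) <= trunc_log 2 n)%N.
Proof.
case: (posnP n) => [->//|n0].
by rewrite trunc_log_max // expn2_size_primes.
Qed.

(** The [i]-th element is at least [b + i], so the product of the ratios [p / p.-1] is at most the
    telescoping product of [(b + i) / (b + i - 1)]. *)
Lemma prod_sorted_le (s : seq nat) (b : nat) : (0 < b)%N -> path ltn b s ->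
  (b * \prod_(p <- s) p <= (b + size s) * \prod_(p <- s) p.-1)%N.
Proof.
elim: s b => [|p s IH] b b0 /=; first by rewrite !big_nil addn0.
move=> /andP[bp ps]; rewrite !big_cons.
have p0 : (0 < p)%N := leq_ltn_trans (leq0n b) bp.
have := IH p p0 ps; move: (\prod_(j <- s) j)%N (\prod_(j <- s) j.-1)%N (size s) => x y n h.
apply: (@leq_trans (b * ((p + n) * y))%N); first by rewrite leq_mul2l h orbT.
rewrite !mulnA leq_mul2r; apply/orP; right.
case: p bp p0 {ps h} => // p bp _ /=.
have : (b * n.+1 <= p * n.+1)%N by rewrite leq_mul2r orbC -ltnS bp.
rewrite !mulnDl !mulnDr !mulnS; nia.
Qed.

(** The case [b = 1] of [prod_sorted_le] for the prime divisors of [e], as [e / totient e] is the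
    product of their ratios [p / p.-1]. *)
Lemma leq_size_primes_totient (e : nat) : (0 < e)%N ->
  (e <= (size (primes e)).+1 * totient e)%N.
Proof.
move=> e0; have eE : e = (\prod_(p <- primes e) p ^ logn p e)%N.
  by rewrite [LHS]prod_prime_decomp // prime_decompE big_map.
have tE := totientE e0.
have : (1 * \prod_(p <- primes e) p <= (1 + size (primes e)) * \prod_(p <- primes e) p.-1)%N.
  apply: prod_sorted_le => //; have := sorted_primes e.
  case E : (primes e) => [//|p s] /= ->; rewrite andbT.
  have : p \in primes e by rewrite E mem_head.
  by rewrite mem_primes => /andP[/prime_gt1].
rewrite mul1n add1n => h.
have d : (e = \prod_(p <- primes e) p * \prod_(p <- primes e) p ^ (logn p e).-1)%N.
  rewrite {1}eE -big_split big_seq [RHS]big_seq /=; apply: eq_bigr => p pe.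
  by rewrite -expnS prednK // logn_gt0.
rewrite {1}d tE big_split /= mulnA leq_mul2r h orbT //.
Qed.

Lemma harmonic_dyadic (i : nat) :
  \sum_(e < 2 ^ i | (0 < e)%N) (e%:R)^-1 <= i%:R :> R.
Proof.
elim: i => [|i IH].
  by rewrite big_mkcond big_ord_recl big_ord0 /= addr0.
rewrite expnS mul2n -addnn big_mkcond big_split_ord /= -natr1; apply: lerD.
  by rewrite -big_mkcond.
apply: (@le_trans _ _ (\sum_(j < 2 ^ i) ((2 ^ i)%:R)^-1)).
  have i0 : 0 < (2 ^ i)%:R :> R by rewrite ltr0n expn_gt0.
  apply: ler_sum => j _; rewrite addn_gt0 expn_gt0 /=.
  by rewrite lef_pV2 ?posrE // ?ltr0n ?addn_gt0 ?expn_gt0 // ler_nat leq_addr.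
by rewrite sumr_const card_ord -[X in X <= _]mulr_natl divff // pnatr_eq0 expn_eq0.
Qed.

(** Below [2 ^ l] a number has fewer than [l] prime divisors, so [1 / totient e <= l / e]; the
    harmonic sum costs another [l]. *)
Lemma sum_inv_totient (Q l : nat) : (Q < 2 ^ l)%N ->
  \sum_(e < Q.+1 | (0 < e)%N) (totient e)%:R^-1 <= l%:R ^+ 2 :> R.
Proof.
move=> Ql; have el (e : nat) : (0 < e)%N -> (e < Q.+1)%N -> (size (primes e) < l)%N.
  move=> e0 eQ; rewrite -(@ltn_exp2l 2) //.
  exact: leq_ltn_trans (expn2_size_primes e0) (leq_ltn_trans (eQ : (e <= Q)%N) Ql).
apply: (@le_trans _ _ (\sum_(e < Q.+1 | (0 < e)%N) l%:R * (e%:R)^-1)).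
  apply: ler_sum => e e0.
  rewrite ler_pdivlMr ?ltr0n // ler_pdivrMl ?ltr0n ?totient_gt0 // mulrC -natrM ler_nat.
  apply: leq_trans (leq_size_primes_totient e0) _.
  by rewrite leq_mul2r el ?orbT.
rewrite -mulr_sumr expr2; apply: ler_wpM2l => //.
apply: le_trans (harmonic_dyadic l).
apply: (@ler_sum_ord_sub R _ _ (fun e => 0 < e)%N (fun e => 0 < e)%N (fun e => (e%:R)^-1)).
  by move=> e; rewrite invr_ge0.
by move=> e eQ ->; rewrite (leq_ltn_trans (eQ : (e <= Q)%N) Ql).
Qed.

Lemma sum_inv_sqr_ge (z : R) (n : nat) : 1 <= z ->
  \sum_(p < n | z <= p%:R) (p%:R ^+ 2)^-1 <= 2 / z.
Proof.
move=> z1; have z0 : 0 < z by apply: lt_le_trans z1.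
(* The induction telescopes, because [1 / n ^ 2 <= 2 / n - 2 / (n + 1)] for [n >= 1]. *)
suff : \sum_(p < n | z <= p%:R) (p%:R ^+ 2)^-1 <=
    if z <= n%:R then 2 / z - 2 / n%:R else 0.
  move=> h; apply: le_trans h _; case: ifP => h; first by rewrite gerBl divr_ge0.
  by rewrite divr_ge0 // ltW.
elim: n => [|n IH]; first by rewrite big_ord0 [z <= _]leNgt z0.
rewrite big_mkcond big_ord_recr -big_mkcond /= -natr1.
case: ifP IH => zn IH.
  rewrite ifT; last by apply: le_trans zn _; rewrite lerDl.
  have n0 : 0 < n%:R :> R by apply: lt_le_trans zn.
  have n1 : 0 < n%:R + 1 :> R by rewrite addr_gt0.
  apply: le_trans (lerD IH (lexx _)) _.
  rewrite -subr_ge0 (_ : _ - _ = (n%:R - 1) / (n%:R ^+ 2 * (n%:R + 1))); last first.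
    by field; rewrite !gt_eqF.
  by rewrite divr_ge0 ?mulr_ge0 ?exprn_ge0 ?(ltW n1) // subr_ge0 (le_trans z1).
rewrite addr0; case: ifP => zn1 //; apply: le_trans IH _.
by rewrite subr_ge0 ler_wpM2l // lef_pV2 ?posrE // (lt_le_trans z0).
Qed.

Lemma bernoulli_double (h : nat) : (0 < h)%N -> 2 <= (1 + h%:R^-1) ^+ h :> R.
Proof.
move=> h0; have hR : 0 < h%:R :> R by rewrite ltr0n.
have bern n : 1 + n%:R * h%:R^-1 <= (1 + h%:R^-1) ^+ n :> R.
  elim: n => [|n IH]; first by rewrite mul0r addr0.
  rewrite exprS; apply: (@le_trans _ _ ((1 + h%:R^-1) * (1 + n%:R * h%:R^-1))).
    rewrite -natr1 -subr_ge0 (_ : _ - _ = n%:R * h%:R^-1 ^+ 2); last by ring.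
    by rewrite mulr_ge0 ?sqr_ge0.
  by apply: ler_wpM2l IH; rewrite addr_ge0 ?invr_ge0.
by have := bern h; rewrite divff ?gt_eqF.
Qed.

End ElementaryBounds.

(** * Exceptional integers in arithmetic progressions *)

Section Exceptional.
Variables (R : realType) (P : set nat).

(** The first clause marks the [n = m * p] for which [m] times the upper end of the interval of [p]
    may exceed [X]; the second those for which [p] may divide its own cofactor. *)
Definition exceptional (X z eta : R) (n : nat) : bool :=
  (X < n%:R * (1 + eta)) || `[< exists p, [/\ P p, z <= p%:R & (p ^ 2 %| n)%N] >].

Lemma truncnS_le (x : R) : 0 <= x -> (Num.truncn x).+1%:R <= x + 1.
Proof. by move=> x0; rewrite -natr1 lerD2r truncn_le. Qed.

Lemma lt_truncnS (x : R) (n : nat) : n%:R <= x -> (n < (Num.truncn x).+1)%N.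
Proof. by move=> nx; rewrite -(ltr_nat R) (le_lt_trans nx) // truncnS_gt. Qed.

Lemma exceptional_short (X eta : R) (q c : nat) : 1 <= X -> 0 <= eta -> (0 < q)%N ->
  \sum_(n < (Num.truncn X).+1 | (X < n%:R * (1 + eta)) && (n == c %[mod q])) 1 <=
  eta * X / q%:R + 2 :> R.
Proof.
move=> X1 eta0 q0; have X0 : 0 < X by apply: lt_le_trans X1.
have e1 : 0 < 1 + eta by rewrite ltr_pwDl.
have qR : 1 <= q%:R :> R by rewrite ler1n.
pose x := X / (1 + eta); pose s := (Num.truncn x).+1.
have x0 : 0 <= x by rewrite divr_ge0 // ltW.
pose k := ((Num.truncn X).+1 - s)%N.
have kX : k%:R <= X - x + 1.
  have sX : (s <= (Num.truncn X).+1)%N.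
    by rewrite ltnS le_truncn // ler_pdivrMr // ler_peMr ?(ltW X0) // lerDl.
  rewrite natrB //; have := truncnS_le (ltW X0); have := truncnS_gt x; rewrite -/s; lra.
have Xx : X - x <= eta * X.
  have -> : X - x = eta * x by rewrite /x; field; rewrite gt_eqF.
  by rewrite ler_wpM2l // ler_pdivrMr // ler_peMr ?(ltW X0) // lerDl.
apply: (@le_trans _ _ (k%:R / q%:R + 1)); last first.
  apply: (@le_trans _ _ ((eta * X + 1) / q%:R + 1)).
    by rewrite lerD2r ler_wpM2r ?invr_ge0 //; lra.
  rewrite mulrDl mul1r -addrA lerD2l (_ : 2 = 1 + 1) // lerD2r.
  by rewrite invf_le1 // (lt_le_trans _ qR).
apply: le_trans (count_ap R c s k q0 (coprime1n q)).
pose F j : R := if (1 * (s + j) == c %[mod q])%N then 1 else 0.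
have sn (n : nat) : X < n%:R * (1 + eta) -> (s <= n)%N.
  rewrite -ltr_pdivrMr // => xn; rewrite -(ltr_nat R); apply: le_lt_trans xn.
  by rewrite truncn_le.
rewrite [leRHS]big_mkcond (eq_bigr (fun n : 'I__ => F (n - s)%N)); last first.
  by move=> n /andP[/sn sn' nc]; rewrite /F mul1n subnKC // nc.
apply: (@ler_sum_injective R _ _ (fun n : 'I__ => n - s)%N k F).
- by move=> j; rewrite /F; case: ifP.
- move=> n n' /andP[/sn h _] /andP[/sn h' _] E; apply: val_inj => /=.
  by rewrite -(subnK h) E subnK.
- by move=> n /andP[/sn h _]; rewrite ltn_sub2r // (leq_ltn_trans h).
Qed.

Lemma sqr_multiples_ap (X : R) (p q c : nat) : 0 <= X -> (0 < p)%N -> (0 < q)%N -> coprime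
    c q ->
  \sum_(n < (Num.truncn X).+1 | [&& n%:R < X, (p ^ 2 %| n)%N & (n == c %[mod q])%N]) 1 <=
  X / q%:R * (p%:R ^+ 2)^-1 + 2 :> R.
Proof.
move=> X0 p0 q0 cq; have pR : 0 < p%:R :> R by rewrite ltr0n.
have qR : 1 <= q%:R :> R by rewrite ler1n.
have q0' : 0 < q%:R :> R by rewrite ltr0n.
have RHS0 : 0 <= X / q%:R * (p%:R ^+ 2)^-1 by rewrite !mulr_ge0 ?invr_ge0 ?sqr_ge0.
(* If [p ^ 2] and [q] share a factor nothing is counted, as [c] is prime to [q]; otherwise [p ^ 2]
   is invertible modulo [q] and the condition falls on [n %/ p ^ 2]. *)
case: (boolP (coprime (p ^ 2) q)) => pq; last first.
  rewrite big_pred0 ?addr_ge0 // => n; apply/negP => /and3P[_ pn /eqP nc].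
  move/negP: pq; apply; apply: (coprime_dvdl pn).
  by rewrite -coprime_modl nc coprime_modl.
pose k := (Num.truncn (X / p%:R ^+ 2)).+1.
have X'0 : 0 <= X / p%:R ^+ 2 by rewrite divr_ge0 ?sqr_ge0.
apply: (@le_trans _ _ (k%:R / q%:R + 1)); last first.
  apply: (@le_trans _ _ ((X / p%:R ^+ 2 + 1) / q%:R + 1)).
    by rewrite lerD2r ler_wpM2r ?invr_ge0 // truncnS_le.
  rewrite mulrDl mul1r -addrA mulrAC lerD2l (_ : 2 = 1 + 1) // lerD2r.
  by rewrite invf_le1.
apply: le_trans (count_ap R c 0 k q0 pq).
pose F j : R := if (p ^ 2 * (0 + j) == c %[mod q])%N then 1 else 0.
rewrite [leRHS]big_mkcond (eq_bigr (fun n : 'I__ => F (n %/ p ^ 2)%N)); last first.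
  by move=> n /and3P[_ pn nc]; rewrite /F add0n mulnC divnK // nc.
apply: (@ler_sum_injective R _ _ (fun n : 'I__ => n %/ p ^ 2)%N k F).
- by move=> j; rewrite /F; case: ifP.
- move=> n n' /and3P[_ h _] /and3P[_ h' _] E; apply: val_inj => /=.
  by rewrite -(divnK h) E divnK.
- move=> n /and3P[nX pn _]; apply: lt_truncnS.
  by rewrite ler_pdivlMr ?exprn_gt0 // -natrX -natrM divnK // ltW.
Qed.

Lemma exceptional_ap (X z eta : R) (q c : nat) : 1 <= X -> 1 <= z -> 0 <= eta ->
  (0 < q)%N -> coprime c q ->
  \sum_(n < (Num.truncn X).+1 | [&& (0 < n)%N, n%:R < X, exceptional X z eta n &
      (n == c %[mod q])%N]) 1 <=
  (eta + 2 / z) * X / q%:R + 4 * Num.sqrt X :> R.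
Proof.
move=> X1 z1 eta0 q0 cq; have X0 : 0 <= X by apply: le_trans X1.
have sX1 : 1 <= Num.sqrt X by rewrite -[leLHS]sqrtr1 ler_sqrt.
have sX0 : 0 <= Num.sqrt X := sqrtr_ge0 X.
have q0' : 0 < q%:R :> R by rewrite ltr0n.
(* If [p ^ 2] divides a positive [n < X] then [p <= T]; the error 2 for each such [p] adds up to the
   term in [Num.sqrt X]. *)
pose T := (Num.truncn (Num.sqrt X)).
pose B n := \sum_(p < T.+1 | z <= p%:R)
   (if [&& n%:R < X, (p ^ 2 %| n)%N & (n == c %[mod q])%N] then 1 else 0 : R).
pose A n := if (X < n%:R * (1 + eta)) && (n == c %[mod q])%N then 1 else 0 : R.
apply: (@le_trans _ _ (\sum_(n < (Num.truncn X).+1) (A n + B n))).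
  rewrite big_mkcond; apply: ler_sum => n _.
  have A0 : 0 <= A n by rewrite /A; case: ifP.
  have B0 : 0 <= B n by apply: sumr_ge0 => p _; case: ifP.
  case: ifP => [/and4P[n0 nX + nc]|_]; last by rewrite addr_ge0.
  case/orP => [h|/asboolP[p [Pp zp pn]]]; first by rewrite /A h nc lerDl.
  have pT : (p < T.+1)%N.
    apply: lt_truncnS; rewrite -(@ler_pXn2r _ 2) ?nnegrE // sqr_sqrtr //.
    by rewrite -natrX (le_trans _ (ltW nX)) // ler_nat dvdn_leq.
  rewrite /B (bigD1 (Ordinal pT)) //= nX pn nc addrCA lerDl addr_ge0 //.
  by apply: sumr_ge0 => p' _; case: ifP.
rewrite big_split /= [leRHS](_ : _ = (eta * X / q%:R + 2) +
   (X / q%:R * (2 / z) + (4 * Num.sqrt X - 2))); last by ring.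
apply: lerD; first by rewrite -big_mkcond; apply: exceptional_short.
rewrite exchange_big /=.
apply: (@le_trans _ _ (\sum_(p < T.+1 | z <= p%:R) (X / q%:R * (p%:R ^+ 2)^-1 + 2))).
  apply: ler_sum => p zp; rewrite -big_mkcond; apply: sqr_multiples_ap => //.
  by rewrite -(ltr_nat R) (lt_le_trans _ (le_trans z1 zp)).
rewrite big_split -mulr_sumr /=; apply: lerD.
  by apply: ler_wpM2l; [rewrite divr_ge0|apply: sum_inv_sqr_ge].
have : \sum_(p < T.+1 | z <= p%:R) 2 <= 2 * Num.sqrt X.
  rewrite big_mkcond big_ord_recl /= [z <= _]leNgt (lt_le_trans _ z1) // add0r.
  apply: (@le_trans _ _ (\sum_(p < T) 2)).
    by apply: ler_sum => p _; case: ifP.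
  by rewrite sumr_const card_ord -[leLHS]mulr_natr ler_wpM2l // truncn_le.
lra.
Qed.

End Exceptional.

Lemma sum_mem_seq_le (R : realType) (s : seq nat) (n : nat) :
  \sum_(p < n | (p : nat) \in s) (1 : R) <= (size s)%:R.
Proof.
rewrite -(big_mkord (fun p => p \in s) (fun=> 1)) -big_filter.
rewrite big_const_seq count_predT iter_addr_0 ler_nat.
apply: uniq_leq_size; first by rewrite filter_uniq // iota_uniq.
by move=> p; rewrite mem_filter => /andP[].
Qed.

(** * Approximation of the products by bilinear forms *)

Section Reduction.
Variables (R : realType) (P : set nat) (r : nat) (a b : 'I_r -> R) (N : R).
Hypothesis Pprime : forall p, P p -> prime p.
Variables (X z eta : R) (J : nat).
Hypotheses (X1 : 1 <= X) (z1 : 1 <= z) (eta0 : 0 <= eta).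
Hypotheses (zN : forall i, z <= N `^ a i) (XJ : X <= z * (1 + eta) ^+ J).

Definition breakpoint (j : nat) : R := z * (1 + eta) ^+ j.

Definition prime_weight (S : {ffun 'I_r -> bool}) (j p : nat) : R :=
  [&& `[< P p >], signature a b N p == S, breakpoint j <= p%:R
    & p%:R < breakpoint j.+1]%:R.

Definition cofactor_weight (S : {ffun 'I_r -> bool}) (j m : nat) : R :=
  [&& (0 < m)%N, cofactor_of P a b N S m & m%:R * breakpoint j.+1 <= X]%:R.

Definition cofactor_range (j : nat) : nat := (Num.truncn (X / breakpoint j.+1)).+1.
Definition prime_range (j : nat) : nat := (Num.truncn (breakpoint j.+1)).+1.

Definition bilinear_model (n : nat) : R :=
  \sum_(j < J) \sum_S \sum_(m < cofactor_range j) \sum_(p < prime_range j)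
    cofactor_weight S j m * prime_weight S j p * (m * p == n)%N%:R.

Lemma breakpoint_gt0 j : 0 < breakpoint j.
Proof. by rewrite mulr_gt0 ?exprn_gt0 ?ltr_pwDl // (lt_le_trans _ z1). Qed.

Lemma breakpointS j : breakpoint j.+1 = breakpoint j * (1 + eta).
Proof. by rewrite /breakpoint exprSr mulrA. Qed.

Lemma breakpoint_le j : breakpoint j <= breakpoint j.+1.
Proof. by rewrite breakpointS ler_peMr ?lerDl // ltW // breakpoint_gt0. Qed.

Lemma sum_breakpoints (x : R) :
  \sum_(j < J) (breakpoint j <= x < breakpoint j.+1)%R%:R =
  (z <= x)%R%:R - (breakpoint J <= x)%R%:R :> R.
Proof.
have z0 : z = breakpoint 0 by rewrite /breakpoint expr0 mulr1.
rewrite [in RHS]z0; clear XJ; elim: J => [|j IH]; first by rewrite big_ord0 subrr.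
rewrite big_ord_recr /= IH; have := breakpoint_le j.
case: (leP (breakpoint j.+1) x) => h2 h1.
  by rewrite (le_trans h1 h2) addr0.
by rewrite andbT subrK subr0.
Qed.

Lemma bilinear_modelE n : (0 < n)%N ->
  bilinear_model n = \sum_(p < n.+1 | (p %| n)%N) \sum_(j < J) \sum_S
     cofactor_weight S j (n %/ p) * prime_weight S j p.
Proof.
move=> n0; rewrite /bilinear_model [RHS]exchange_big /=; apply: eq_bigr => j _.
rewrite [RHS]exchange_big /=; apply: eq_bigr => S _.
rewrite [LHS]exchange_big /=.
pose f p := (p %| n)%:R * (cofactor_weight S j (n %/ p) * prime_weight S j p).
have inner (p : nat) : \sum_(m < cofactor_range j)
    cofactor_weight S j m * prime_weight S j p * (m * p == n)%N%:R = f p.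
  rewrite /f; case: (boolP (p %| n)%N) => pn; last first.
    rewrite mul0r big1 // => m _; case: eqP => mp; last by rewrite mulr0.
    by move: pn; rewrite -mp dvdn_mull.
  have p0 := dvdn_gt0 n0 pn.
  rewrite mul1r (eq_bigr (fun m : 'I__ =>
    cofactor_weight S j m * prime_weight S j p * (m == n %/ p :> nat)%N%:R)); last first.
    by move=> m _; rewrite [(m * p)%N == n]eq_sym (eqn_mul _ p0 pn) eq_sym.
  case: (ltnP (n %/ p) (cofactor_range j)) => h.
    rewrite (bigD1 (Ordinal h)) //= eqxx mulr1 big1 ?addr0 // => m.
    by rewrite -val_eqE /= => /negPf ->; rewrite mulr0.
  rewrite big1 => [|m _]; last first.
    by rewrite (ltn_eqF (leq_trans (ltn_ord m) h)) mulr0.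
  rewrite /cofactor_weight.
  have -> : ((n %/ p)%:R * breakpoint j.+1 <= X) = false.
    apply: contraTF h => h; rewrite -ltnNge; apply: lt_truncnS.
    by rewrite ler_pdivlMr ?breakpoint_gt0.
  by rewrite !andbF mul0r.
rewrite (eq_bigr (fun p : 'I__ => f p)) => [|p _]; last exact: inner.
have f0 p : (prime_range j <= p)%N -> f p = 0.
  move=> h; rewrite /f /prime_weight.
  have -> : (p%:R < breakpoint j.+1) = false.
    by apply: contraTF h => h; rewrite -ltnNge; apply: lt_truncnS; apply: ltW.
  by rewrite !andbF !mulr0.
have f0' p : (n < p)%N -> f p = 0.
  by move=> h; rewrite /f gtnNdvd // mul0r.
rewrite [RHS]big_mkcond [RHS](eq_bigr (fun p : 'I__ => f p)); last first.
  by move=> p _; rewrite /f; case: ifP => _; rewrite ?mul1r ?mul0r.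
pose L := maxn (prime_range j) n.+1.
transitivity (\sum_(p < L) f p).
  rewrite (big_ord_widen _ f (leq_maxl _ n.+1 : (prime_range j <= L)%N)) big_mkcond.
  by apply: eq_bigr => p _; case: ltnP => // h; rewrite f0.
rewrite (big_ord_widen _ f (leq_maxr (prime_range j) _ : (n.+1 <= L)%N)) [RHS]big_mkcond.
by apply: eq_bigr => p _; case: ltnP => // h; rewrite f0'.
Qed.

Lemma sum_signatures j p m :
  \sum_S cofactor_weight S j m * prime_weight S j p =
  (breakpoint j <= p%:R < breakpoint j.+1)%R%:R *
  [&& `[< P p >], (0 < m)%N, cofactor_of P a b N (signature a b N p) m &
     m%:R * breakpoint j.+1 <= X]%:R.
Proof.
rewrite (bigD1 (signature a b N p)) //= big1 ?addr0 => [|S Sp]; last first.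
  by rewrite /prime_weight eq_sym (negPf Sp) andbF mulr0.
rewrite /cofactor_weight /prime_weight eqxx /= -!natrM !mulnb; congr (nat_of_bool _)%:R.
by case: `[< _ >]; case: (_ && (_ < _)); case: (_ < m)%N; case: cofactor_of; case: (_ <=
    X); rewrite ?andbF.
Qed.

(** A prime divisor of [n] lies in at most one interval and has one signature, so it contributes at
    most 1. *)
Lemma bilinear_model_bound n : (0 < n)%N ->
  0 <= bilinear_model n <= (size (primes n))%:R.
Proof.
move=> n0; rewrite bilinear_modelE //; apply/andP; split.
  apply: sumr_ge0 => p _; apply: sumr_ge0 => j _; apply: sumr_ge0 => S _.
  by rewrite mulr_ge0.
apply: (@le_trans _ _ (\sum_(p < n.+1 | (p : nat) \in primes n) (1 : R))).
  rewrite big_mkcond [leRHS]big_mkcond; apply: ler_sum => p _.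
  case: (boolP (p %| n)%N) => pn; last by case: ifP.
  rewrite mem_primes n0 pn andbT /=.
  case: (boolP `[< P p >]) => Pp; last first.
    rewrite big1 => [|j _]; last by rewrite sum_signatures (negPf Pp) mulr0.
    by case: ifP.
  rewrite Pprime; last exact/asboolP.
  apply: (@le_trans _ _ (\sum_(j < J) (breakpoint j <= p%:R < breakpoint j.+1)%R%:R)).
    apply: ler_sum => j _; rewrite sum_signatures.
    by rewrite ler_piMr //; case: (_ && _).
  by rewrite sum_breakpoints; case: (z <= _); case: (breakpoint J <= _) => /=; lra.
exact: sum_mem_seq_le.
Qed.

(** If [breakpoint j <= p], the upper end of the interval is at most [p * (1 + eta)]; hence
    [n * (1 + eta) <= X] makes the condition on the cofactor automatic, and [sum_cofactors]
    applies. *)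
Lemma bilinear_model_beta n : (0 < n)%N -> n%:R < X -> ~~ exceptional P X z eta n ->
  bilinear_model n = r%:R * beta P a b N n.
Proof.
move=> n0 nX; rewrite /exceptional negb_or -leNgt => /andP[nX' /asboolPn sqf].
rewrite bilinear_modelE // -(sum_cofactors b Pprime (z := z) n0 zN); last first.
  by move=> p Pp zp; apply/negP => pn; apply: sqf; exists p.
rewrite [RHS]big_mkcond [LHS]big_mkcond; apply: eq_bigr => p _.
case: (boolP (p %| n)%N) => pn; last by rewrite !andbF.
have p0 := dvdn_gt0 n0 pn; have pR : 0 < p%:R :> R by rewrite ltr0n.
have m0 : (0 < n %/ p)%N by rewrite divn_gt0 // dvdn_leq.
have nE : n%:R = (n %/ p)%:R * p%:R :> R by rewrite -natrM divnK.
have pJ : p%:R < breakpoint J.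
  by apply: lt_le_trans XJ; apply: le_lt_trans nX; rewrite ler_nat dvdn_leq.
transitivity (\sum_(j < J) (breakpoint j <= p%:R < breakpoint j.+1)%R%:R *
    (`[< P p >] && cofactor_of P a b N (signature a b N p) (n %/ p))%:R : R).
  apply: eq_bigr => j _; rewrite sum_signatures m0 /=.
  case: (boolP (breakpoint j <= p%:R < _)) => [/andP[jp _]|_]; last by rewrite !mul0r.
  have -> : (n %/ p)%:R * breakpoint j.+1 <= X.
    apply: le_trans nX'; rewrite breakpointS mulrA nE ler_wpM2r ?addr_ge0 //.
    by rewrite ler_wpM2l.
  by rewrite !mul1r andbT.
rewrite -mulr_suml sum_breakpoints [breakpoint J <= _]leNgt pJ subr0.
by case: `[< _ >]; case: (z <= _); rewrite /= ?mul1r ?mul0r ?mulr0.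
Qed.

(** On exceptional [n] both quantities still lie between 0 and the number of prime divisors of
    [n]. *)
Lemma bilinear_model_approx n : (0 < n)%N -> n%:R < X ->
  `|r%:R * beta P a b N n - bilinear_model n| <=
  (trunc_log 2 (Num.truncn X))%:R * (exceptional P X z eta n)%:R.
Proof.
move=> n0 nX; case: (boolP (exceptional P X z eta n)) => ex; last first.
  by rewrite bilinear_model_beta // subrr normr0 mulr0.
have sW : (size (primes n))%:R <= (trunc_log 2 (Num.truncn X))%:R :> R.
  rewrite ler_nat; apply: leq_trans (size_primes_le n) _; apply: leq_trunc_log.
  by rewrite -ltnS; apply: lt_truncnS; apply: ltW.
have rb : 0 <= r%:R * beta P a b N n <= (size (primes n))%:R.
  rewrite /beta indicE; case: (pselect (prime_products P a b N n)) => h; last first.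
    by rewrite memNset // mulr0 lexx ler0n.
  rewrite mem_set // mulr1 ler0n /= -(prime_products_divisors Pprime h) natr_sum.
  apply: le_trans (sum_mem_seq_le R _ n.+1); rewrite big_mkcond [leRHS]big_mkcond.
  apply: ler_sum => p _; case: ifP => [/andP[/asboolP Pp pn]|_]; last by case: ifP.
  by rewrite mem_primes n0 pn Pprime.
rewrite mulr1; apply: le_trans sW; have := bilinear_model_bound n0.
move: rb => /andP[? ?] /andP[? ?]; rewrite ler_norml; lra.
Qed.

Definition progression_error (f : nat -> R) (q c : nat) : R :=
  `| \sum_(1 <= n < (Num.truncn X).+1 | n%:R < X)
       (1 / (totient q)%:R * coprime_part f q n - ap_part f q c n) |.

Lemma progression_error_le q c : (0 < r)%N -> (0 < q)%N -> coprime c q ->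
  progression_error (beta P a b N) q c <=
  \sum_(j < J) \sum_S bilinear_error (cofactor_weight S j) (prime_weight S j)
     (cofactor_range j) (prime_range j) q c +
  2 * (trunc_log 2 (Num.truncn X))%:R * ((eta + 2 / z) * X / q%:R + 4 * Num.sqrt X).
Proof.
move=> r0 q0 cq; rewrite /progression_error big_geq_mkord.
pose inX (n : nat) := (n%:R < X) && (1 <= n)%N.
rewrite (eq_bigl (fun n : 'I__ => inX n)) //.
have phi0 : 0 < (totient q)%:R :> R by apply: totient_pos.
pose h n : R := (coprime n q)%:R / (totient q)%:R - (n == c %[mod q])%:R.
have hE f n : 1 / (totient q)%:R * coprime_part f q n - ap_part f q c n = h n * f n.
  rewrite /h /coprime_part /ap_part mulrBl; congr (_ - _).
    by case: coprime; rewrite ?mulr0 ?mul0r // mul1r.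
  by case: ifP => _; rewrite ?mul1r ?mul0r.
rewrite (eq_bigr (fun n : 'I__ => h n * beta P a b N n)) => [|n _]; last exact: hE.
set W : R := (trunc_log 2 _)%:R; set Ex := _ + 4 * Num.sqrt X.
have W0 : 0 <= W by apply: ler0n.
apply: (@le_trans _ _ `|\sum_(n < (Num.truncn X).+1 | inX n) h n * (r%:R * beta P a b N n)|).
  rewrite [X in _ <= `|X|](_ : _ = r%:R * \sum_(n < (Num.truncn X).+1 | inX n) h n * beta P
      a b N n); last first.
    by rewrite mulr_sumr; apply: eq_bigr => n _; rewrite mulrCA.
  by rewrite normrM normr_nat ler_peMl // ler1n.
rewrite (eq_bigr (fun n : 'I__ => h n * bilinear_model n +
   h n * (r%:R * beta P a b N n - bilinear_model n))); last first.
  by move=> n _; rewrite -mulrDr addrC subrK.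
rewrite big_split /=; apply: le_trans (ler_normD _ _) _; apply: lerD.
  rewrite [X in `|X|](_ : _ = \sum_(j < J) \sum_S \sum_(m < cofactor_range j)
    \sum_(p < prime_range j) cofactor_weight S j m * prime_weight S j p * h (m * p)%N).
    apply: le_trans (ler_norm_sum _ _ _) _; apply: ler_sum => j _.
    apply: le_trans (ler_norm_sum _ _ _) _; apply: ler_sum => S _.
    rewrite /bilinear_error -normrN -sumrN le_eqVlt; apply/orP; left; apply/eqP.
    congr (`| _ |); apply: eq_bigr => m _; rewrite -sumrN; apply: eq_bigr => p _.
    by rewrite -mulrN opprB.
  rewrite /bilinear_model; under eq_bigr => n _ do rewrite mulr_sumr.
  rewrite exchange_big; apply: eq_bigr => j _ /=; under eq_bigr => n _ do rewrite mulr_sumr.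
  rewrite exchange_big; apply: eq_bigr => S _ /=; under eq_bigr => n _ do rewrite mulr_sumr.
  rewrite exchange_big; apply: eq_bigr => m _ /=; under eq_bigr => n _ do rewrite mulr_sumr.
  rewrite exchange_big; apply: eq_bigr => p _ /=.
  rewrite (eq_bigr (fun n : 'I__ => cofactor_weight S j m * prime_weight S j p * h (m * p)%N *
     (m * p == n)%N%:R)); last first.
    move=> n _; case: eqP => [<-|]; last by rewrite !mulr0.
    by rewrite !mulr1 mulrC.
  rewrite -mulr_sumr.
  case: (boolP ((0 < m)%N && cofactor_of P a b N S m && (m%:R * breakpoint j.+1 <= X))) =>
      hm; last first.
    by rewrite /cofactor_weight andbA (negPf hm) !mul0r.
  case: (boolP [&& `[< P p >], signature a b N p == S, breakpoint j <= p%:R & p%:R <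
      breakpoint j.+1]) => hp; last first.
    by rewrite /prime_weight (negPf hp) mulr0 !mul0r.
  move: hm hp => /andP[/andP[m0 _] mX] /and4P[_ _ p1 p2].
  have mpX : (m * p)%:R < X.
    by apply: lt_le_trans mX; rewrite natrM ltr_pM2l ?ltr0n.
  have p0 : (0 < p)%N by rewrite -(ltr_nat R) (lt_le_trans (breakpoint_gt0 j)).
  have mpT : (m * p < (Num.truncn X).+1)%N by apply: lt_truncnS; apply: ltW.
  rewrite (bigD1 (Ordinal mpT)) /=; last by rewrite /inX mpX muln_gt0 m0.
  rewrite eqxx big1 ?addr0 ?mulr1 // => n /andP[_]; rewrite -val_eqE /= eq_sym.
  by move=> /negPf ->.
have ExC e : coprime e q -> \sum_(n < (Num.truncn X).+1 | inX n)
    (exceptional P X z eta n)%:R * (n == e %[mod q])%N%:R <= Ex.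
  move=> eq; apply: le_trans (exceptional_ap P X1 z1 eta0 q0 eq).
  rewrite big_mkcond [leRHS]big_mkcond; apply: ler_sum => n _.
  rewrite /inX andbC; case: (0 < n)%N; case: (_ < X); case: exceptional; case: (_ == _ :> nat);
    by rewrite /= ?mulr0 ?mul0r ?mul1r.
apply: le_trans (ler_norm_sum _ _ _) _.
apply: (@le_trans _ _ (\sum_(n < (Num.truncn X).+1 | inX n)
  W * ((exceptional P X z eta n)%:R * (n == c %[mod q])%N%:R +
    (totient q)%:R^-1 * ((exceptional P X z eta n)%:R * (coprime n q)%:R)))).
  apply: ler_sum => n /andP[nX n1]; rewrite normrM.
  have h1 : `|h n| <= (n == c %[mod q])%N%:R + (totient q)%:R^-1 * (coprime n q)%:R.
    rewrite /h; apply: le_trans (ler_normB _ _) _; rewrite addrC lerD // ger0_norm //.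
    by rewrite mulrC.
  apply: le_trans (ler_pM _ _ h1 (bilinear_model_approx n1 nX)) _ => //.
  by rewrite -/W le_eqVlt; apply/orP; left; apply/eqP; ring.
rewrite -mulr_sumr [2 * W]mulrC -mulrA; apply: ler_wpM2l => //.
rewrite big_split /= mulrDl !mul1r; apply: lerD; first exact: ExC.
rewrite -mulr_sumr.
(* The main term is an average over the reduced classes, so the estimate for one class bounds it as
   well; hence the factor 2 in the statement. *)
have cE n : (coprime n q)%:R = \sum_(e < q | coprime e q) (n == e %[mod q])%N%:R :> R.
  case: (boolP (coprime n q)) => nq; last first.
    rewrite big1 // => e eq; case: eqP => // ne.
    by move: nq; rewrite -coprime_modl ne coprime_modl eq.
  rewrite (bigD1 (Ordinal (ltn_pmod n q0))) /= ?coprime_modl // modn_mod eqxx.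
  rewrite big1 ?addr0 // => e /andP[_ en]; case: eqP => // ne.
  by move: en; rewrite -val_eqE /= ne modn_small ?eqxx.
rewrite (eq_bigr (fun n : 'I__ => \sum_(e < q | coprime e q)
   (exceptional P X z eta n)%:R * (n == e %[mod q])%N%:R)); last first.
  by move=> n _; rewrite cE mulr_sumr.
rewrite exchange_big /= -[leRHS](mulKf (lt0r_neq0 phi0)).
rewrite ler_pM2l ?invr_gt0 //.
have -> : (totient q)%:R * Ex = \sum_(e < q | coprime e q) Ex.
  by rewrite -totientE_sum natr_sum mulr_suml; apply: eq_bigr => e _; rewrite mul1r.
by apply: ler_sum => e eq; apply: ExC.
Qed.

End Reduction.

(** * Siegel-Walfisz for weighted primes *)

Section Discrepancy.
Variable R : realType.
Implicit Types (w : nat -> R) (D : pred nat).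

Definition discrepancy w (q c t : nat) : R :=
  `| \sum_(p < t | p == c %[mod q]) w p - (\sum_(p < t) w p) / (totient q)%:R |.

(** Such conditions cut a sum over [p < t] to a shorter initial segment, so a discrepancy bound
    uniform in [t] survives them. *)
Definition down_closed D := forall p p', (p <= p')%N -> D p' -> D p.

Lemma down_closed_prefix D t : down_closed D ->
  exists2 t', (t' <= t)%N & forall p, (p < t)%N -> D p = (p < t')%N.
Proof.
move=> Dc; elim: t => [|t [t' t't IH]]; first by exists 0%N.
case: (boolP (D t)) => Dt.
  exists t.+1 => // p pt; rewrite pt; apply: Dc Dt.
  by rewrite -ltnS.
exists t' => [|p]; first exact: leqW.
rewrite ltnS leq_eqVlt => /orP[/eqP ->|/IH //].
by rewrite (negPf Dt) ltnNge t't.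
Qed.

Lemma sum_prefix w D t t' (Q : pred nat) : (t' <= t)%N ->
  (forall p, (p < t)%N -> D p = (p < t')%N) ->
  \sum_(p < t | Q p) (D p)%:R * w p = \sum_(p < t' | Q p) w p.
Proof.
move=> t't DE; rewrite (big_ord_widen_cond _ _ _ t't) [RHS]big_mkcondr /=.
by apply: eq_bigr => p _; rewrite (DE _ (ltn_ord p)); case: ltnP; rewrite ?mul1r ?mul0r.
Qed.

Lemma discrepancy_down_closed w D q c T (E : R) : down_closed D ->
  (forall t, (t <= T)%N -> discrepancy w q c t <= E) ->
  forall t, (t <= T)%N -> discrepancy (fun p => (D p)%:R * w p) q c t <= E.
Proof.
move=> Dc wE t tT; have [t' t't DE] := down_closed_prefix t Dc.
rewrite /discrepancy (sum_prefix _ (fun p => p == c %[mod q]) t't DE).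
rewrite (sum_prefix _ xpredT t't DE); apply: wE.
exact: leq_trans t't tT.
Qed.

Lemma discrepancyB w1 w2 q c t :
  discrepancy (fun p => w1 p - w2 p) q c t <= discrepancy w1 q c t + discrepancy w2 q c t.
Proof.
rewrite /discrepancy !sumrB mulrBl; apply: le_trans (ler_normB _ _).
by rewrite le_eqVlt; apply/orP; left; apply/eqP; congr (`| _ |); ring.
Qed.

(** The weight is a difference of two weights cut to initial segments, whence the factor 2. *)
Lemma discrepancy_interval w D1 D2 q c T (E : R) : down_closed D1 -> down_closed D2 ->
  (forall t, (t <= T)%N -> discrepancy w q c t <= E) ->
  forall t, (t <= T)%N ->
    discrepancy (fun p => (D2 p && ~~ D1 p)%:R * w p) q c t <= 2 * E.
Proof.
move=> D1c D2c wE t tT.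
have -> : (fun p => (D2 p && ~~ D1 p)%:R * w p) =
   (fun p => (D2 p)%:R * w p - (D1 p)%:R * ((D2 p)%:R * w p)).
  apply/funext => p; case: (D2 p); case: (D1 p) => /=;
    by rewrite ?mul1r ?mul0r ?mulr0 ?subrr ?subr0.
apply: le_trans (discrepancyB _ _ _ _ _) _; rewrite mulrDl mul1r.
have D2E := discrepancy_down_closed D2c wE.
by apply: lerD; [apply: D2E|apply: (discrepancy_down_closed D1c D2E)].
Qed.

Lemma discrepancy_interval_compl w D1 D2 q c T (E : R) : down_closed D1 -> down_closed D2 ->
  (forall t, (t <= T)%N -> discrepancy w q c t <= E) ->
  forall t, (t <= T)%N ->
    discrepancy (fun p => (~~ (D2 p && ~~ D1 p))%:R * w p) q c t <= 3 * E.
Proof.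
move=> D1c D2c wE t tT.
have -> : (fun p => (~~ (D2 p && ~~ D1 p))%:R * w p) =
   (fun p => w p - (D2 p && ~~ D1 p)%:R * w p).
  by apply/funext => p; case: (_ && _) => /=; rewrite ?mul1r ?mul0r ?subrr ?subr0.
apply: le_trans (discrepancyB _ _ _ _ _) _.
have -> : 3 * E = E + 2 * E by ring.
by apply: lerD; [apply: wE|apply: discrepancy_interval wE _ _].
Qed.

Lemma down_closed_lt (x : R) : down_closed (fun p => p%:R < x).
Proof. by move=> p p' pp'; apply: le_lt_trans; rewrite ler_nat. Qed.

Lemma down_closed_le (x : R) : down_closed (fun p => p%:R <= x).
Proof. by move=> p p' pp'; apply: le_trans; rewrite ler_nat. Qed.

(** A signature prescribes, for each of [r] intervals, membership at a cost of 2 or its negation at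
    a cost of 3. The bounds stay uniform in [t], so the conditions can be imposed one after
    another. *)
Lemma discrepancy_signature w (r : nat) (a b : 'I_r -> R) (N : R) S q c T (E : R) :
  0 <= E -> (forall t, (t <= T)%N -> discrepancy w q c t <= E) ->
  forall t, (t <= T)%N ->
    discrepancy (fun p => (signature a b N p == S)%:R * w p) q c t <= 3 ^+ r * E.
Proof.
move=> E0 wE.
pose I i p := (p%:R <= N `^ b i) && ~~ (p%:R < N `^ a i).
have IE i p : I i p = (N `^ a i <= p%:R <= N `^ b i) by rewrite /I andbC -leNgt.
have sigE p : (signature a b N p == S) = all (fun i => I i p == S i) (enum 'I_r).
  apply/eqP/allP => [<- i _|h]; first by rewrite ffunE IE.
  by apply/ffunP => i; rewrite ffunE -IE; apply/eqP/h; rewrite mem_enum.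
rewrite (_ : (fun p => (_ == S)%:R * _) =
  (fun p => (all (fun i => I i p == S i) (enum 'I_r))%:R * w p)); last first.
  by apply/funext => p; rewrite sigE.
have -> : 3 ^+ r = 3 ^+ size (enum 'I_r) :> R by rewrite size_enum_ord.
elim: (enum 'I_r) => [|i s IH] t tT.
  rewrite mul1r (_ : (fun p => _) = w); first exact: wE.
  by apply/funext => p; rewrite mul1r.
rewrite (_ : (fun p => _) = (fun p => (I i p == S i)%:R *
   ((all (fun i => I i p == S i) s)%:R * w p))); last first.
  by apply/funext => p /=; rewrite mulrA -natrM mulnb.
have s0 : 0 <= 3 ^+ size s * E by rewrite mulr_ge0 ?exprn_ge0.
rewrite /= exprS -mulrA; case: (S i).
  rewrite (_ : (fun p => _) = (fun p => (I i p)%:R *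
     ((all (fun i => I i p == S i) s)%:R * w p))); last first.
    by apply/funext => p; case: (I i p).
  apply: (@le_trans _ _ (2 * (3 ^+ size s * E))); last by rewrite ler_wpM2r // ler_nat.
  exact: (@discrepancy_interval _ (fun p => p%:R < N `^ a i) (fun p => p%:R <= N `^ b i)
    q c T _ (@down_closed_lt _) (@down_closed_le _) IH t tT).
rewrite (_ : (fun p => _) = (fun p => (~~ I i p)%:R *
     ((all (fun i => I i p == S i) s)%:R * w p))); last first.
  by apply/funext => p; case: (I i p).
exact: (@discrepancy_interval_compl _ (fun p => p%:R < N `^ a i) (fun p => p%:R <= N `^ b i)
  q c T _ (@down_closed_lt _) (@down_closed_le _) IH t tT).
Qed.

Lemma discrepancy_trivial w q c t : (0 < q)%N -> (forall p, 0 <= w p <= 1) ->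
  discrepancy w q c t <= t%:R.
Proof.
move=> q0 w01; have phi1 : 1 <= (totient q)%:R :> R by rewrite ler1n totient_gt0.
have S0 (Q : pred nat) : 0 <= \sum_(p < t | Q p) w p <= t%:R.
  apply/andP; split; first by apply: sumr_ge0 => p _; case/andP: (w01 p).
  rewrite -[in leRHS](card_ord t) -sum1_card natr_sum big_mkcond.
  by apply: ler_sum => p _; case/andP: (w01 p) => ? ?; case: ifP.
have /andP[x0 xt] := S0 (fun p => p == c %[mod q]); have /andP[y0 yt] := S0 xpredT.
have y1 : 0 <= (\sum_(p < t) w p) / (totient q)%:R <= t%:R.
  rewrite divr_ge0 //= ler_pdivrMr ?(lt_le_trans _ phi1) //.
  by apply: le_trans yt _; rewrite ler_peMr.
rewrite /discrepancy ler_norml; move: y1 => /andP[? ?]; lra.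
Qed.

(** Up to [s + 1] the trivial bound is used; beyond it [ln s <= ln x], so the saving is a power of
    [ln s] whatever [t] is. This provides the uniformity needed for cutting into intervals. *)
Lemma discrepancy_siegel_walfisz (P : set nat) (B k : nat) (C s : R) (T q c : nat) :
  (forall p, P p -> prime p) -> 2 <= s ->
  (forall (x : R) (q a : nat), 2 <= x -> (0 < q)%N -> coprime q B -> coprime a q ->
     ap_error P x q a <= C * (x / ln x `^ k%:R)) ->
  (0 < q)%N -> coprime q B -> coprime c q ->
  forall t, (t <= T)%N -> discrepancy (fun p => `[< P p >]%:R) q c t <=
    s + 1 + `|C| * T%:R / ln s ^+ k.
Proof.
move=> Pp s2 SW q0 qB cq t tT.
have ls : 0 < ln s by apply: ln_gt0; lra.
have RHS0 : 0 <= `|C| * T%:R / ln s ^+ k by rewrite divr_ge0 ?mulr_ge0 ?exprn_ge0 // ltW.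
have [ts|ts] := leP t%:R (s + 1).
  apply: le_trans (discrepancy_trivial _ _ q0 _) _; last by lra.
  by move=> p; case: `[< _ >]; rewrite lexx ler01.
have t0 : (0 < t)%N by rewrite -(ltr_nat R); lra.
(* The sums over [p < t] count primes up to [t - 1]. *)
pose x : R := t.-1%:R.
have xt : x + 1 = t%:R by rewrite /x natr1 prednK.
have xs : s < x by lra.
have lx : ln s <= ln x by rewrite ler_ln ?posrE; lra.
have trx : (Num.truncn x).+1 = t by rewrite /x natrK prednK.
have memE n : (n \in P) = `[< P n >] by [].
have conv (Q : pred nat) : (\sum_(1 <= p < t | (p \in P) && Q p) 1)%N%:R =
    \sum_(p < t | Q p) `[< P p >]%:R :> R.
  rewrite natr_sum big_geq_mkord big_mkcond [RHS]big_mkcond; apply: eq_bigr => p _.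
  rewrite memE; case: (Q p); rewrite ?andbF //= andbT.
  case: (boolP `[< P p >]) => [/asboolP/Pp pp|_]; last by [].
  by rewrite prime_gt0.
apply: (@le_trans _ _ (C * (x / ln x `^ k%:R))).
  apply: le_trans (SW x q c _ q0 qB cq); last by lra.
  rewrite /ap_error /primes_upto_ap /primes_upto trx conv.
  rewrite (_ : (\sum_(1 <= p < t | p \in P) 1)%N = (\sum_(1 <= p < t | (p \in P) && true)
      1)%N).
    by rewrite conv.
  by apply: eq_bigl => p; rewrite andbT.
rewrite powR_mulrn ?(le_trans _ lx) ?(ltW ls) //.
have s1 : 0 <= s + 1 by lra.
apply: le_trans (_ : `|C| * T%:R / ln s ^+ k <= _); last by rewrite lerDr.
rewrite -mulrA; apply: (@le_trans _ _ (`|C| * (x / ln x ^+ k))).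
  apply: ler_wpM2r (ler_norm C); rewrite divr_ge0 ?exprn_ge0 //.
  by rewrite (le_trans _ lx) ?ltW.
apply: ler_wpM2l => //; apply: ler_pM; rewrite ?invr_ge0 ?exprn_ge0 //.
- by rewrite (le_trans _ lx) ?ltW.
- by rewrite /x ler_nat (leq_trans (leq_pred t)).
- rewrite lef_pV2 ?posrE ?exprn_gt0 ?(lt_le_trans ls) //.
  by rewrite lerXn2r ?nnegrE ?(ltW ls) // (le_trans (ltW ls)).
Qed.

End Discrepancy.

(** Only primes dividing [e] or [d] are lost, each of weight at most 1: those of [e] from the class
    and from the total, those of [d] from the total. *)
Lemma discrepancy_restrict (R : realType) (w : nat -> R) (Y d e c : nat) : (0 < d)%N -> (0
    < e)%N ->
  (forall p, 0 <= w p <= (prime p)%:R) ->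
  `|\sum_(p < Y | p == c %[mod d]) restrict_coprime w e p -
    (\sum_(p < Y | coprime p d) restrict_coprime w e p) / (totient d)%:R| <=
  discrepancy w d c Y + 2 * (size (primes e))%:R + (size (primes d))%:R.
Proof.
move=> d0 e0 w01; have phi1 : 1 <= (totient d)%:R :> R by rewrite ler1n totient_gt0.
have w0 p : 0 <= w p by case/andP: (w01 p).
have noncoprime (f p : nat) : (0 < f)%N -> ~~ coprime p f -> w p <= (p \in primes f)%:R.
  move=> f0 pf; have /andP[_] := w01 p.
  case: (boolP (prime p)) => pp; last by move=> h; apply: le_trans h (ler0n _ _).
  by rewrite mem_primes pp f0 /= prime_coprime // negbK in pf *; rewrite pf.
have loss (Q : pred nat) : 0 <= \sum_(p < Y | Q p) w p -
    \sum_(p < Y | Q p) restrict_coprime w e p <= (size (primes e))%:R.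
  rewrite -sumrB; apply/andP; split.
    apply: sumr_ge0 => p _; rewrite /restrict_coprime.
    by case: coprime; rewrite ?mul1r ?mul0r ?subrr ?subr0.
  apply: le_trans (sum_mem_seq_le R _ Y); rewrite big_mkcond [leRHS]big_mkcond.
  apply: ler_sum => p _; rewrite /restrict_coprime.
  have := noncoprime e p e0; case: (boolP (coprime p e)) => [_ _|pe /(_ isT)].
    by rewrite mul1r subrr if_same; case: ifP.
  rewrite mul0r subr0; case: (Q p) => h; last by case: ifP.
  by case: ifP h.
have lossd : 0 <= \sum_(p < Y) restrict_coprime w e p -
    \sum_(p < Y | coprime p d) restrict_coprime w e p <= (size (primes d))%:R.
  rewrite [X in _ - X]big_mkcond -sumrB; apply/andP; split.
    apply: sumr_ge0 => p _; case: ifP => _; rewrite ?subrr // subr0.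
    by rewrite mulr_ge0.
  apply: le_trans (sum_mem_seq_le R _ Y); rewrite [leRHS]big_mkcond.
  apply: ler_sum => p _; case: (boolP (coprime p d)) => pd.
    by rewrite subrr; case: ifP.
  rewrite subr0; apply: (@le_trans _ _ (w p)).
    by rewrite /restrict_coprime ler_piMl // ; case: coprime.
  by have := noncoprime d p d0 pd; case: ifP.
have lossT : 0 <= \sum_(p < Y) w p - \sum_(p < Y) restrict_coprime w e p <=
    (size (primes e))%:R := loss xpredT.
have := loss (fun p => p == c %[mod d]).
rewrite /discrepancy.
move: (\sum_(p < Y | p == c %[mod d]) w p) => A.
move: (\sum_(p < Y | p == c %[mod d]) restrict_coprime w e p) => A'.
move: (\sum_(p < Y) w p) lossT => S.
move: (\sum_(p < Y) restrict_coprime w e p) lossd => S'.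
move: (\sum_(p < Y | coprime p d) restrict_coprime w e p) => S''.
move=> /andP[d1 d2] /andP[e1 e2] /andP[A1 A2].
have eR : 0 <= (size (primes e))%:R :> R by [].
have dR : 0 <= (size (primes d))%:R :> R by [].
have t1 : 0 <= (S - S'') / (totient d)%:R by rewrite divr_ge0 //; lra.
have t2 : (S - S'') / (totient d)%:R <= (size (primes e))%:R + (size (primes d))%:R.
  rewrite ler_pdivrMr ?(lt_le_trans _ phi1) //.
  apply: (@le_trans _ _ ((size (primes e))%:R + (size (primes d))%:R)); first lra.
  by rewrite ler_peMr // addr_ge0.
have -> : A' - S'' / (totient d)%:R = (A - S / (totient d)%:R) - (A - A') +
    (S - S'') / (totient d)%:R by ring.
move: (A - S / _) (_ / _) t1 t2 => D t t1 t2.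
have := lexx `|D|; rewrite {1}ler_norml => /andP[? ?].
rewrite ler_norml; lra.
Qed.

(** * The error of a single bilinear form *)

Section Cells.
Variables (R : realType) (P : set nat) (r : nat) (a b : 'I_r -> R) (N : R).
Hypothesis Pprime : forall p, P p -> prime p.
Variables (X z eta s C : R) (B k Q D0 W : nat).
Hypotheses (r2 : (2 <= r)%N) (X1 : 1 <= X) (eta0 : 0 <= eta) (s2 : 2 <= s).
Hypotheses (zs : z = s ^+ 2) (zN : forall i, z <= N `^ a i).
Hypothesis SW : forall (x : R) (q a : nat), 2 <= x -> (0 < q)%N ->
  coprime q B -> coprime a q -> ap_error P x q a <= C * (x / ln x `^ k%:R).
Hypotheses (D00 : (0 < D0)%N) (QW : (Q < 2 ^ W)%N) (D0W : (D0 < 2 ^ W)%N).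

Lemma prime_weight_discrepancy S j d c : (0 < d)%N -> coprime d B -> coprime c d ->
  discrepancy (prime_weight P a b N z eta S j) d c (prime_range z eta j) <=
  2 * (3 ^+ r * (s + 1 + `|C| * (prime_range z eta j)%:R / ln s ^+ k)).
Proof.
move=> d0 dB cd; set T := prime_range z eta j.
have base := discrepancy_siegel_walfisz (T := T) Pprime s2 SW d0 dB cd.
have E0 : 0 <= s + 1 + `|C| * T%:R / ln s ^+ k.
  apply: le_trans (base 0%N (leq0n _)); exact: normr_ge0.
have sig := discrepancy_signature a b N S E0 base.
rewrite (_ : prime_weight P a b N z eta S j = (fun p =>
  ((p%:R < breakpoint z eta j.+1) && ~~ (p%:R < breakpoint z eta j))%:R *
  ((signature a b N p == S)%:R * `[< P p >]%:R))); last first.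
  apply/funext => p; rewrite /prime_weight -!natrM !mulnb -leNgt; congr (nat_of_bool _)%:R.
  by case: `[< _ >]; case: (signature _ _ _ _ == _); case: (_ <= _); case: (_ < _).
exact: (discrepancy_interval (@down_closed_lt R _) (@down_closed_lt R _) sig).
Qed.

(** With [y] the upper end of the interval, the variables have lengths about [X / y] and [y], both
    at least [s ^+ 2] unless the form vanishes. This yields the savings [1 / s] in the large sieve
    and makes an error of size [s] harmless in the small conductors. *)
Lemma sum_cell_error S j :
  \sum_(q < Q.+1 | (0 < q)%N && coprime q B) max_reduced q
    (bilinear_error (cofactor_weight P a b N X z eta S j)
       (prime_weight P a b N z eta S j) (cofactor_range X z eta j) (prime_range z eta j) q) <=
  W%:R ^+ 2 * (D0%:R ^+ 2 * X * (8 * 3 ^+ r * (s^-1 + `|C| / ln s ^+ k) + 6 * W%:R / s) +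
    W%:R * (8 * (Q%:R * Num.sqrt X) + 64 * X / s + 64 * X / D0%:R)).
Proof.
have s1 : 1 < s by apply: lt_le_trans s2; rewrite ltr1n.
have s0 : 0 < s by apply: lt_trans s1.
have X0 : 0 <= X by apply: le_trans X1.
have z1 : 1 <= z by rewrite zs exprn_ege1 // ltW.
have ls : 0 < ln s by apply: ln_gt0.
have D0R : 0 < D0%:R :> R by rewrite ltr0n.
have Ck0 : 0 <= `|C| / ln s ^+ k by rewrite divr_ge0 // exprn_ge0 // ltW.
have W0 : 0 <= W%:R :> R by [].
set y := breakpoint z eta j.+1.
have zy : z <= y.
  rewrite /y /breakpoint ler_peMr ?(le_trans _ z1) // exprn_ege1 // lerDl //.
have y0 : 0 < y by apply: breakpoint_gt0.
have bound0 : 0 <= 8 * 3 ^+ r * (s^-1 + `|C| / ln s ^+ k) + 6 * W%:R / s.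
  by rewrite addr_ge0 ?divr_ge0 ?mulr_ge0 ?addr_ge0 ?exprn_ge0 ?invr_ge0 ?(ltW s0).
have LS0 : 0 <= 8 * (Q%:R * Num.sqrt X) + 64 * X / s + 64 * X / D0%:R.
  by rewrite !addr_ge0 ?divr_ge0 ?mulr_ge0 ?sqrtr_ge0 ?(ltW s0).
(* If [X / y < z] the form is zero, because every cofactor is at least [z]. *)
have [zx|xz] := leP z (X / y); last first.
  rewrite big1; last first.
    move=> q _; apply/eqP; rewrite eq_le; apply/andP; split; last first.
      by apply: max_reduced_ge0 => c; apply: normr_ge0.
    apply: max_reduced_le => // c _ cq; rewrite /bilinear_error big1 ?normr0 // => m _.
    rewrite big1 // => p _; rewrite /cofactor_weight.
    case: (boolP [&& _, _ & _]) => [/and3P[m0 cm mX]|_]; last by rewrite !mul0r.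
    have zm := cofactor_of_ge Pprime r2 zN cm.
    by move: xz; rewrite ltNge (le_trans zm) // ler_pdivlMr.
  rewrite mulr_ge0 ?sqr_ge0 // addr_ge0 // mulr_ge0 // mulr_ge0 ?sqr_ge0 //.
have x0 : 0 < X / y by apply: lt_le_trans zx; apply: lt_le_trans z1.
set M := cofactor_range X z eta j; set Y := prime_range z eta j.
have MX : M%:R <= 2 * (X / y).
  apply: le_trans (truncnS_le (ltW x0)) _; rewrite -/y; lra.
have YX : Y%:R <= 2 * y.
  apply: le_trans (truncnS_le (ltW y0)) _; rewrite -/y; lra.
have al1 m : `|cofactor_weight P a b N X z eta S j m| <= 1.
  by rewrite normr_nat lern1 leq_b1.
have la1 m : `|prime_weight P a b N z eta S j m| <= 1.
  by rewrite normr_nat lern1 leq_b1.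
have laP p : 0 <= prime_weight P a b N z eta S j p <= (prime p)%:R.
  rewrite ler0n ler_nat /prime_weight.
  by case: (boolP `[< P p >]) => [/asboolP/Pprime ->|]; rewrite ?leq_b1.
pose E := s + 1 + `|C| * Y%:R / ln s ^+ k.
have E0 : 0 <= E.
  by rewrite !addr_ge0 ?divr_ge0 ?mulr_ge0 ?exprn_ge0 ?(ltW ls) ?(ltW s0).
(* The term [3 * W] covers twice the prime divisors of [e] and once those of [d]. *)
pose Del := 2 * (3 ^+ r * E) + 3 * W%:R.
have Del0 : 0 <= Del by rewrite addr_ge0 ?mulr_ge0 ?exprn_ge0.
have sizeW (e : nat) : (0 < e)%N -> (e < 2 ^ W)%N -> (size (primes e))%:R <= W%:R :> R.
  move=> e0 eW; rewrite ler_nat ltnW // -(@ltn_exp2l 2) //.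
  exact: leq_ltn_trans (expn2_size_primes e0) eW.
have M0 : (0 < M)%N by []. have Y0 : (0 < Y)%N by [].
apply: le_trans (sum_bilinear_error_le M0 Y0 D00 Del0 al1 la1 _) _.
  move=> e d c /andP[e0 eQ] /andP[d1 dD0] dB cd; have d0 : (0 < d)%N by apply: ltnW.
  apply: le_trans (discrepancy_restrict _ _ d0 e0 laP) _.
  have := prime_weight_discrepancy S j d0 dB cd; rewrite -/Y -/E /Del.
  have := sizeW e e0 (leq_ltn_trans eQ QW).
  have := sizeW d d0 (leq_ltn_trans dD0 D0W); lra.
apply: ler_pM.
- by apply: sumr_ge0 => e _; rewrite invr_ge0.
- by rewrite addr_ge0 ?mulr_ge0 ?sqr_ge0 ?large_sieve_bound_ge0.
- exact: sum_inv_totient.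
apply: lerD.
  rewrite -[leRHS]mulrA -[leLHS]mulrA; apply: ler_wpM2l; first exact: sqr_ge0.
  apply: (@le_trans _ _ (2 * (X / y) * Del)); first by rewrite ler_wpM2r.
  rewrite (_ : 2 * (X / y) * Del = X * (2 * Del / y)); last by field; rewrite gt_eqF.
  apply: ler_wpM2l => //; rewrite ler_pdivrMr //.
  have sy : s * s <= y by rewrite -expr2 -zs.
  have ys : s <= s^-1 * y by rewrite ler_pdivlMl.
  have one_s : 1 <= s^-1 * y by lra.
  have E1 : E <= 2 * (s^-1 * y) + 2 * (`|C| / ln s ^+ k * y).
    rewrite /E; have : `|C| * Y%:R / ln s ^+ k <= 2 * (`|C| / ln s ^+ k * y).
      by rewrite mulrAC mulrCA; apply: ler_wpM2l.
    lra.
  have : 3 ^+ r * E <= 3 ^+ r * (2 * (s^-1 * y) + 2 * (`|C| / ln s ^+ k * y)).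
    by apply: ler_wpM2l; rewrite ?exprn_ge0.
  have : W%:R <= W%:R * (s^-1 * y) by rewrite ler_peMr.
  rewrite /Del (_ : (8 * 3 ^+ r * (s^-1 + `|C| / ln s ^+ k) + 6 * W%:R / s) * y =
    4 * (3 ^+ r * (2 * (s^-1 * y) + 2 * (`|C| / ln s ^+ k * y))) + 6 * (W%:R * (s^-1 *
        y))); last by ring.
  move: (3 ^+ r * E) (3 ^+ r * _) (W%:R * _) => u v t; lra.
have QlogW : (trunc_log 2 Q).+1%:R <= W%:R :> R.
  rewrite ler_nat; case: (posnP Q) => [->|Q0].
    by rewrite trunc_log0 -(@ltn_exp2l 2) // expn0 (leq_ltn_trans _ D0W).
  by rewrite -(@ltn_exp2l 2) // (leq_ltn_trans (trunc_logP _ Q0)).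
apply: ler_pM => //; first exact: large_sieve_bound_ge0.
rewrite /large_sieve_bound.
(* Then [X = p ^+ 2 * v ^+ 2] with [s <= p] and [s <= v], while [M] and [Y] are at most [2 * p ^+ 2]
   and [2 * v ^+ 2]; a missing factor [p] or [v] is therefore a gain of [s] over [X]. *)
pose p := Num.sqrt (X / y); pose v := Num.sqrt y.
have p2 : p ^+ 2 = X / y by rewrite sqr_sqrtr // ltW.
have v2 : v ^+ 2 = y by rewrite sqr_sqrtr // ltW.
have pv : Num.sqrt X = p * v.
  by rewrite -sqrtrM ?(ltW x0) // divfK // gt_eqF.
have sp : s <= p.
  by rewrite -(@ler_pXn2r _ 2) ?nnegrE ?sqrtr_ge0 ?(ltW s0) // p2 -zs.
have sv : s <= v.
  by rewrite -(@ler_pXn2r _ 2) ?nnegrE ?sqrtr_ge0 ?(ltW s0) // v2 -zs.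
have p0 : 0 < p by apply: lt_le_trans sp.
have v0 : 0 < v by apply: lt_le_trans sv.
have XE : X = p ^+ 2 * v ^+ 2 by rewrite p2 v2 divfK // gt_eqF.
rewrite -p2 in MX; rewrite -v2 in YX.
have m2 := sqr_sqrtr (ler0n R M); have n2 := sqr_sqrtr (ler0n R Y).
move: (Num.sqrt M%:R) (Num.sqrt Y%:R) (sqrtr_ge0 (M%:R : R)) (sqrtr_ge0 (Y%:R : R)) m2 n2
    => m n m0 n0 m2 n2.
have mp : m <= 2 * p.
  rewrite -(@ler_pXn2r _ 2) ?nnegrE ?mulr_ge0 ?(ltW p0) // m2 exprMn; nra.
have no : n <= 2 * v.
  rewrite -(@ler_pXn2r _ 2) ?nnegrE ?mulr_ge0 ?(ltW v0) // n2 exprMn; nra.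
have mn : m * n <= 2 * (p * v).
  rewrite -(@ler_pXn2r _ 2) ?nnegrE ?mulr_ge0 ?(ltW v0) ?(ltW p0) //.
  rewrite exprMn m2 n2 (_ : (2 * (p * v)) ^+ 2 = (2 * p ^+ 2) * (2 * v ^+ 2)); last by ring.
  by apply: ler_pM.
have mn0 : 0 <= m * n by apply: mulr_ge0.
have h1 : m * n * (4 * Q%:R) <= 8 * (Q%:R * (p * v)).
  rewrite (_ : 8 * (Q%:R * (p * v)) = 2 * (p * v) * (4 * Q%:R)); last by ring.
  by apply: ler_wpM2r.
have Xs : p ^+ 2 * v <= X / s.
  rewrite ler_pdivlMr // XE -mulrA expr2 [v ^+ 2]expr2.
  by rewrite ler_wpM2l ?mulr_ge0 ?(ltW p0) // ler_wpM2l ?(ltW v0).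
have Xs' : v ^+ 2 * p <= X / s.
  rewrite ler_pdivlMr // XE [_ * v ^+ 2]mulrC -mulrA expr2 [p ^+ 2]expr2.
  by rewrite ler_wpM2l ?mulr_ge0 ?(ltW v0) // ler_wpM2l ?(ltW p0).
have h2 : m * n * (8 * m) <= 32 * (X / s).
  apply: (@le_trans _ _ (32 * (p ^+ 2 * v))); last by rewrite ler_pM2l.
  rewrite (_ : m * n * (8 * m) = 8 * (m ^+ 2 * n)); last by ring.
  rewrite (_ : 32 * (p ^+ 2 * v) = 8 * ((2 * p ^+ 2) * (2 * v))); last by ring.
  by rewrite ler_pM2l // m2; apply: ler_pM.
have h3 : m * n * (8 * n) <= 32 * (X / s).
  apply: (@le_trans _ _ (32 * (v ^+ 2 * p))); last by rewrite ler_pM2l.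
  rewrite (_ : m * n * (8 * n) = 8 * (n ^+ 2 * m)); last by ring.
  rewrite (_ : 32 * (v ^+ 2 * p) = 8 * ((2 * v ^+ 2) * (2 * p))); last by ring.
  by rewrite ler_pM2l // n2; apply: ler_pM.
have h4 : m * n * (16 * (m * n) / D0%:R) <= 64 * X / D0%:R.
  rewrite mulrA ler_pM2r ?invr_gt0 // XE.
  rewrite (_ : m * n * (16 * (m * n)) = 16 * ((m * n) * (m * n))); last by ring.
  rewrite (_ : 64 * (p ^+ 2 * v ^+ 2) = 16 * ((2 * (p * v)) * (2 * (p * v)))); last by ring.
  by rewrite ler_pM2l //; apply: ler_pM.
rewrite pv !mulrDr -[64 * X / s]mulrA.
move: (X / s) h2 h3 => t h2 h3.
have -> : 64 * t = 32 * t + 32 * t by ring.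
rewrite !addrA; apply: lerD => //; rewrite -!addrA; apply: lerD => //.
exact: lerD.
Qed.

End Cells.

(** * The total error *)

Section Total.
Variables (R : realType) (P : set nat) (r : nat) (a b : 'I_r -> R) (N : R).
Hypothesis Pprime : forall p, P p -> prime p.
Variables (X z s C : R) (B k Q D0 W h : nat).
Hypotheses (r2 : (2 <= r)%N) (X1 : 1 <= X) (s2 : 2 <= s).
Hypotheses (zs : z = s ^+ 2) (zN : forall i, z <= N `^ a i).
Hypothesis SW : forall (x : R) (q a : nat), 2 <= x -> (0 < q)%N ->
  coprime q B -> coprime a q -> ap_error P x q a <= C * (x / ln x `^ k%:R).
Hypotheses (D00 : (0 < D0)%N) (QW : (Q < 2 ^ W)%N) (D0W : (D0 < 2 ^ W)%N).
Hypotheses (h0 : (0 < h)%N) (XW : X < (2 ^ W)%:R).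

(** There are [h * W] intervals and [2 ^+ r] signatures; the last summand comes from the exceptional
    integers. *)
Lemma sum_progression_error :
  \sum_(q < Q.+1 | (0 < q)%N && coprime q B)
     max_reduced q (progression_error X (beta P a b N) q) <=
  (h * W)%:R * (2 ^+ r * (W%:R ^+ 2 *
    (D0%:R ^+ 2 * X * (8 * 3 ^+ r * (s^-1 + `|C| / ln s ^+ k) + 6 * W%:R / s) +
     W%:R * (8 * (Q%:R * Num.sqrt X) + 64 * X / s + 64 * X / D0%:R)))) +
  2 * W%:R * ((h%:R^-1 + 2 / z) * X * W%:R ^+ 2 + 4 * (Q%:R * Num.sqrt X)).
Proof.
set J := (h * W)%N; set cell := W%:R ^+ 2 * _.
have eta0 : 0 <= h%:R^-1 :> R by rewrite invr_ge0.
have z1 : 1 <= z by rewrite zs exprn_ege1 // (le_trans _ s2) // ler1n.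
have z0 : 0 < z by apply: lt_le_trans z1.
have X0 : 0 <= X by apply: le_trans X1.
(* With ratio [1 + 1 / h], every [h] intervals at least double the endpoint, so [h * W] of them pass
   [2 ^ W], which exceeds [X]. *)
have XJ : X <= z * (1 + h%:R^-1) ^+ J.
  apply: le_trans (ltW XW) _; apply: (@le_trans _ _ ((1 + h%:R^-1) ^+ J)).
    rewrite /J exprM natrX; apply: lerXn2r; rewrite ?nnegrE ?exprn_ge0 ?addr_ge0 //.
    exact: bernoulli_double.
  by rewrite ler_peMl // exprn_ge0 // addr_ge0.
set lX : R := 2 * (trunc_log 2 (Num.truncn X))%:R.
have lW : lX <= 2 * W%:R.
  rewrite ler_pM2l // ler_nat -(@leq_exp2l 2) //.
  case: (posnP (Num.truncn X)) => [->|t0]; first by rewrite trunc_log0 expn0 expn_gt0.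
  apply: leq_trans (trunc_logP _ t0) _ => //.
  by rewrite truncn_le_nat (lt_trans XW) // ltr_nat.
have eta2z : 0 <= (h%:R^-1 + 2 / z) * X by rewrite mulr_ge0 // addr_ge0 // divr_ge0 // ltW.
have lX0 : 0 <= lX by rewrite mulr_ge0.
have bil0 q j S : 0 <= max_reduced q (bilinear_error
    (cofactor_weight P a b N X z h%:R^-1 S j) (prime_weight P a b N z h%:R^-1 S j)
    (cofactor_range X z h%:R^-1 j) (prime_range z h%:R^-1 j) q).
  by apply: max_reduced_ge0 => c; apply: normr_ge0.
apply: (@le_trans _ _ (\sum_(q < Q.+1 | (0 < q)%N && coprime q B)
  (\sum_(j < J) \sum_S max_reduced q (bilinear_error
    (cofactor_weight P a b N X z h%:R^-1 S j) (prime_weight P a b N z h%:R^-1 S j)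
    (cofactor_range X z h%:R^-1 j) (prime_range z h%:R^-1 j) q) +
   lX * ((h%:R^-1 + 2 / z) * X / q%:R + 4 * Num.sqrt X)))).
  apply: ler_sum => q /andP[q0 qB]; apply: max_reduced_le.
    rewrite addr_ge0 //; first by apply: sumr_ge0 => j _; apply: sumr_ge0.
    apply: mulr_ge0 => //; apply: addr_ge0; first by apply: divr_ge0.
    by rewrite mulr_ge0 // sqrtr_ge0.
  move=> c cq cop; apply: le_trans (progression_error_le b Pprime X1 z1 eta0 zN XJ _ q0 cop) _.
    exact: ltnW.
  rewrite lerD2r; apply: ler_sum => j _; apply: ler_sum => S _.
  exact: le_max_reduced.
rewrite big_split /=; apply: lerD.
  rewrite exchange_big /=.
  have -> : J%:R * (2 ^+ r * cell) = \sum_(j < J) \sum_(S : {ffun 'I_r -> bool}) cell.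
    rewrite [RHS]sumr_const card_ord [LHS]mulr_natl; congr (_ *+ _).
    by rewrite sumr_const card_ffun card_bool card_ord -[RHS]mulr_natl natrX.
  apply: ler_sum => j _; rewrite exchange_big /=; apply: ler_sum => S _.
  exact: sum_cell_error.
rewrite -mulr_sumr; apply: ler_pM => //.
  apply: sumr_ge0 => q _; apply: addr_ge0; first by apply: divr_ge0.
  by rewrite mulr_ge0 // sqrtr_ge0.
rewrite big_split /=; apply: lerD.
  rewrite -mulr_sumr; apply: ler_wpM2l => //.
  apply: le_trans (sum_inv_totient R QW).
  rewrite big_mkcondr; apply: ler_sum => q q0; case: ifP => _; last by rewrite invr_ge0.
  rewrite lef_pV2 ?posrE ?ltr0n ?totient_gt0 // ler_nat.
  rewrite -totientE_sum -[leqRHS](card_ord q) -sum1_card big_mkcond.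
  by apply: leq_sum => c _; case: ifP.
apply: (@le_trans _ _ (\sum_(q < Q) 4 * Num.sqrt X)); last first.
  by rewrite sumr_const card_ord -[leLHS]mulr_natl mulrCA.
rewrite big_mkcond big_ord_recl /= add0r; apply: ler_sum => q _.
by case: ifP => // _; rewrite mulr_ge0 ?sqrtr_ge0.
Qed.

End Total.

(** * Powers of the logarithm and choice of parameters *)

Section Asymptotics.
Variable R : realType.

Lemma ln_le_powR (N t : R) : 0 < N -> t * ln N <= N `^ t.
Proof.
move=> N0; have p0 : 0 < N `^ t by apply: powR_gt0.
have : -1 < N `^ t - 1 by lra.
by move=> /le_ln1Dx; rewrite addrC subrK ln_powR => h; lra.
Qed.

Lemma ln_power_le (t c : R) (n : nat) : 0 < t ->
  exists N0 : R, forall N, N0 <= N -> c * ln N ^+ n <= N `^ t.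
Proof.
(* Of [n.+1] equal parts of the exponent, [n] absorb the logarithms and one the constant [c]. *)
move=> t0; pose tau := t / n.+1%:R.
have tau0 : 0 < tau by rewrite divr_gt0.
have tn : 0 < tau ^+ n by rewrite exprn_gt0.
exists (expR (`|c| / tau ^+ n / tau)) => N NN.
have N0 : 0 < N by apply: lt_le_trans (expR_gt0 _) NN.
have LM : `|c| / tau ^+ n / tau <= ln N.
  by rewrite -[leLHS]expRK ler_ln ?posrE ?expR_gt0.
have L0 : 0 <= ln N by apply: le_trans LM; rewrite !divr_ge0 // ltW.
have Lt := ln_le_powR tau N0.
have NtE : N `^ t = N `^ tau * (N `^ tau) ^+ n.
  by rewrite -exprS -powR_mulrn ?powR_ge0 // -powRrM divfK.
rewrite NtE; apply: (@le_trans _ _ (`|c| / tau ^+ n * (tau * ln N) ^+ n)).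
  rewrite [(tau * ln N) ^+ n]exprMn mulrA divfK ?gt_eqF //; apply: ler_wpM2r (ler_norm c).
  exact: exprn_ge0.
apply: ler_pM.
- by rewrite divr_ge0 // ltW.
- by rewrite exprn_ge0 // mulr_ge0 // ltW.
- by apply: le_trans Lt; rewrite [tau * _]mulrC -ler_pdivrMr.
- by rewrite lerXn2r ?nnegrE ?powR_ge0 ?mulr_ge0 // ltW.
Qed.

Lemma ln_ge_eventually (M : R) : exists N0 : R, forall N, N0 <= N -> 1 < N /\ M <= ln N.
Proof.
exists (expR (`|M| + 1)) => N NN; have N0 : 0 < N := lt_le_trans (expR_gt0 _) NN.
have lN : `|M| + 1 <= ln N by rewrite -[leLHS]expRK ler_ln ?posrE ?expR_gt0.
have M0 := normr_ge0 M; have := ler_norm M; split; last by lra.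
by apply: lt_le_trans NN; rewrite expR_gt1; lra.
Qed.

(* [L] stands for [ln N] and [i] for its inverse; [L ^+ (n + 4)] and
   [L ^+ (2 * n + 9)] are the smallest number of intervals and conductor cutoff
   for which all error terms save [n.+1] logarithms. *)
Lemma total_bound_le (n : nat) (X L i W h D si zi Cs Qx t g c c' : R) :
  0 <= X -> 0 < i -> i <= 1 -> L * i = 1 -> 1 <= c -> 0 <= c' -> 0 <= t -> 0 <= g ->
  0 <= W <= c * L -> L ^+ (n + 4) <= h <= 2 * L ^+ (n + 4) ->
  L ^+ (2 * n + 9) <= D <= 2 * L ^+ (2 * n + 9) ->
  0 <= si <= i ^+ (6 * n + 27) -> 0 <= zi <= si ->
  0 <= Qx <= X * i ^+ (6 * n + 27) -> 0 <= Cs <= c' * i ^+ (6 * n + 26) ->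
  h * W * (g * (W ^+ 2 * (D ^+ 2 * X * (8 * t * (si + Cs) + 6 * W * si) +
     W * (8 * Qx + 64 * X * si + 64 * X / D)))) +
  2 * W * ((h^-1 + 2 * zi) * X * W ^+ 2 + 4 * Qx) <=
  X * ((2 * c ^+ 3 * g * (4 * (8 * t * (1 + c') + 6 * c) + 136 * c) + 14 * c ^+ 3) * i ^+
      n.+1).
Proof.
move=> X0 i0 i1 Li c1 c'0 t0 g0 /andP[W0 WL] /andP[hL hU] /andP[DL DU].
move=> /andP[si0 siU] /andP[zi0 ziU] /andP[Q0 QU] /andP[Cs0 CsU].
have L0 : 0 < L by rewrite -(pmulr_lgt0 _ i0) Li.
have ii0 m : 0 <= i ^+ m by rewrite exprn_ge0 // ltW.
have LL0 m : 0 <= L ^+ m by rewrite exprn_ge0 // ltW.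
have Lpi p m : L ^+ p * i ^+ (p + m) = i ^+ m.
  by rewrite exprD mulrA -exprMn Li expr1n mul1r.
have imono p m : (p <= m)%N -> i ^+ m <= i ^+ p.
  by move=> pm; rewrite ler_wiXn2l // ltW.
have Linv p : (L ^+ p)^-1 = i ^+ p.
  by apply: (mulfI (x := L ^+ p)); rewrite ?gt_eqF ?exprn_gt0 // mulfV ?gt_eqF ?exprn_gt0
      // -exprMn Li expr1n.
have c0 : 0 <= c by lra.
have h0 : 0 <= h by apply: le_trans hL.
have D0 : 0 <= D by apply: le_trans DL.
pose e := 8 * t * (1 + c') + 6 * c.
have e0 : 0 <= e by rewrite addr_ge0 ?mulr_ge0 ?addr_ge0.
have W2 : W ^+ 2 <= c ^+ 2 * L ^+ 2.
  by rewrite -exprMn lerXn2r ?nnegrE // mulr_ge0 // ltW.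
have S1 : 8 * t * (si + Cs) + 6 * W * si <= e * i ^+ (6 * n + 26).
  have a1 : 8 * t * (si + Cs) <= 8 * t * ((1 + c') * i ^+ (6 * n + 26)).
    apply: ler_wpM2l; first by rewrite mulr_ge0.
    rewrite mulrDl mul1r; apply: lerD => //; apply: le_trans siU _.
    by apply: imono; rewrite leq_add2l.
  have a2 : W * si <= c * i ^+ (6 * n + 26).
    rewrite -(Lpi 1%N) addnA (addnC 1%N) -addnA expr1 mulrA; exact: ler_pM.
  apply: (@le_trans _ _ (8 * t * ((1 + c') * i ^+ (6 * n + 26)) + 6 * (c * i ^+ (6 * n +
      26)))).
    by apply: lerD => //; rewrite -mulrA ler_pM2l.
  by rewrite le_eqVlt; apply/orP; left; apply/eqP; rewrite /e; ring.
(* [D ^+ 2] costs [4 * n + 18] logarithms, so the saving of [6 * n + 26] leaves [2 * n + 8]; the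
   [n + 7] logarithms of [h * W ^+ 3] then leave [n.+1]. *)
have S2 : D ^+ 2 * X * (8 * t * (si + Cs) + 6 * W * si) <= X * (4 * e) * i ^+ (2 * n + 8).
  have D2 : D ^+ 2 <= 4 * L ^+ (4 * n + 18).
    rewrite (_ : 4 * L ^+ (4 * n + 18) = (2 * L ^+ (2 * n + 9)) ^+ 2).
      by rewrite lerXn2r ?nnegrE // mulr_ge0.
    by rewrite exprMn -exprM; congr (_ * L ^+ _); [ring|clear; lia].
  apply: (@le_trans _ _ (4 * L ^+ (4 * n + 18) * X * (e * i ^+ (6 * n + 26)))).
    apply: ler_pM => //; first by rewrite mulr_ge0 ?sqr_ge0.
      by rewrite addr_ge0 // !mulr_ge0 ?addr_ge0.
    by apply: ler_wpM2r.
  rewrite -(Lpi (4 * n + 18)%N (2 * n + 8)%N) (_ : (4 * n + 18 + (2 * n + 8) = 6 * n +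
      26)%N); last by clear; lia.
  by rewrite le_eqVlt; apply/orP; left; apply/eqP; ring.
have S3 : W * (8 * Qx + 64 * X * si + 64 * X / D) <= X * (136 * c) * i ^+ (2 * n + 8).
  have b1 : Qx <= X * i ^+ (2 * n + 9).
    by apply: le_trans QU _; apply: ler_wpM2l => //; apply: imono; clear; lia.
  have b2 : X * si <= X * i ^+ (2 * n + 9).
    by apply: ler_wpM2l => //; apply: le_trans siU _; apply: imono; clear; lia.
  have b3 : X / D <= X * i ^+ (2 * n + 9).
    apply: ler_wpM2l => //; rewrite -Linv lef_pV2 ?posrE ?exprn_gt0 //.
    by apply: lt_le_trans DL; rewrite exprn_gt0.
  apply: (@le_trans _ _ (c * L * (136 * (X * i ^+ (2 * n + 9))))).
    apply: ler_pM => //; last by rewrite -!mulrA; lra.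
    by rewrite !addr_ge0 // ?divr_ge0 ?mulr_ge0.
  rewrite -(Lpi 1%N (2 * n + 8)%N) (_ : (1 + (2 * n + 8) = 2 * n + 9)%N); last by clear; lia.
  by rewrite le_eqVlt; apply/orP; left; apply/eqP; rewrite expr1; ring.
have S5 : h * W * (g * (W ^+ 2 * (D ^+ 2 * X * (8 * t * (si + Cs) + 6 * W * si) +
     W * (8 * Qx + 64 * X * si + 64 * X / D)))) <=
     X * (2 * c ^+ 3 * g * (4 * e + 136 * c) * i ^+ n.+1).
  have hW : h * W <= 2 * L ^+ (n + 4) * (c * L) by apply: ler_pM.
  apply: (@le_trans _ _ (2 * L ^+ (n + 4) * (c * L) * (g * (c ^+ 2 * L ^+ 2 *
     (X * (4 * e) * i ^+ (2 * n + 8) + X * (136 * c) * i ^+ (2 * n + 8)))))).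
    have in1 : 0 <= D ^+ 2 * X * (8 * t * (si + Cs) + 6 * W * si).
      apply: mulr_ge0; first by rewrite mulr_ge0 ?sqr_ge0.
      by apply: addr_ge0; apply: mulr_ge0; rewrite ?mulr_ge0 ?addr_ge0.
    have in2 : 0 <= W * (8 * Qx + 64 * X * si + 64 * X / D).
      apply: mulr_ge0 => //; apply: addr_ge0; last by rewrite divr_ge0 ?mulr_ge0.
      by apply: addr_ge0; rewrite ?mulr_ge0.
    have in0 := addr_ge0 in1 in2.
    apply: ler_pM => //; first by rewrite mulr_ge0.
      by apply: mulr_ge0 => //; apply: mulr_ge0; rewrite ?sqr_ge0.
    apply: ler_wpM2l => //; apply: ler_pM => //; first exact: sqr_ge0.
    exact: lerD.
  rewrite -(Lpi (n + 7)%N n.+1) (_ : (n + 7 + n.+1 = 2 * n + 8)%N); last by clear; lia.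
  rewrite (_ : (n + 7 = n + 4 + 1 + 2)%N); last by clear; lia.
  by rewrite le_eqVlt; apply/orP; left; apply/eqP; rewrite !(exprD L) expr1; ring.
have S6 : 2 * W * ((h^-1 + 2 * zi) * X * W ^+ 2 + 4 * Qx) <= X * (14 * c ^+ 3 * i ^+ n.+1).
  have h1 : h^-1 <= i ^+ (n + 4).
    rewrite -Linv lef_pV2 ?posrE ?exprn_gt0 //.
    by apply: lt_le_trans hL; rewrite exprn_gt0.
  have z1 : zi <= i ^+ (n + 4).
    by apply: le_trans ziU (le_trans siU _); apply: imono; clear; lia.
  have q1 : Qx <= X * i ^+ (n + 2).
    by apply: le_trans QU _; apply: ler_wpM2l => //; apply: imono; clear; lia.
  apply: (@le_trans _ _ (2 * (c * L) * ((3 * i ^+ (n + 4)) * X * (c ^+ 2 * L ^+ 2) + 4 * (X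
      * i ^+ (n + 2))))).
    apply: ler_pM.
    - by rewrite mulr_ge0.
    - by rewrite addr_ge0 ?mulr_ge0 ?addr_ge0 ?invr_ge0 ?sqr_ge0 ?mulr_ge0.
    - by rewrite ler_pM2l.
    apply: lerD; last by rewrite ler_pM2l.
    apply: ler_pM; rewrite ?sqr_ge0 ?mulr_ge0 ?addr_ge0 ?invr_ge0 ?mulr_ge0 //.
    by apply: ler_wpM2r => //; lra.
  rewrite (_ : (n + 4 = 2 + (n + 2))%N); last by clear; lia.
  rewrite (_ : 3 * i ^+ (2 + (n + 2)) * X * (c ^+ 2 * L ^+ 2) =
    3 * X * c ^+ 2 * (L ^+ 2 * i ^+ (2 + (n + 2)))); last by ring.
  rewrite Lpi (_ : (n + 2 = 1 + n.+1)%N); last by clear; lia.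
  rewrite (_ : 2 * (c * L) * (3 * X * c ^+ 2 * i ^+ (1 + n.+1) + 4 * (X * i ^+ (1 + n.+1))) =
    X * ((6 * c ^+ 3 + 8 * c) * (L ^+ 1 * i ^+ (1 + n.+1)))); last by rewrite expr1; ring.
  rewrite Lpi; apply: ler_wpM2l => //; apply: ler_wpM2r => //.
  have : c <= c ^+ 3 by rewrite exprS ler_peMr // exprn_ege1.
  lra.
apply: le_trans (lerD S5 S6) _; rewrite -mulrDr -mulrDl /e.
exact: lexx.
Qed.

End Asymptotics.

(** The reciprocal of the sum of all [1 / a i] is positive and below each [a i]. *)
Lemma exists_lower_bound (R : realType) (r : nat) (a b : 'I_r -> R) : (0 < r)%N ->
  (forall i, 0 < a i < b i) -> exists2 a0 : R, 0 < a0 & forall i, a0 <= a i.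
Proof.
move=> r0 ab; have a0 i : 0 < (a i)^-1 by case/andP: (ab i); rewrite invr_gt0.
have le_sum i : (a i)^-1 <= \sum_j (a j)^-1.
  by rewrite (bigD1 i) //= lerDl sumr_ge0 // => j _; apply: ltW.
have S0 : 0 < \sum_j (a j)^-1 by apply: lt_le_trans (le_sum (Ordinal r0)).
exists (\sum_j (a j)^-1)^-1; first by rewrite invr_gt0.
by move=> i; rewrite -[leRHS]invrK lef_pV2 ?posrE.
Qed.

Theorem theorem3p2 (R : realType) (u eps A : R) (heps : 0 < eps) (hA : 0 < A) :
  exists C : R,
  forall (P : set nat) (delta : R) (B : nat) (theta : R),
    (forall p, P p -> prime p) ->
    0 < delta -> has_density P delta ->
    squarefree B -> siegel_walfisz R P B ->
    0 < theta -> has_level P B theta ->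
  forall (r : nat) (a b : 'I_r -> R),
    (2 <= r)%N -> (forall i, 0 < a i < b i) ->
  \forall N \near +oo,
    \sum_(1 <= q < (Num.truncn (N `^ (2^-1 * u - eps))).+1 | coprime q B)
      max_reduced q (fun c =>
        `| \sum_(1 <= n < (Num.truncn (N `^ u)).+1 | n%:R < N `^ u)
             (1 / (totient q)%:R * coprime_part (beta P a b N) q n
              - ap_part (beta P a b N) q c n) |)
    <= C * (N `^ u / ln N `^ A).
Proof.
(* The constant 1 suffices: one logarithm more than needed is saved, and it absorbs all constants
   once [N] passes a threshold, which may depend on [P], [r], [a] and [b]. *)
exists 1 => P delta B theta Pprime _ _ _ SW _ _ r a b r2 ab.
(* For [u <= 0] no positive integer is below the bound on [n], and the inner sum is empty. *)
have [u0|u0] := leP u 0.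
  have [N1 hN1] := ln_ge_eventually (0 : R).
  exists N1; split; first exact: num_real.
  move=> N NN; have [N1lt _] := hN1 N (ltW NN).
  rewrite mul1r big1; first by rewrite divr_ge0 ?powR_ge0.
  move=> q _; apply/eqP; rewrite eq_le; apply/andP; split; last first.
    by apply: max_reduced_ge0 => c; apply: normr_ge0.
  apply: max_reduced_le => // c _ _.
  rewrite big_geq_mkord big_pred0 ?normr0 // => n; apply/negP => /andP[nX n1].
  have : N `^ u <= 1 by rewrite -[leRHS](powRr0 N) ler_powR // ltW.
  by rewrite leNgt => /negP; apply; apply: le_lt_trans nX; rewrite ler1n.
have r0 : (0 < r)%N := ltnW r2.
have [a0 a00 a0a] := exists_lower_bound r0 ab.
have t0 : 0 < a0 / 2 by rewrite divr_gt0.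
(* [k] is the number of logarithms that [total_bound_le] asks of Siegel-Walfisz. *)
pose n := (Num.truncn A).+1; pose k := (6 * n + 26)%N.
have An : A <= n%:R by rewrite ltW // truncnS_gt.
have k0 : 0 < k%:R :> R by rewrite ltr0n /k addn_gt0 orbT.
have [C SWk] := SW k%:R k0.
have ln2 : 0 < ln (2 : R) by apply: ln_gt0; rewrite ltr1n.
(* Chosen for [W <= c * ln N]: [W] is one more than a base 2 logarithm of at most [2 * X], and
   [1 <= ln N]. *)
pose c := 2 + u / ln 2.
have c1 : 1 <= c.
  have : 0 < u / ln 2 by rewrite divr_gt0.
  rewrite /c; lra.
(* The denominator appears because [ln s] is [a0 / 2] times [ln N]. *)
pose c' := `|C| / (a0 / 2) ^+ k.
have c'0 : 0 <= c' by rewrite divr_ge0 // exprn_ge0 // ltW.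
pose K := 2 * c ^+ 3 * 2 ^+ r * (4 * (8 * 3 ^+ r * (1 + c') + 6 * c) + 136 * c) + 14 * c ^+ 3.
(* The thresholds ensure in turn: [ln N] at least 1 and [K]; [2 <= s]; [s], then the power [eps] of
   [N], above the logarithms to be saved; [D0 <= X]. *)
have [N1 hN1] := ln_ge_eventually (Num.max 1 K).
have [N2 hN2] := ln_power_le 2 0 t0.
have [N3 hN3] := ln_power_le 1 (6 * n + 27) t0.
have [N4 hN4] := ln_power_le 1 (6 * n + 27) heps.
have [N5 hN5] := ln_power_le 2 (2 * n + 9) u0.
exists (Num.max N1 (Num.max N2 (Num.max N3 (Num.max N4 N5)))); split; first exact: num_real.
move=> N; rewrite !gt_max => /and5P[/ltW/hN1[N1lt LK] /ltW/hN2 s2 /ltW/hN3 sL /ltW/hN4 eL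
    /ltW/hN5 XL].
rewrite expr0 mulr1 in s2; rewrite mul1r in sL; rewrite mul1r in eL.
have N0 : 0 < N by apply: lt_trans N1lt.
have [L1 LK'] : 1 <= ln N /\ K <= ln N by move: LK; rewrite ge_max => /andP.
have L0 : 0 < ln N by apply: lt_le_trans L1.
set X := N `^ u in XL *; set Q := Num.truncn (N `^ (2^-1 * u - eps)).
(* The exponent is halved because [s ^+ 2] must stay below every left endpoint. *)
pose s := N `^ (a0 / 2); rewrite -/s in s2 sL.
have s0 : 0 < s by apply: powR_gt0.
pose h := (Num.truncn (ln N ^+ (n + 4))).+1.
pose D0 := (Num.truncn (ln N ^+ (2 * n + 9))).+1.
pose W := (trunc_log 2 (Num.truncn X + D0)).+1.
have X1 : 1 <= X by rewrite -[leLHS](powRr0 N) ler_powR // ltW.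
have X0 : 0 <= X by apply: le_trans X1.
have succ_bound m : ln N ^+ m <= (Num.truncn (ln N ^+ m)).+1%:R <= 2 * ln N ^+ m.
  have Lm1 : 1 <= ln N ^+ m by apply: exprn_ege1.
  rewrite (ltW (truncnS_gt _)) /=; apply: le_trans (truncnS_le _) _; first by apply:
      le_trans Lm1.
  by rewrite mulrDl mul1r lerD2l.
have hb := succ_bound (n + 4)%N; have Db := succ_bound (2 * n + 9)%N.
have W2 : (Num.truncn X + D0 < 2 ^ W)%N by apply: trunc_log_ltn.
have QX : (Q <= Num.truncn X)%N.
  by apply: le_truncn; rewrite ler_powR ?(ltW N1lt) //; lra.
have QW : (Q < 2 ^ W)%N by apply: leq_ltn_trans W2; apply: leq_trans QX (leq_addr _ _).
have D0W : (D0 < 2 ^ W)%N by apply: leq_ltn_trans W2; apply: leq_addl.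
have XW : X < (2 ^ W)%:R.
  apply: lt_le_trans (truncnS_gt X) _; rewrite ler_nat; apply: leq_ltn_trans W2.
  by apply: leq_addr.
have WL : 0 <= (W%:R : R) <= c * ln N.
  apply/andP; split; first exact: ler0n.
  have DX : D0%:R <= X by case/andP: Db => _ h2; apply: le_trans h2 XL.
  have p1 : 0 < (Num.truncn X + D0)%:R :> R by rewrite ltr0n addn_gt0 orbT.
  have h1 : (2 ^ trunc_log 2 (Num.truncn X + D0))%:R <= 2 * X.
    apply: (@le_trans _ _ (Num.truncn X + D0)%:R).
      by rewrite ler_nat; apply: trunc_logP => //; rewrite addn_gt0 orbT.
    by rewrite natrD mulrDl mul1r lerD // truncn_le.
  have h2 : (trunc_log 2 (Num.truncn X + D0))%:R * ln 2 <= ln 2 + u * ln N.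
    rewrite mulr_natl -lnXn // -natrX.
    apply: (@le_trans _ _ (ln (2 * X))).
      by rewrite ler_ln ?posrE ?ltr0n ?expn_gt0 // mulr_gt0 // (lt_le_trans _ X1).
    by rewrite lnM ?posrE ?(lt_le_trans _ X1) // ln_powR.
  have h3 : (trunc_log 2 (Num.truncn X + D0))%:R <= 1 + u / ln 2 * ln N.
    rewrite -(ler_pM2r ln2) mulrDl mul1r; apply: le_trans h2 _.
    by rewrite lerD2l [leRHS]mulrAC divfK ?gt_eqF.
  rewrite /W -natr1 /c mulrDl; apply: le_trans (lerD h3 (lexx 1)) _.
  by rewrite addrAC lerD2r -[X in X <= _]mulr1 ler_pM2l.
have iL : ln N * (ln N)^-1 = 1 by rewrite divff ?gt_eqF.
have i0 : 0 < (ln N)^-1 by rewrite invr_gt0.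
have i1 : (ln N)^-1 <= 1 by rewrite invf_le1.
have sib : 0 <= s^-1 <= (ln N)^-1 ^+ (6 * n + 27).
  by rewrite invr_ge0 (ltW s0) exprVn lef_pV2 ?posrE ?exprn_gt0.
have s1 : 1 <= s by apply: le_trans s2; rewrite ler1n.
have zib : 0 <= (s ^+ 2)^-1 <= s^-1.
  rewrite invr_ge0 exprn_ge0 ?(ltW s0) // lef_pV2 ?posrE ?exprn_gt0 //.
  by rewrite expr2 ler_peMr // ltW.
(* The range of [q] falls short of the square root of [X] by the power [eps] of [N], which beats any
   power of [ln N]. *)
have Qb : 0 <= (Q%:R : R) * Num.sqrt X <= X * (ln N)^-1 ^+ (6 * n + 27).
  rewrite mulr_ge0 ?sqrtr_ge0 //=.
  have sX : Num.sqrt X = N `^ (2^-1 * u).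
    have p0 : 0 <= N `^ (2^-1 * u) by apply: powR_ge0.
    rewrite -[RHS](ger0_norm p0) -sqrtr_sqr -powR_mulrn // -powRrM.
    by congr (Num.sqrt (_ `^ _)); field.
  have Qle : Q%:R <= N `^ (2^-1 * u - eps) by rewrite truncn_le powR_ge0.
  apply: (@le_trans _ _ (N `^ (2^-1 * u - eps) * N `^ (2^-1 * u))).
    by rewrite sX ler_wpM2r ?powR_ge0.
  have Nn : N != 0 by rewrite gt_eqF.
  rewrite -powRD ?Nn ?implybT // (_ : _ + _ = u - eps); last by field.
  rewrite powRB ?Nn ?implybT // ler_wpM2l // exprVn lef_pV2 ?posrE ?exprn_gt0 //.
  exact: powR_gt0.
have Csb : 0 <= `|C| / ln s ^+ k <= c' * (ln N)^-1 ^+ (6 * n + 26).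
  rewrite /s ln_powR divr_ge0 ?exprn_ge0 ?(mulr_ge0 (ltW t0) (ltW L0)) //=.
  by rewrite /c' -/k exprMn exprVn invfM mulrA.
have zN i : s ^+ 2 <= N `^ a i.
  rewrite /s -powR_mulrn ?powR_ge0 // -powRrM divfK // ler_powR //.
  exact: ltW.
have g0 : 0 <= 2 ^+ r :> R by apply: exprn_ge0.
have t30 : 0 <= 3 ^+ r :> R by apply: exprn_ge0.
have h0 : (0 < h)%N by [].
have D00 : (0 < D0)%N by [].
have := total_bound_le X0 i0 i1 iL c1 c'0 t30 g0 WL hb Db sib zib Qb Csb.
rewrite -/h -/D0 -/K => bound.
have total := sum_progression_error b Pprime r2 X1 s2 erefl zN SWk D00 QW D0W h0 XW.
rewrite big_geq_mkord (eq_bigl (fun q : 'I_Q.+1 => (0 < q)%N && coprime q B)); last first.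
  by move=> q; rewrite andbC.
apply: le_trans total _; apply: le_trans (_ : X * (K * (ln N)^-1 ^+ n.+1) <= _).
  apply: le_trans bound; rewrite natrM le_eqVlt; apply/orP; left; apply/eqP.
  by rewrite -!mulrA.
rewrite mul1r ler_wpM2l // exprSr mulrCA.
(* The spare logarithm absorbs [K], as [K <= ln N]. *)
apply: (@le_trans _ _ ((ln N)^-1 ^+ n)).
  by rewrite ler_piMr ?exprn_ge0 ?(ltW i0) // ler_pdivrMr // mul1r.
rewrite exprVn lef_pV2 ?posrE ?exprn_gt0 ?powR_gt0 // -powR_mulrn ?(ltW L0) //.
by rewrite ler_powR.
Qed.
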